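(* For every integer $n\ge 1$ let $a_n$ be the smallest positive integer such that $n+a_n$ is prime. Then, for real $x\ge 3$, \[ \sum_{n\le x} \frac{1}{a_n} = \frac{x\log\log x}{\log x} + O\!\left(\frac{x}{\log x}\right). \]
   Context: The sum is over positive integers $n\le x$. $f(x)=F(x)+O(g(x))$ means $|f(x)-F(x)|\le C g(x)$ for an absolute constant $C>0$. *)

(* Defs.v *)
From mathcomp Require Import all_boot.

Set Implicit Arguments.
Unset Strict Implicit.
Unset Printing Implicit Defensive.

Lemma prime_shift_exists (n : nat) : exists a, (0 < a) && prime (n + a).
Proof.
have [p lt_np p_pr] := prime_above n.
by exists (p - n); rewrite subn_gt0 lt_np subnKC // ltnW.
Qed.

(* The least a >= 1 such that n + a is prime: it is the distance from n to the
   next prime strictly above n, also when n itself is prime. *)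
Definition next_prime_dist (n : nat) : nat := ex_minn (prime_shift_exists n).

(* Main.v *)
(** Let L = log N and let S be the sum of 1/a_n over n <= N. The n with a_n = j are
    obtained by subtracting j from a prime, so there are at most pi(N) + j of them, and at
    least pi(N) - j - 1 - sum_(i <= j) #{n < N : n and n + i are prime}. Weighting with 1/j
    for j <= L, and bounding the remaining terms by N/L, gives S = pi(N) log log N + O(N/L),
    provided that
    - pi(N) = (N/L) (1 + O(1/log L)), since pi(N) gets multiplied by log L, and
    - sum_(i <= H) #{n < N : n and n + i are prime} = O(H N / L^2).

    The prime number theorem is a Tauberian statement: with Lambda the von Mangoldt function,
    -zeta'/zeta - zeta is Lipschitz and of polynomial growth in the imaginary direction,
    uniformly down to the line Re s = 1 (3-4-1 inequality for a lower bound of zeta).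
    Hence, by a quantitative Riemann-Lebesgue lemma, sums of (Lambda(n) - 1) n^(-s) against
    a Fejer kernel in log n of width 1/T are small for T a small power of log N, and
    integrating the kernel over windows bounds psi on short intervals.

    For prime pairs, each p not dividing 2i gives a function mod p that equals 1 unless p
    divides n (n + i) and has mean zero; their products over square-free l are orthogonal,
    and the second moment of a weighted average of these products is a Selberg-type upper
    bound sieve. *)

Require Import Defs.
From Stdlib Require Reals Lra Lia Psatz.
From Coquelicot Require Coquelicot.
From HB Require structures.
From mathcomp Require ssreflect all_boot.

(** * The Chebyshev function *)

(** The factor log L multiplying pi(N) forces a rate in the prime number theorem: bare asymptotics
    would leave an error o(N log L / L). But a saving of log L is tiny, so polynomial bounds in the
    imaginary direction, with unspecified exponents, are good enough. For sums up to exp y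
    everything is evaluated at s = 1 + 1/y instead of on the line Re s = 1: for n up to exp y the
    weights n^(-s) and 1/n differ by a bounded factor, so the damping costs only a constant, and
    every bound is uniform in s. The pole is removed by subtracting zeta itself, that is, Lambda is
    compared with the constant 1, whose window sums are counted directly.

    In the sieve the weight of l is tau(l)/l, slightly below the optimal one, because its sum can be
    compared with the square of a harmonic sum by elementary factorizations. The bound for pairs
    with difference i contains a divisor sum of 2i that is bounded only on average, which is why
    pairs enter through a sum over i. *)

Module Analytic.
Import Reals Lra Lia Psatz Coquelicot ssreflect.
Set Bullet Behavior "Strict Subproofs".
Open Scope R_scope.

(* Series are indexed from 0: index n stands for the integer n + 1. *)
Definition logS (n : nat) : R := ln (INR (S n)).

(** * Exponential inequalities and absolutely convergent Dirichlet series *)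

Lemma INR_S_pos n : 0 < INR (S n).
Proof. apply lt_0_INR; lia. Qed.

Lemma exp_logS n : exp (logS n) = INR (S n).
Proof. by apply exp_ln, INR_S_pos. Qed.

Lemma logS_ge0 n : 0 <= logS n.
Proof.
rewrite /logS -ln_1. apply ln_le; [lra|]. rewrite S_INR. pose proof (pos_INR n); lra.
Qed.

Lemma exp_ge1 x : 0 <= x -> 1 <= exp x.
Proof. move=> h. rewrite -exp_0. case: (Req_dec x 0) => [->|]; [lra|]. move=> h1. left; apply exp_increasing; lra. Qed.

Lemma exp_mono x y : x <= y -> exp x <= exp y.
Proof. case=> [h|->]; [left; by apply exp_increasing|lra]. Qed.

Lemma exp_lower x : 1 + x <= exp x.
Proof. case: (Req_dec x 0) => [->|h]; [rewrite exp_0; lra|]. left. by apply exp_ineq1. Qed.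

Lemma logS_step n : exp (- logS (S n)) <= logS (S n) - logS n.
Proof.
have h1 := exp_lower (- (logS (S n) - logS n)).
have -> : exp (- logS (S n)) = 1 - exp (- (logS (S n) - logS n)).
{ have -> : - (logS (S n) - logS n) = logS n + - logS (S n) by ring.
  rewrite exp_plus exp_Ropp !exp_logS. have := INR_S_pos n. have := INR_S_pos (S n).
  rewrite (S_INR (S n)). move=> ? ?. field. lra. }
lra.
Qed.

(** Integral test in telescoping form: divided by (N + 2)^(1 - s), the right side is exp ((s - 1) d)
    - 1 with d = [logS (S N) - logS N], and d is at least 1 / (N + 2) by [logS_step]. *)
Lemma zeta_term_le s N : 1 < s ->
  (s - 1) * exp (- s * logS (S N)) <= exp (- (s - 1) * logS N) - exp (- (s - 1) * logS (S N)).
Proof.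
move=> hs.
have -> : exp (- s * logS (S N)) = exp (- (s - 1) * logS (S N)) * exp (- logS (S N)) by rewrite -exp_plus; f_equal; ring.
have -> : exp (- (s - 1) * logS N) = exp (- (s - 1) * logS (S N)) * exp ((s - 1) * (logS (S N) - logS N))
  by rewrite -exp_plus; f_equal; ring.
have h1 := exp_lower ((s - 1) * (logS (S N) - logS N)).
have h2 := logS_step N. have h3 := exp_pos (- (s - 1) * logS (S N)).
have h4 : (s - 1) * exp (- logS (S N)) <= exp ((s - 1) * (logS (S N) - logS N)) - 1 by nra.
nra.
Qed.

Lemma zeta_partial_sum_le (s : R) (N : nat) : 1 < s ->
  sum_n (fun n => exp (- s * logS n)) N <= 1 + / (s - 1) * (1 - exp (- (s - 1) * logS N)).
Proof.
move=> hs. elim: N => [|N IH].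
- rewrite sum_O /logS /= ln_1 !Rmult_0_r exp_0. lra.
- rewrite sum_Sn /plus /=. have h := zeta_term_le s N hs.
  apply: Rle_trans; first by apply Rplus_le_compat_r, IH.
  have -> : exp (- s * logS (S N)) = / (s - 1) * ((s - 1) * exp (- s * logS (S N))) by field; lra.
  have h2 : 0 < / (s - 1) by apply Rinv_0_lt_compat; lra.
  nra.
Qed.

Lemma ex_series_pos_bounded (a : nat -> R) (M : R) :
  (forall n, 0 <= a n) -> (forall N, sum_n a N <= M) -> ex_series a.
Proof.
move=> ha hM.
suff [x hx] : ex_finite_lim_seq (sum_n a) by exists x.
apply: (ex_finite_lim_seq_incr _ M) => // n. rewrite sum_Sn /plus /=. have := ha (S n); lra.
Qed.

Lemma ex_series_exp s : 1 < s -> ex_series (fun n => exp (- s * logS n)).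
Proof.
move=> hs. apply: (ex_series_pos_bounded _ (1 + / (s - 1))) => [n|N].
- left; apply exp_pos.
- apply: Rle_trans; first by apply zeta_partial_sum_le.
  have := exp_pos (- (s - 1) * logS N). have : 0 < / (s - 1) by apply Rinv_0_lt_compat; lra. nra.
Qed.

(** Both 1 and d v / 2 are at most exp (d v / 2), and the resulting bound for 1 + v is squared. This
    is how logarithms are traded for an arbitrarily small power throughout. *)
Lemma log_weight_le (d v : R) : 0 < d -> 0 <= v -> (1 + v) ^ 2 <= (1 + 2 / d) ^ 2 * exp (d * v).
Proof.
move=> hd hv.
have h : 1 + v <= (1 + 2 / d) * exp (d * v / 2).
{ have h1 := exp_lower (d * v / 2). have h2 : 0 < / d by apply Rinv_0_lt_compat.
  have h3 : v = 2 * / d * (d * v / 2) by field; lra.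
  have h4 : 0 <= d * v by nra.
  rewrite /Rdiv. have h5 : v <= 2 * / d * exp (d * v / 2) by rewrite {1}h3; nra. lra. }
have -> : exp (d * v) = exp (d * v / 2) ^ 2.
{ rewrite /= Rmult_1_r -exp_plus. f_equal; field. }
rewrite -Rpow_mult_distr. apply pow_incr. lra.
Qed.

(** A common majorant: the square accommodates a coefficient up to [1 + logS n], and also the factor
    [logS n ^ 2] of a second-order Taylor remainder in s. *)
Definition weight s n := (1 + logS n) ^ 2 * exp (- s * logS n).

Lemma ex_series_weight s : 1 < s -> ex_series (weight s).
Proof.
move=> hs. set d := (s - 1) / 2. have hd : 0 < d by rewrite /d; lra.
apply: (@ex_series_le R_AbsRing R_CompleteNormedModule _
  (fun n => (1 + 2 / d) ^ 2 * exp (- ((1 + s) / 2) * logS n))) => [n|].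
- rewrite /norm /= /abs /= /weight. have hl := logS_ge0 n.
  rewrite Rabs_pos_eq; last by apply Rmult_le_pos; [apply pow_le; lra|left; apply exp_pos].
  have -> : exp (- s * logS n) = exp (- (d * logS n)) * exp (- ((1 + s) / 2) * logS n).
  { rewrite -exp_plus; f_equal. rewrite /d. field. }
  have h := log_weight_le d (logS n) hd hl.
  rewrite -Rmult_assoc. apply Rmult_le_compat_r; first by left; apply exp_pos.
  have h1 : exp (d * logS n) * exp (- (d * logS n)) = 1 by rewrite -exp_plus Rplus_opp_r exp_0.
  have h2 := exp_pos (- (d * logS n)). have := Rmult_le_compat_r _ _ _ (Rlt_le _ _ h2) h. rewrite Rmult_assoc h1 Rmult_1_r. by [].
- apply: (@ex_series_scal R_AbsRing). apply ex_series_exp. lra.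
Qed.

Lemma ex_series_dom s (c : R) (a : nat -> R) :
  1 < s -> (forall n, Rabs (a n) <= c * weight s n) -> ex_series a.
Proof.
move=> hs ha. apply: (@ex_series_le R_AbsRing R_CompleteNormedModule _ (fun n => c * weight s n)).
- exact ha.
- apply: (@ex_series_scal R_AbsRing). by apply ex_series_weight.
Qed.

(* With the angle th = 0, resp. th = - PI / 2, the real, resp. imaginary, part of the
   Dirichlet series of a at s - i t. *)
Definition dterm (a : nat -> R) (s t th : R) n := a n * exp (- s * logS n) * cos (t * logS n + th).
Definition DS a s t th := Series (dterm a s t th).

Definition admissible (a : nat -> R) := forall n, 0 <= a n <= 1 + logS n.

Lemma Rabs_cos_le x : Rabs (cos x) <= 1.
Proof. apply Rabs_le. have := COS_bound x. lra. Qed.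
Lemma Rabs_sin_le x : Rabs (sin x) <= 1.
Proof. apply Rabs_le. have := SIN_bound x. lra. Qed.

Lemma dterm_le a s t th n : admissible a -> Rabs (dterm a s t th n) <= weight s n.
Proof.
move=> ha. rewrite /dterm /weight !Rabs_mult. have := ha n. move=> [h1 h2]. have hl := logS_ge0 n.
rewrite (Rabs_pos_eq (a n)) // (Rabs_pos_eq (exp _)); last by left; apply exp_pos.
have h3 := Rabs_cos_le (t * logS n + th). have h4 := exp_pos (- s * logS n).
have h5 := Rabs_pos (cos (t * logS n + th)).
have h6 : a n <= (1 + logS n) ^ 2 by nra.
apply: (Rle_trans _ (a n * exp (- s * logS n) * 1)).
- apply Rmult_le_compat_l => //. apply Rmult_le_pos; lra.
- rewrite Rmult_1_r. apply Rmult_le_compat_r; lra.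
Qed.

Lemma ex_dterm a s t th : admissible a -> 1 < s -> ex_series (dterm a s t th).
Proof.
move=> ha hs. apply (ex_series_dom s 1) => // n. rewrite Rmult_1_l. by apply dterm_le.
Qed.

(** The addition formula for the cosine, summed. It makes multiplication by a phase exp (- i t y)
    available later, with th = - t y. *)
Lemma DS_rot a s t th : admissible a -> 1 < s ->
  DS a s t th = DS a s t 0 * cos th - DS a s t (- (PI / 2)) * sin th.
Proof.
move=> ha hs. rewrite /DS.
have e0 := ex_dterm a s t 0 ha hs. have e1 := ex_dterm a s t (- (PI / 2)) ha hs.
rewrite -!Series_scal_r -Series_minus; [|by apply ex_series_scal_r|by apply ex_series_scal_r].
apply Series_ext => n. rewrite /dterm Rplus_0_r.
have -> : t * logS n + - (PI / 2) = - (PI / 2 - t * logS n) by ring.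
rewrite cos_neg cos_shift cos_plus. ring.
Qed.

Definition ones (n : nat) := 1.
Lemma admissible_ones : admissible ones.
Proof. move=> n. rewrite /ones. have := logS_ge0 n; lra. Qed.
Lemma admissible_logS : admissible logS.
Proof. move=> n. have := logS_ge0 n; lra. Qed.

(** * Comparison of series with integrals; polar parts of zeta and zeta' *)

Lemma mvt (f df : R -> R) a b : a <= b ->
  (forall x, a <= x <= b -> is_derive f x (df x)) ->
  exists c, a <= c <= b /\ f b - f a = df c * (b - a).
Proof.
move=> hab hf.
have := MVT_gen f a b df. rewrite Rmin_left // Rmax_right //. apply.
- move=> x hx. apply hf; lra.
- move=> x hx. apply continuity_pt_filterlim.
  apply (@ex_derive_continuous R_AbsRing R_NormedModule). exists (df x). by apply hf.
Qed.

Lemma lipschitz_of_derive (f df : R -> R) a b B :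
  (forall x, Rmin a b <= x <= Rmax a b -> is_derive f x (df x)) ->
  (forall x, Rmin a b <= x <= Rmax a b -> Rabs (df x) <= B) ->
  Rabs (f a - f b) <= B * Rabs (a - b).
Proof.
wlog hab : a b / a <= b.
{ move=> H. case: (Rle_dec a b) => h; first by apply H.
  rewrite Rmin_comm Rmax_comm (Rabs_minus_sym (f a)) (Rabs_minus_sym a). apply H; lra. }
rewrite Rmin_left // Rmax_right // => hf hB.
have [c [hc h]] := mvt f df a b hab hf.
rewrite (Rabs_minus_sym (f a)) (Rabs_minus_sym a) h Rabs_mult.
apply Rmult_le_compat_r; [apply Rabs_pos|by apply hB].
Qed.

Lemma mvt_term (f F df : R -> R) (x B : R) :
  (forall u, x <= u <= x + 1 -> is_derive F u (f u)) ->
  (forall u, x <= u <= x + 1 -> is_derive f u (df u)) ->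
  (forall u, x <= u <= x + 1 -> Rabs (df u) <= B) ->
  Rabs (f x - (F (x + 1) - F x)) <= B.
Proof.
move=> hF hf hB.
have [c [hc ->]] := mvt F f x (x + 1) ltac:(lra) hF.
have -> : f c * (x + 1 - x) = f c by ring.
have h : Rabs (f x - f c) <= B * Rabs (x - c).
{ apply (lipschitz_of_derive f df) => y; rewrite Rmin_left ?Rmax_right; try lra; move=> hy; [apply hf|apply hB]; lra. }
apply: (Rle_trans _ _ _ h). have h0 := Rle_trans _ _ _ (Rabs_pos _) (hB x ltac:(lra)).
have : Rabs (x - c) <= 1 by apply Rabs_le; lra. nra.
Qed.

(** First-order Euler-Maclaurin: each term differs from the integral over the next unit interval by
    at most the supremum of [dH] there, and these suprema are summable like n^(-3/2). *)
Lemma sum_vs_integral (H F dH : R -> R) c N : 0 <= c ->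
  (forall u, 1 <= u -> is_derive F u (H u)) ->
  (forall u, 1 <= u -> is_derive H u (dH u)) ->
  (forall u, 1 <= u -> Rabs (dH u) <= c * exp (- (3 / 2) * ln u)) ->
  Rabs (sum_n (fun n => H (INR (S n))) N - (F (INR (S (S N))) - F 1)) <= c * 3.
Proof.
move=> hc hF hH hdH.
have hterm n : Rabs (H (INR (S n)) - (F (INR (S (S n))) - F (INR (S n)))) <= c * exp (- (3 / 2) * logS n).
{ rewrite (S_INR (S n)). have h1 : 1 <= INR (S n) by rewrite S_INR; have := pos_INR n; lra.
  apply (mvt_term H F dH) => u hu; [apply hF|apply hH|]; try lra.
  apply: Rle_trans; first by apply hdH; lra.
  apply Rmult_le_compat_l => //. apply exp_mono. rewrite /logS.
  have := ln_le (INR (S n)) u ltac:(lra) ltac:(lra). lra. }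
apply: (Rle_trans _ (c * sum_n (fun n => exp (- (3 / 2) * logS n)) N)).
- elim: N => [|N IH].
  + rewrite !sum_O. apply (hterm O).
  + rewrite !sum_Sn /plus /= Rmult_plus_distr_l.
    have := hterm (S N). move: IH. rewrite -!/(INR (S _)).
    set A := sum_n _ _. set B := H (INR _). set U := F _. set V := F 1. set W := F _. move=> IH h.
    have -> : A + B - (W - V) = (A - (U - V)) + (B - (W - U)) by ring.
    apply: Rle_trans; first apply Rabs_triang. lra.
(* The 3 is 1 + 1 / (3/2 - 1), a bound for zeta(3/2). *)
- apply Rmult_le_compat_l => //. apply: Rle_trans; first by apply zeta_partial_sum_le; lra.
  have := exp_pos (- (3 / 2 - 1) * logS N). lra.
Qed.

Lemma is_lim_seq_logS : is_lim_seq logS p_infty.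
Proof.
apply is_lim_seq_spec => M. have [N hN] := INR_unbounded (exp M). exists N => n hn.
rewrite /logS -{1}(ln_exp M). apply ln_increasing; first apply exp_pos.
apply: (Rlt_le_trans _ _ _ hN). apply le_INR. lia.
Qed.

Lemma lim_exp_logS a : 0 < a -> is_lim_seq (fun n => exp (- a * logS n)) 0.
Proof.
move=> ha. apply (is_lim_comp_seq exp (fun n => - a * logS n) m_infty 0).
- apply is_lim_exp_m.
- exists O => n _ . by [].
- apply is_lim_seq_spec => M. have /is_lim_seq_spec /(_ (- M / a)) [N hN] := is_lim_seq_logS.
  exists N => n hn. have := hN n hn. have -> : - M / a = - M * / a by []. move=> h.
  have h1 : a * (- M * / a) < a * logS n by apply Rmult_lt_compat_l.
  have h2 : a * (- M * / a) = - M by field; lra. lra.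
Qed.

(** The boundary term at infinity vanishes because F decays, so the series is - F 1, the integral of
    H over [1, oo), up to an error that involves neither M nor a. Applied to n^(-s) cos (t log n)
    this isolates the pole uniformly as s tends to 1. *)
Lemma series_vs_integral (H F dH : R -> R) c a M S0 : 0 <= c -> 0 < a ->
  (forall u, 1 <= u -> is_derive F u (H u)) ->
  (forall u, 1 <= u -> is_derive H u (dH u)) ->
  (forall u, 1 <= u -> Rabs (dH u) <= c * exp (- (3 / 2) * ln u)) ->
  (forall u, 1 <= u -> Rabs (F u) <= M * exp (- a * ln u)) ->
  is_series (fun n => H (INR (S n))) S0 -> Rabs (S0 + F 1) <= c * 3.
Proof.
move=> hc ha hF hH hdH hM hS.
have hl : is_lim_seq (fun N => F (INR (S (S N)))) 0.
{ apply is_lim_seq_abs_0.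
  apply (is_lim_seq_le_le (fun _ => 0) _ (fun N => M * exp (- a * logS (S N)))).
  - move=> n; split; first apply Rabs_pos. apply hM. rewrite S_INR; have := pos_INR (S n); lra.
  - apply is_lim_seq_const.
  - have -> : Finite 0 = Rbar_mult M 0 by rewrite /= Rmult_0_r.
    apply is_lim_seq_scal_l. apply (is_lim_seq_incr_1 (fun n => exp (- a * logS n))). by apply lim_exp_logS. }
have hlim : is_lim_seq (fun N => Rabs (sum_n (fun n => H (INR (S n))) N - (F (INR (S (S N))) - F 1))) (Rabs (S0 + F 1)).
{ apply (is_lim_seq_abs _ (S0 + F 1)).
  have -> : S0 + F 1 = S0 - (0 - F 1) by ring.
  apply is_lim_seq_minus'; first exact hS.
  apply is_lim_seq_minus'; [exact hl|apply is_lim_seq_const]. }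
apply (is_lim_seq_le _ (fun _ => c * 3) (Rabs (S0 + F 1)) (c * 3)) in hlim => //; last apply is_lim_seq_const.
move=> n. by apply: sum_vs_integral hF hH hdH.
Qed.

(* zeta_prim and logzeta_prim are primitives of zeta_fun and logzeta_fun; the opposites of
   their values at 1 are the polar parts of zeta and - zeta' at s - i t. *)
Definition zeta_fun s t th u := exp (- s * ln u) * cos (t * ln u + th).
Definition logzeta_fun s t th u := ln u * exp (- s * ln u) * cos (t * ln u + th).
Definition zeta_prim s t th u := exp (- (s - 1) * ln u) *
  (- (s - 1) * cos (t * ln u + th) + t * sin (t * ln u + th)) / ((s - 1) ^ 2 + t ^ 2).
Definition logzeta_prim s t th u := ln u * zeta_prim s t th u - exp (- (s - 1) * ln u) *
  (((s - 1) ^ 2 - t ^ 2) * cos (t * ln u + th) - 2 * (s - 1) * t * sin (t * ln u + th)) / ((s - 1) ^ 2 + t ^ 2) ^ 2.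
Definition zeta_dfun s t th v := - s * cos (t * v + th) - t * sin (t * v + th).
Definition logzeta_dfun s t th v := (1 - s * v) * cos (t * v + th) - t * v * sin (t * v + th).

Lemma exp_shift s u : 0 < u -> exp (- (s - 1) * ln u) = exp (- s * ln u) * u.
Proof. move=> hu. rewrite -{3}(exp_ln u) // -exp_plus. f_equal; ring. Qed.

Lemma is_derive_zeta_prim s t th u : 1 < s -> 1 <= u -> is_derive (zeta_prim s t th) u (zeta_fun s t th u).
Proof.
move=> hs hu. rewrite /zeta_prim /zeta_fun. auto_derive; first by split; lra.
rewrite (exp_shift s u); last lra. simpl. field. split; nra.
Qed.

Lemma is_derive_logzeta_prim s t th u : 1 < s -> 1 <= u -> is_derive (logzeta_prim s t th) u (logzeta_fun s t th u).
Proof.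
move=> hs hu. rewrite /logzeta_prim /logzeta_fun /zeta_prim. auto_derive; first by split; lra.
rewrite (exp_shift s u); last lra. simpl. field. split; nra.
Qed.

Lemma is_derive_zeta_fun s t th u : 1 <= u -> is_derive (zeta_fun s t th) u (exp (- (s + 1) * ln u) * zeta_dfun s t th (ln u)).
Proof.
move=> hu. rewrite /zeta_fun /zeta_dfun. auto_derive; first by split; lra.
have -> : exp (- s * ln u) = exp (- (s + 1) * ln u) * u.
{ rewrite -{3}(exp_ln u); last lra. rewrite -exp_plus. f_equal; ring. }
field. lra.
Qed.

Lemma is_derive_logzeta_fun s t th u : 1 <= u -> is_derive (logzeta_fun s t th) u (exp (- (s + 1) * ln u) * logzeta_dfun s t th (ln u)).
Proof.
move=> hu. rewrite /logzeta_fun /logzeta_dfun. auto_derive; first by split; lra.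
have -> : exp (- s * ln u) = exp (- (s + 1) * ln u) * u.
{ rewrite -{3}(exp_ln u); last lra. rewrite -exp_plus. f_equal; ring. }
field. lra.
Qed.

Lemma Rabs_lin2 a b c d : Rabs c <= 1 -> Rabs d <= 1 -> Rabs (a * c + b * d) <= Rabs a + Rabs b.
Proof.
move=> hc hd. apply: Rle_trans; first apply Rabs_triang. rewrite !Rabs_mult.
have := Rabs_pos a. have := Rabs_pos b. nra.
Qed.

Lemma zeta_dfun_le s t th v : 1 < s <= 2 -> 0 <= v -> Rabs (zeta_dfun s t th v) <= (3 + Rabs t) * (1 + v) ^ 2.
Proof.
move=> hs hv. rewrite /zeta_dfun.
have -> : - s * cos (t * v + th) - t * sin (t * v + th) = (- s) * cos (t * v + th) + (- t) * sin (t * v + th) by ring.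
apply: Rle_trans; first by apply Rabs_lin2; [apply Rabs_cos_le|apply Rabs_sin_le].
rewrite !Rabs_Ropp (Rabs_pos_eq s); last lra. have := Rabs_pos t.
have : 1 <= (1 + v) ^ 2 by nra. nra.
Qed.

Lemma logzeta_dfun_le s t th v : 1 < s <= 2 -> 0 <= v -> Rabs (logzeta_dfun s t th v) <= (3 + Rabs t) * (1 + v) ^ 2.
Proof.
move=> hs hv. rewrite /logzeta_dfun.
have -> : (1 - s * v) * cos (t * v + th) - t * v * sin (t * v + th)
  = (1 - s * v) * cos (t * v + th) + (- (t * v)) * sin (t * v + th) by ring.
apply: Rle_trans; first by apply Rabs_lin2; [apply Rabs_cos_le|apply Rabs_sin_le].
rewrite !Rabs_Ropp Rabs_mult (Rabs_pos_eq v) //. have h := Rabs_pos t.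
have : Rabs (1 - s * v) <= 1 + 2 * v by apply Rabs_le; nra.
have : 1 + 2 * v <= (1 + v) ^ 2 by nra. nra.
Qed.

Lemma Rabs_hull T t t' x : Rabs t <= T -> Rabs t' <= T -> Rmin t t' <= x <= Rmax t t' -> Rabs x <= T.
Proof.
move=> /Rabs_le_between h /Rabs_le_between h'. rewrite /Rmin /Rmax.
case: Rle_dec => _ hx; apply Rabs_le; lra.
Qed.

Lemma zeta_dfun_lip s t t' th v T : 1 < s <= 2 -> 0 <= v -> Rabs t <= T -> Rabs t' <= T ->
  Rabs (zeta_dfun s t th v - zeta_dfun s t' th v) <= (3 + T) * (1 + v) ^ 2 * Rabs (t - t').
Proof.
move=> hs hv ht ht'.
apply (lipschitz_of_derive (fun t => zeta_dfun s t th v)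
  (fun t => (s * v - 1) * sin (t * v + th) + (- (t * v)) * cos (t * v + th))).
- move=> x _. rewrite /zeta_dfun. auto_derive => //. ring.
- move=> x /(Rabs_hull T _ _ _ ht ht') hx.
  apply: Rle_trans; first by apply Rabs_lin2; [apply Rabs_sin_le|apply Rabs_cos_le].
  rewrite !Rabs_Ropp Rabs_mult (Rabs_pos_eq v) //. have h := Rabs_pos x.
  have : Rabs (s * v - 1) <= 1 + 2 * v by apply Rabs_le; nra.
  have : 1 + 2 * v <= (1 + v) ^ 2 by nra. nra.
Qed.

Lemma logzeta_dfun_lip s t t' th v T : 1 < s <= 2 -> 0 <= v -> Rabs t <= T -> Rabs t' <= T ->
  Rabs (logzeta_dfun s t th v - logzeta_dfun s t' th v) <= (3 + T) * (1 + v) ^ 2 * Rabs (t - t').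
Proof.
move=> hs hv ht ht'.
apply (lipschitz_of_derive (fun t => logzeta_dfun s t th v)
  (fun t => (s * v ^ 2 - 2 * v) * sin (t * v + th) + (- (t * v ^ 2)) * cos (t * v + th))).
- move=> x _. rewrite /logzeta_dfun. auto_derive => //. ring.
- move=> x /(Rabs_hull T _ _ _ ht ht') hx.
  apply: Rle_trans; first by apply Rabs_lin2; [apply Rabs_sin_le|apply Rabs_cos_le].
  rewrite !Rabs_Ropp Rabs_mult (Rabs_pos_eq (v ^ 2)); last nra. have h := Rabs_pos x.
  have : Rabs (s * v ^ 2 - 2 * v) <= 2 * v ^ 2 + 2 * v by apply Rabs_le; nra. nra.
Qed.

Ltac Rring := match goal with |- @eq _ ?a ?b => change (@eq R a b); ring end.

(** Here M may blow up at the pole: the bound only serves to make the boundary term at infinity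
    vanish for fixed s and t. *)
Lemma zeta_prim_decay s t th : 1 < s -> exists M, forall u, 1 <= u ->
  Rabs (zeta_prim s t th u) <= M * exp (- ((s - 1) / 2) * ln u).
Proof.
move=> hs. set q := (s - 1) ^ 2 + t ^ 2. have hq : 0 < q by rewrite /q; nra.
exists ((s - 1 + Rabs t) * / q) => u hu. rewrite /zeta_prim -/q /Rdiv.
have hv : 0 <= ln u by rewrite -ln_1; apply ln_le; lra.
rewrite !Rabs_mult (Rabs_pos_eq (exp _)); last by left; apply exp_pos.
rewrite (Rabs_pos_eq (/ q)); last by left; apply Rinv_0_lt_compat.
have h1 : exp (- (s - 1) * ln u) <= exp (- ((s - 1) / 2) * ln u) by apply exp_mono; nra.
have h2 := Rabs_lin2 (- (s - 1)) t _ _ (Rabs_cos_le (t * ln u + th)) (Rabs_sin_le (t * ln u + th)).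
rewrite Rabs_Ropp (Rabs_pos_eq (s - 1)) in h2; last lra.
have h3 := exp_pos (- (s - 1) * ln u).
rewrite (Rmult_comm (exp _)) Rmult_assoc (Rmult_comm (exp _)) -Rmult_assoc.
apply Rmult_le_compat => //; try lra.
- apply Rmult_le_pos; [apply Rabs_pos|left; by apply Rinv_0_lt_compat].
- apply Rmult_le_compat_r => //. left; by apply Rinv_0_lt_compat.
Qed.

Lemma logzeta_prim_decay s t th : 1 < s -> exists M, forall u, 1 <= u ->
  Rabs (logzeta_prim s t th u) <= M * exp (- ((s - 1) / 2) * ln u).
Proof.
move=> hs. set q := (s - 1) ^ 2 + t ^ 2. have hq : 0 < q by rewrite /q; nra.
have hiq : 0 < / q by apply Rinv_0_lt_compat.
set A := (s - 1 + Rabs t) * / q.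
set B := (((s - 1) ^ 2 + t ^ 2) + 2 * (s - 1) * Rabs t) * / q ^ 2.
have hA : 0 <= A by apply Rmult_le_pos; [have := Rabs_pos t|]; lra.
have hiq2 : 0 < / q ^ 2 by apply Rinv_0_lt_compat, pow_lt.
have hB : 0 <= B.
{ apply Rmult_le_pos; last lra. have h := Rabs_pos t.
  have : 0 <= (s - 1) * Rabs t by apply Rmult_le_pos; lra. nra. }
have hd : 0 < (s - 1) / 2 by lra.
exists ((1 + 2 / ((s - 1) / 2)) ^ 2 * A + B) => u hu.
have hv : 0 <= ln u by rewrite -ln_1; apply ln_le; lra.
have h1 : exp (- (s - 1) * ln u) <= exp (- ((s - 1) / 2) * ln u) by apply exp_mono; nra.
have h3 := exp_pos (- (s - 1) * ln u).
have hlog : ln u * exp (- (s - 1) * ln u) <= (1 + 2 / ((s - 1) / 2)) ^ 2 * exp (- ((s - 1) / 2) * ln u).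
{ have h4 := log_weight_le _ _ hd hv.
  have h5 := Rmult_le_compat_r _ _ _ (Rlt_le _ _ h3) h4.
  rewrite Rmult_assoc -exp_plus in h5.
  have e : (s - 1) / 2 * ln u + - (s - 1) * ln u = - ((s - 1) / 2) * ln u by field.
  rewrite e in h5. apply: Rle_trans h5. apply Rmult_le_compat_r; nra. }
rewrite /logzeta_prim. apply: Rle_trans; first apply Rabs_triang. rewrite Rabs_Ropp Rmult_plus_distr_r.
apply Rplus_le_compat.
- rewrite /zeta_prim -/q /Rdiv !Rabs_mult (Rabs_pos_eq (ln u)) // (Rabs_pos_eq (exp _)); last lra.
  rewrite (Rabs_pos_eq (/ q)); last lra.
  have h2 := Rabs_lin2 (- (s - 1)) t _ _ (Rabs_cos_le (t * ln u + th)) (Rabs_sin_le (t * ln u + th)).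
  rewrite Rabs_Ropp (Rabs_pos_eq (s - 1)) in h2; last lra.
  apply: (Rle_trans _ ((ln u * exp (- (s - 1) * ln u)) *
    (Rabs (- (s - 1) * cos (t * ln u + th) + t * sin (t * ln u + th)) * / q))); first by right; ring.
  have -> : (1 + 2 * / ((s - 1) * / 2)) ^ 2 * A * exp (- ((s - 1) * / 2) * ln u)
    = (1 + 2 / ((s - 1) / 2)) ^ 2 * exp (- ((s - 1) / 2) * ln u) * A by rewrite /Rdiv; ring.
  apply Rmult_le_compat => //; first by apply Rmult_le_pos; lra.
  + apply Rmult_le_pos; [apply Rabs_pos|lra].
  + apply Rmult_le_compat_r => //. lra.
- rewrite -/q /Rdiv !Rabs_mult (Rabs_pos_eq (exp _)); last lra.
  rewrite (Rabs_pos_eq (/ q ^ 2)); last lra.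
  have h2 := Rabs_lin2 ((s - 1) ^ 2 - t ^ 2) (- (2 * (s - 1) * t)) _ _ (Rabs_cos_le (t * ln u + th)) (Rabs_sin_le (t * ln u + th)).
  have h5 : Rabs ((s - 1) ^ 2 - t ^ 2) <= (s - 1) ^ 2 + t ^ 2
    by apply Rabs_le; have := pow2_ge_0 (s - 1); have := pow2_ge_0 t; lra.
  rewrite Rabs_Ropp Rabs_mult (Rabs_pos_eq (2 * (s - 1))) in h2; last lra.
  rewrite Rmult_assoc (Rmult_comm B). apply Rmult_le_compat => //; try lra.
  + apply Rmult_le_pos; [apply Rabs_pos|lra].
  + apply Rmult_le_compat_r; first lra. apply: Rle_trans; last first.
    * apply Rplus_le_compat_r. exact h5.
    * apply: Rle_trans h2. right. f_equal. ring.
Qed.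

(** Since s + 1 > 2, an exponent 1/2 is given up to absorb (1 + v)^2, and 3/2 remains for
    summability. The constant of [log_weight_le] at d = 1/2 is 25. *)
Lemma kernel_bound s A v Q : 1 < s -> 0 <= v -> 0 <= A -> Rabs Q <= A * (1 + v) ^ 2 ->
  Rabs (exp (- (s + 1) * v) * Q) <= 25 * A * exp (- (3 / 2) * v).
Proof.
move=> hs hv hA hQ. rewrite Rabs_mult (Rabs_pos_eq (exp _)); last by left; apply exp_pos.
have h1 : exp (- (s + 1) * v) <= exp (- (3 / 2) * v) * exp (- (/ 2 * v)) by rewrite -exp_plus; apply exp_mono; nra.
have h2 := log_weight_le (/ 2) v ltac:(lra) hv.
have e : (1 + 2 / (/ 2)) ^ 2 = 25 by field. rewrite e in h2.
have h3 : exp (/ 2 * v) * exp (- (/ 2 * v)) = 1 by rewrite -exp_plus Rplus_opp_r exp_0.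
have p1 := exp_pos (- (/ 2 * v)). have p2 := exp_pos (- (3 / 2) * v).
have h4 : (1 + v) ^ 2 * exp (- (/ 2 * v)) <= 25.
{ have := Rmult_le_compat_r _ _ _ (Rlt_le _ _ p1) h2. rewrite Rmult_assoc h3. lra. }
apply: (Rle_trans _ (exp (- (3 / 2) * v) * exp (- (/ 2 * v)) * (A * (1 + v) ^ 2))).
- apply Rmult_le_compat => //; [left; apply exp_pos|apply Rabs_pos].
- have -> : exp (- (3 / 2) * v) * exp (- (/ 2 * v)) * (A * (1 + v) ^ 2)
    = (A * exp (- (3 / 2) * v)) * ((1 + v) ^ 2 * exp (- (/ 2 * v))) by ring.
  have -> : 25 * A * exp (- (3 / 2) * v) = (A * exp (- (3 / 2) * v)) * 25 by ring.
  apply Rmult_le_compat_l => //. apply Rmult_le_pos; lra.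
Qed.

(** The number [- zeta_prim s t th 1] is the component of 1 / (s - 1 - i t) at the angle th, so this
    bounds zeta minus its pole, with linear growth in t and no singularity as s tends to 1, even at
    t = 0. *)
Lemma zeta_remainder s t th : 1 < s <= 2 -> Rabs (DS ones s t th + zeta_prim s t th 1) <= 25 * (3 + Rabs t) * 3.
Proof.
move=> hs. have [M hM] := zeta_prim_decay s t th ltac:(lra). have ht := Rabs_pos t.
apply (series_vs_integral (zeta_fun s t th) (zeta_prim s t th) (fun u => exp (- (s + 1) * ln u) * zeta_dfun s t th (ln u)) _ ((s - 1) / 2) M);
  try lra.
- move=> u hu. apply is_derive_zeta_prim; lra.
- move=> u hu. apply is_derive_zeta_fun; lra.
- move=> u hu. have hv : 0 <= ln u by rewrite -ln_1; apply ln_le; lra.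
  apply kernel_bound; try lra. by apply zeta_dfun_le.
- exact hM.
- refine (is_series_ext (dterm ones s t th) _ _ _ (Series_correct _ (ex_dterm ones s t th admissible_ones _))); last lra.
  move=> n. rewrite /dterm /zeta_fun /ones /logS. Rring.
Qed.

Lemma logzeta_remainder s t th : 1 < s <= 2 -> Rabs (DS logS s t th + logzeta_prim s t th 1) <= 25 * (3 + Rabs t) * 3.
Proof.
move=> hs. have [M hM] := logzeta_prim_decay s t th ltac:(lra). have ht := Rabs_pos t.
apply (series_vs_integral (logzeta_fun s t th) (logzeta_prim s t th) (fun u => exp (- (s + 1) * ln u) * logzeta_dfun s t th (ln u)) _ ((s - 1) / 2) M);
  try lra.
- move=> u hu. apply is_derive_logzeta_prim; lra.
- move=> u hu. apply is_derive_logzeta_fun; lra.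
- move=> u hu. have hv : 0 <= ln u by rewrite -ln_1; apply ln_le; lra.
  apply kernel_bound; try lra. by apply logzeta_dfun_le.
- exact hM.
- refine (is_series_ext (dterm logS s t th) _ _ _ (Series_correct _ (ex_dterm logS s t th admissible_logS _))); last lra.
  move=> n. by rewrite /dterm /logzeta_fun /logS.
Qed.

(** The comparison with the integral is applied to the difference of the integrands at t and t',
    whose derivative in u already carries the factor |t - t'|. *)
Lemma zeta_remainder_lip s t t' th T : 1 < s <= 2 -> Rabs t <= T -> Rabs t' <= T ->
  Rabs ((DS ones s t th + zeta_prim s t th 1) - (DS ones s t' th + zeta_prim s t' th 1)) <= 25 * ((3 + T) * Rabs (t - t')) * 3.
Proof.
move=> hs ht ht'. have [M hM] := zeta_prim_decay s t th ltac:(lra). have [M' hM'] := zeta_prim_decay s t' th ltac:(lra).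
have hT := Rabs_pos t. have hp := Rabs_pos (t - t').
have -> : (DS ones s t th + zeta_prim s t th 1) - (DS ones s t' th + zeta_prim s t' th 1) =
  (DS ones s t th - DS ones s t' th) + (zeta_prim s t th 1 - zeta_prim s t' th 1) by ring.
have hc : 0 <= (3 + T) * Rabs (t - t') by apply Rmult_le_pos; lra.
apply (series_vs_integral (fun u => zeta_fun s t th u - zeta_fun s t' th u) (fun u => zeta_prim s t th u - zeta_prim s t' th u)
  (fun u => exp (- (s + 1) * ln u) * zeta_dfun s t th (ln u) - exp (- (s + 1) * ln u) * zeta_dfun s t' th (ln u)) _ ((s - 1) / 2) (M + M'));
  try lra.
- move=> u hu. apply (@is_derive_minus R_AbsRing); apply is_derive_zeta_prim; lra.
- move=> u hu. apply (@is_derive_minus R_AbsRing); apply is_derive_zeta_fun; lra.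
- move=> u hu. have hv : 0 <= ln u by rewrite -ln_1; apply ln_le; lra.
  rewrite -Rmult_minus_distr_l. apply kernel_bound; try lra.
  have := zeta_dfun_lip s t t' th _ T hs hv ht ht'. nra.
- move=> u hu. apply: Rle_trans; first apply Rabs_triang. rewrite Rabs_Ropp.
  have := hM u hu. have := hM' u hu. nra.
- have h := Series_correct _ (ex_dterm ones s t th admissible_ones ltac:(lra)).
  have h' := Series_correct _ (ex_dterm ones s t' th admissible_ones ltac:(lra)).
  refine (is_series_ext _ _ _ _ (is_series_minus _ _ _ _ h h')) => n. rewrite /dterm /zeta_fun /ones /logS /plus /opp /=. Rring.
Qed.

Lemma logzeta_remainder_lip s t t' th T : 1 < s <= 2 -> Rabs t <= T -> Rabs t' <= T ->
  Rabs ((DS logS s t th + logzeta_prim s t th 1) - (DS logS s t' th + logzeta_prim s t' th 1)) <= 25 * ((3 + T) * Rabs (t - t')) * 3.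
Proof.
move=> hs ht ht'. have [M hM] := logzeta_prim_decay s t th ltac:(lra). have [M' hM'] := logzeta_prim_decay s t' th ltac:(lra).
have hT := Rabs_pos t. have hp := Rabs_pos (t - t').
have -> : (DS logS s t th + logzeta_prim s t th 1) - (DS logS s t' th + logzeta_prim s t' th 1) =
  (DS logS s t th - DS logS s t' th) + (logzeta_prim s t th 1 - logzeta_prim s t' th 1) by ring.
have hc : 0 <= (3 + T) * Rabs (t - t') by apply Rmult_le_pos; lra.
apply (series_vs_integral (fun u => logzeta_fun s t th u - logzeta_fun s t' th u) (fun u => logzeta_prim s t th u - logzeta_prim s t' th u)
  (fun u => exp (- (s + 1) * ln u) * logzeta_dfun s t th (ln u) - exp (- (s + 1) * ln u) * logzeta_dfun s t' th (ln u)) _ ((s - 1) / 2) (M + M'));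
  try lra.
- move=> u hu. apply (@is_derive_minus R_AbsRing); apply is_derive_logzeta_prim; lra.
- move=> u hu. apply (@is_derive_minus R_AbsRing); apply is_derive_logzeta_fun; lra.
- move=> u hu. have hv : 0 <= ln u by rewrite -ln_1; apply ln_le; lra.
  rewrite -Rmult_minus_distr_l. apply kernel_bound; try lra.
  have := logzeta_dfun_lip s t t' th _ T hs hv ht ht'. nra.
- move=> u hu. apply: Rle_trans; first apply Rabs_triang. rewrite Rabs_Ropp.
  have := hM u hu. have := hM' u hu. nra.
- have h := Series_correct _ (ex_dterm logS s t th admissible_logS ltac:(lra)).
  have h' := Series_correct _ (ex_dterm logS s t' th admissible_logS ltac:(lra)).
  refine (is_series_ext _ _ _ _ (is_series_minus _ _ _ _ h h')) => n. rewrite /dterm /logzeta_fun /logS /plus /opp /=. Rring.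
Qed.

(** * Finite sums, the derivative in s, and the Dirichlet product *)

Lemma sum_n_le (a b : nat -> R) N : (forall n, a n <= b n) -> sum_n a N <= sum_n b N.
Proof.
move=> h. elim: N => [|N IH]; first by rewrite !sum_O.
rewrite !sum_Sn /plus /=. have := h (S N). lra.
Qed.

Lemma sum_n_mono (a : nat -> R) N N' : (forall n, 0 <= a n) -> (N <= N')%nat -> sum_n a N <= sum_n a N'.
Proof.
move=> h. elim=> [|N1 _ IH]; first lra.
rewrite sum_Sn /plus /=. have := h (S N1). lra.
Qed.

Lemma sum_n_ge0 (a : nat -> R) N : (forall n, 0 <= a n) -> 0 <= sum_n a N.
Proof.
move=> h. elim: N => [|N IH]; first by rewrite sum_O.
rewrite sum_Sn /plus /=. have := h (S N). lra.
Qed.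

Lemma Rabs_sum_n (a : nat -> R) N : Rabs (sum_n a N) <= sum_n (fun n => Rabs (a n)) N.
Proof.
elim: N => [|N IH]; first by rewrite !sum_O; lra.
rewrite !sum_Sn /plus /=. apply: Rle_trans; first apply Rabs_triang. lra.
Qed.

Lemma sum_n_scal_l (c : R) (a : nat -> R) N : c * sum_n a N = sum_n (fun n => c * a n) N.
Proof.
elim: N => [|N IH]; first by rewrite !sum_O.
rewrite !sum_Sn /plus /= -IH. ring.
Qed.

Lemma sum_n_minusR (a b : nat -> R) N : sum_n a N - sum_n b N = sum_n (fun n => a n - b n) N.
Proof.
elim: N => [|N IH]; first by rewrite !sum_O.
rewrite !sum_Sn /plus /= -IH. ring.
Qed.

Lemma sum_n_prod (a b : nat -> R) N M : sum_n a N * sum_n b M = sum_n (fun m => sum_n (fun k => a m * b k) M) N.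
Proof.
elim: N => [|N IH]; first by rewrite !sum_O sum_n_scal_l.
rewrite !sum_Sn /plus /= -IH -sum_n_scal_l. ring.
Qed.

Lemma exp_taylor x : 0 <= exp x - 1 - x <= x ^ 2 * exp (Rabs x).
Proof.
have h1 := exp_lower x. split; first lra.
have h2 : exp x - 1 <= x * exp x.
{ have := exp_lower (- x). have e : exp (- x) * exp x = 1 by rewrite -exp_plus Rplus_opp_l exp_0.
  have := exp_pos x. nra. }
case: (Rle_dec 0 x) => hx.
- rewrite Rabs_pos_eq //. nra.
- have h3 : 1 <= exp (Rabs x) by apply exp_ge1, Rabs_pos. nra.
Qed.

(* Differentiates a series termwise without uniform convergence, from a second-order bound. *)
Lemma is_derive_quadratic (f : R -> R) x D C d : 0 < d ->
  (forall h, Rabs h <= d -> Rabs (f (x + h) - f x - h * D) <= C * h ^ 2) -> is_derive f x D.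
Proof.
move=> hd H. apply is_derive_Reals => eps heps.
have hC : 0 <= C.
{ have hdd : Rabs d <= d by rewrite Rabs_pos_eq; lra.
  have h1 := Rle_trans _ _ _ (Rabs_pos _) (H d hdd). have h2 : 0 < d ^ 2 by nra.
  case: (Rle_dec 0 C) => // h3. nra. }
have hdel : 0 < Rmin d (eps / (C + 1)).
{ apply Rmin_pos => //. apply Rdiv_lt_0_compat; lra. }
exists (mkposreal _ hdel) => h h0 /= hh.
have h1 : Rabs h <= d by have := Rmin_l d (eps / (C + 1)); lra.
have h2 : Rabs h < eps / (C + 1) by have := Rmin_r d (eps / (C + 1)); lra.
have hp := Rabs_pos_lt h h0.
have -> : (f (x + h) - f x) / h - D = (f (x + h) - f x - h * D) / h by field.
rewrite /Rdiv Rabs_mult Rabs_inv.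
apply: (Rle_lt_trans _ (C * h ^ 2 * / Rabs h)).
- apply Rmult_le_compat_r; [left; by apply Rinv_0_lt_compat|by apply H].
- have -> : C * h ^ 2 * / Rabs h = C * Rabs h by rewrite -(pow2_abs h); field; lra.
  have h3 : Rabs h * (C + 1) < eps.
  { have := Rmult_lt_compat_r (C + 1) _ _ ltac:(lra) h2. rewrite /Rdiv Rmult_assoc Rinv_l; lra. }
  nra.
Qed.

(** The Taylor remainder of exp (- h v) is at most h^2 v^2 exp (|h| v). For |h| up to d, half the
    distance from s to 1, it is dominated by the convergent weight at s - d. *)
Lemma DS_derive s t th : 1 < s -> is_derive (fun s => DS ones s t th) s (- DS logS s t th).
Proof.
move=> hs. set d := (s - 1) / 2. have hd : 0 < d by rewrite /d; lra.
have hs' : 1 < s - d by rewrite /d; lra.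
apply (is_derive_quadratic _ _ _ (Series (weight (s - d))) d hd) => h hh.
have hsh : 1 < s + h by move: hh => /Rabs_le_between; lra.
have e0 := ex_dterm ones (s + h) t th admissible_ones hsh.
have e1 := ex_dterm ones s t th admissible_ones hs.
have e2 := ex_dterm logS s t th admissible_logS hs.
rewrite /DS -Series_minus //.
have -> : h * - Series (dterm logS s t th) = (- h) * Series (dterm logS s t th) by ring.
rewrite -Series_scal_l -Series_minus; last first.
{ exact (ex_series_scal_l _ _ e2). }
{ exact (ex_series_minus _ _ e0 e1). }
rewrite (Rmult_comm (Series _)) -Series_scal_l.
have hterm n : Rabs (dterm ones (s + h) t th n - dterm ones s t th n - (- h) * dterm logS s t th n)
  <= h ^ 2 * weight (s - d) n.
{ rewrite /dterm /ones /weight. set v := logS n. have hv : 0 <= v by apply logS_ge0.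
  have -> : exp (- (s + h) * v) = exp (- s * v) * exp (- h * v) by rewrite -exp_plus; f_equal; ring.
  have -> : 1 * (exp (- s * v) * exp (- h * v)) * cos (t * v + th) - 1 * exp (- s * v) * cos (t * v + th) -
    - h * (v * exp (- s * v) * cos (t * v + th)) = exp (- s * v) * (exp (- h * v) - 1 - (- h * v)) * cos (t * v + th) by ring.
  have [h1 h2] := exp_taylor (- h * v).
  have h3 : exp (Rabs (- h * v)) * exp (- s * v) <= exp (- (s - d) * v).
  { rewrite -exp_plus. apply exp_mono. rewrite Rabs_mult Rabs_Ropp (Rabs_pos_eq v) //. nra. }
  have h4 := Rabs_cos_le (t * v + th). have h5 := exp_pos (- s * v).
  rewrite !Rabs_mult (Rabs_pos_eq (exp _)); last lra. rewrite (Rabs_pos_eq (_ - _ - _)) //.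
  apply: (Rle_trans _ (exp (- s * v) * (exp (- h * v) - 1 - - h * v) * 1)).
  { apply Rmult_le_compat_l => //. apply Rmult_le_pos; lra. }
  rewrite Rmult_1_r.
  apply: (Rle_trans _ (exp (- s * v) * ((- h * v) ^ 2 * exp (Rabs (- h * v))))).
  { apply Rmult_le_compat_l; lra. }
  have -> : exp (- s * v) * ((- h * v) ^ 2 * exp (Rabs (- h * v))) = h ^ 2 * v ^ 2 * (exp (Rabs (- h * v)) * exp (- s * v)) by ring.
  have -> : h ^ 2 * ((1 + v) ^ 2 * exp (- (s - d) * v)) = h ^ 2 * (1 + v) ^ 2 * exp (- (s - d) * v) by ring.
  apply Rmult_le_compat => //.
  - apply Rmult_le_pos; apply pow2_ge_0.
  - apply Rmult_le_pos; left; apply exp_pos.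
  - apply Rmult_le_compat_l; [apply pow2_ge_0|nra]. }
have ew : ex_series (fun n => h ^ 2 * weight (s - d) n) by apply (ex_series_scal_l _ _ (ex_series_weight _ hs')).
apply: Rle_trans; first apply Series_Rabs.
- apply (@ex_series_le R_AbsRing R_CompleteNormedModule _ (fun n => h ^ 2 * weight (s - d) n)) => // n.
  rewrite /norm /= /abs /= Rabs_Rabsolu. apply hterm.
- apply Series_le => // n. split; [apply Rabs_pos|apply hterm].
Qed.

(* The Dirichlet convolution ln = Lam * 1, summed over n <= N + 1. Only this identity and
   the bounds 0 <= Lam <= 1 + ln are used of the von Mangoldt function. *)
Definition log_convolution (Lam : nat -> R) := forall N (f : nat -> R),
  sum_n (fun n => logS n * f (S n)) N =
  sum_n (fun m => sum_n (fun k => if Nat.leb (S m * S k) (S N) then Lam m * f (S m * S k)%nat else 0) N) N.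

Section Lambda.
Variable Lam : nat -> R.
Hypothesis Lam_adm : admissible Lam.
Hypothesis Lam_conv : log_convolution Lam.

Definition nterm s t th (n : nat) := exp (- s * ln (INR n)) * cos (t * ln (INR n) + th).

Lemma logS_mul m k : ln (INR (S m * S k)) = logS m + logS k.
Proof. rewrite mult_INR ln_mult //; apply INR_S_pos. Qed.

(** Pairs in the square but outside the hyperbolic region have a product between N + 2 and (N +
    1)^2. The convolution identity at (N + 1)^2 contains them among nonnegative terms, so they are
    at most a stretch of the convergent series of log n n^(-s). *)
Lemma conv_tail s N : 1 < s ->
  sum_n (fun m => sum_n (fun k => if Nat.leb (S m * S k) (S N) then 0 else Lam m * nterm s 0 0 (S m * S k)) N) N
  <= sum_n (dterm logS s 0 0) (S N * S N - 1) - sum_n (dterm logS s 0 0) N.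
Proof.
move=> hs.
have hpos m k : 0 <= Lam m * nterm s 0 0 (S m * S k).
{ apply Rmult_le_pos; first apply Lam_adm. rewrite /nterm Rmult_0_l Rplus_0_r cos_0 Rmult_1_r. left; apply exp_pos. }
have hL N' : sum_n (dterm logS s 0 0) N' = sum_n (fun m => sum_n (fun k => if Nat.leb (S m * S k) (S N') then Lam m * nterm s 0 0 (S m * S k) else 0) N') N'.
{ rewrite -(Lam_conv N' (nterm s 0 0)). apply sum_n_ext => n. rewrite /dterm /nterm /logS Rmult_assoc //. }
suff h : sum_n (fun m => sum_n (fun k => Lam m * nterm s 0 0 (S m * S k)) N) N <= sum_n (dterm logS s 0 0) (S N * S N - 1).
{ apply: (Rle_trans _ (sum_n (fun m => sum_n (fun k => Lam m * nterm s 0 0 (S m * S k)) N) N - sum_n (dterm logS s 0 0) N)); last lra.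
  rewrite hL sum_n_minusR. right. apply sum_n_ext => m. rewrite sum_n_minusR. apply sum_n_ext => k.
  by case: Nat.leb; Rring. }
rewrite hL.
apply: (Rle_trans _ (sum_n (fun m => sum_n (fun k => if Nat.leb (S m * S k) (S (S N * S N - 1)) then Lam m * nterm s 0 0 (S m * S k) else 0) N) N)).
- right. apply sum_n_ext_loc => m hm. apply sum_n_ext_loc => k hk.
  have -> : Nat.leb (S m * S k) (S (S N * S N - 1)) = true by apply PeanoNat.Nat.leb_le; nia. by [].
- apply: (Rle_trans _ (sum_n (fun m => sum_n (fun k => if Nat.leb (S m * S k) (S (S N * S N - 1)) then Lam m * nterm s 0 0 (S m * S k) else 0) (S N * S N - 1)) N)).
  + apply sum_n_le => m. apply sum_n_mono; last lia. move=> k. case: Nat.leb => //. lra.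
  + apply sum_n_mono; last lia. move=> m. apply sum_n_ge0 => k. case: Nat.leb => //. lra.
Qed.

(** The identity - zeta' = (- zeta' / zeta) zeta at s - i t, turned by the angle th. Products of
    partial sums run over squares of pairs, the left side over hyperbolic regions, and [conv_tail]
    sends the difference to 0. *)
Lemma DS_conv s t th : 1 < s ->
  DS logS s t th = DS Lam s t 0 * DS ones s t th - DS Lam s t (- (PI / 2)) * DS ones s t (th - PI / 2).
Proof.
move=> hs.
have cv a t' th' : admissible a -> is_lim_seq (sum_n (dterm a s t' th')) (DS a s t' th').
{ move=> ha. exact (Series_correct _ (ex_dterm a s t' th' ha hs)). }
have hlim : is_lim_seq (fun N => sum_n (dterm logS s 0 0) (S N * S N - 1) - sum_n (dterm logS s 0 0) N) 0.
{ have -> : Finite 0 = Finite (DS logS s 0 0 - DS logS s 0 0) by rewrite Rminus_diag_eq.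
  apply is_lim_seq_minus'; last by apply cv, admissible_logS.
  apply (is_lim_seq_subseq _ (DS logS s 0 0) (fun N => (S N * S N - 1)%nat)); last by apply cv, admissible_logS.
  move=> P [N0 hN0]. exists N0 => n hn. apply hN0. nia. }
have h1 : is_lim_seq (fun N => sum_n (dterm Lam s t 0) N * sum_n (dterm ones s t th) N -
   sum_n (dterm Lam s t (- (PI / 2))) N * sum_n (dterm ones s t (th - PI / 2)) N - sum_n (dterm logS s t th) N) 0.
{ apply is_lim_seq_abs_0.
  apply (is_lim_seq_le_le (fun _ => 0) _ (fun N => sum_n (dterm logS s 0 0) (S N * S N - 1) - sum_n (dterm logS s 0 0) N)) => //;
    last apply is_lim_seq_const.
  move=> N. split; first apply Rabs_pos. apply: Rle_trans; last by apply conv_tail.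
  have -> : sum_n (dterm logS s t th) N = sum_n (fun m => sum_n (fun k => if Nat.leb (S m * S k) (S N) then Lam m * nterm s t th (S m * S k) else 0) N) N.
  { rewrite -(Lam_conv N (nterm s t th)). apply sum_n_ext => n. rewrite /dterm /nterm /logS Rmult_assoc //. }
  rewrite !sum_n_prod !sum_n_minusR. apply: Rle_trans; first apply Rabs_sum_n.
  apply sum_n_le => m. rewrite !sum_n_minusR. apply: Rle_trans; first apply Rabs_sum_n.
  apply sum_n_le => k.
  have -> : dterm Lam s t 0 m * dterm ones s t th k - dterm Lam s t (- (PI / 2)) m * dterm ones s t (th - PI / 2) k
    = Lam m * nterm s t th (S m * S k).
  { rewrite /dterm /nterm logS_mul /ones.
    have -> : - s * (logS m + logS k) = - s * logS m + - s * logS k by ring.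
    have -> : t * (logS m + logS k) + th = t * logS m + (t * logS k + th) by ring.
    have -> : t * logS m + - (PI / 2) = - (PI / 2 - t * logS m) by ring.
    have -> : t * logS k + (th - PI / 2) = - (PI / 2 - (t * logS k + th)) by ring.
    rewrite !cos_neg !cos_shift exp_plus Rplus_0_r (cos_plus (t * logS m)). ring. }
  case: Nat.leb; first by rewrite Rminus_diag_eq // Rabs_R0; lra.
  rewrite Rminus_0_r /nterm !Rabs_mult Rmult_0_l Rplus_0_r cos_0 Rmult_1_r.
  rewrite (Rabs_pos_eq (Lam m)); last apply Lam_adm.
  rewrite (Rabs_pos_eq (exp _)); last by left; apply exp_pos.
  apply Rmult_le_compat_l; first apply Lam_adm.
  have := Rabs_cos_le (t * ln (INR (S m * S k)) + th). have := exp_pos (- s * ln (INR (S m * S k))).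
  set E := exp _. set c := Rabs _. nra. }
have h2 : is_lim_seq (fun N => sum_n (dterm Lam s t 0) N * sum_n (dterm ones s t th) N -
   sum_n (dterm Lam s t (- (PI / 2))) N * sum_n (dterm ones s t (th - PI / 2)) N - sum_n (dterm logS s t th) N)
  (DS Lam s t 0 * DS ones s t th - DS Lam s t (- (PI / 2)) * DS ones s t (th - PI / 2) - DS logS s t th).
{ have a1 := admissible_ones. have a2 := admissible_logS.
  apply is_lim_seq_minus'; last by apply cv. apply is_lim_seq_minus'; apply is_lim_seq_mult'; by apply cv. }
have := is_lim_seq_unique _ _ h1. rewrite (is_lim_seq_unique _ _ h2). case. lra.
Qed.
End Lambda.

(** * The 3-4-1 inequality on absolute values of zeta *)

Definition DScos a s t := DS a s t 0.
Definition DSsin a s t := DS a s t (- (PI / 2)).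
Definition zeta_sq s t := DScos ones s t ^ 2 + DSsin ones s t ^ 2.

Lemma zeta_sq_ge0 s t : 0 <= zeta_sq s t.
Proof. rewrite /zeta_sq. have := pow2_ge_0 (DScos ones s t). have := pow2_ge_0 (DSsin ones s t). lra. Qed.

Lemma cos_negpi2 x : cos (x + - (PI / 2)) = sin x.
Proof. have -> : x + - (PI / 2) = - (PI / 2 - x) by ring. by rewrite cos_neg cos_shift. Qed.

Lemma Series_0 (a : nat -> R) : (forall n, a n = 0) -> Series a = 0.
Proof.
move=> h. rewrite (Series_ext _ (fun n => 0 * a n)) ?Series_scal_l; first ring.
move=> n. rewrite h. ring.
Qed.

Lemma Series_ge0 (a : nat -> R) : (forall n, 0 <= a n) -> ex_series a -> 0 <= Series a.
Proof.
move=> h ha. rewrite -(Series_0 (fun _ => 0)) //. apply Series_le => // n. split; [lra|apply h].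
Qed.

Lemma Series_le_bound (a : nat -> R) M : ex_series a -> (forall N, sum_n a N <= M) -> Series a <= M.
Proof.
move=> ha h. have hl : is_lim_seq (sum_n a) (Series a) := Series_correct _ ha.
exact (is_lim_seq_le _ (fun _ => M) (Series a) M h hl (is_lim_seq_const M)).
Qed.

Lemma DSsin_0 a s : DSsin a s 0 = 0.
Proof. apply Series_0 => n. rewrite /dterm Rmult_0_l cos_negpi2 sin_0. ring. Qed.

Lemma DScos_0_bounds s : 1 < s -> 0 <= DScos ones s 0 <= 1 + / (s - 1).
Proof.
move=> hs. have e : forall n, dterm ones s 0 0 n = exp (- s * logS n).
{ move=> n. rewrite /dterm /ones Rmult_0_l Rplus_0_l cos_0. ring. }
split.
- apply Series_ge0; last by apply ex_dterm => //; apply admissible_ones.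
  move=> n. rewrite e. left; apply exp_pos.
- apply Series_le_bound; first by apply ex_dterm => //; apply admissible_ones.
  move=> N. rewrite (sum_n_ext _ _ N e). apply: Rle_trans; first by apply zeta_partial_sum_le.
  have := exp_pos (- (s - 1) * logS N). have : 0 < / (s - 1) by apply Rinv_0_lt_compat; lra. nra.
Qed.

(** Every term after the first is at least - n^(-2), and the sum of n^(-2) over n >= 2 is at most
    1/4 + 1/2, by telescoping from n = 3 on. *)
Lemma DScos_2_lower t : / 4 <= DScos ones 2 t.
Proof.
have ex := ex_dterm ones 2 t 0 admissible_ones ltac:(lra).
have -> : DScos ones 2 t = 1 - Series (fun n => - dterm ones 2 t 0 (S n)).
{ rewrite /DScos /DS Series_incr_1 // Series_opp. have -> : dterm ones 2 t 0 0 = 1.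
  { rewrite /dterm /ones /logS /= ln_1 !Rmult_0_r exp_0 Rplus_0_r cos_0. ring. }
  ring. }
suff : Series (fun n => - dterm ones 2 t 0 (S n)) <= 3 / 4 by lra.
have ht n : - dterm ones 2 t 0 (S n) <= exp (- (2) * logS (S n)).
{ rewrite /dterm /ones. have h1 := exp_pos (- (2) * logS (S n)). have [h2 _] := COS_bound (t * logS (S n) + 0).
  have := Rmult_le_pos _ (1 + cos (t * logS (S n) + 0)) (Rlt_le _ _ h1). lra. }
apply Series_le_bound.
{ apply: ex_series_opp. by apply (ex_series_incr_1 (dterm ones 2 t 0)). }
move=> N. apply: (Rle_trans _ (sum_n (fun n => exp (- (2) * logS (S n))) N)); first by apply sum_n_le.
suff : sum_n (fun n => exp (- (2) * logS (S n))) N <= 3 / 4 - exp (- (2 - 1) * logS (S N)) by have := exp_pos (- (2 - 1) * logS (S N)); lra.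
have l1 : exp (- (2 - 1) * logS 1) = / 2.
{ have -> : - (2 - 1) * logS 1 = - logS 1 by ring. by rewrite exp_Ropp exp_logS. }
elim: N => [|N IH].
- rewrite sum_O. have -> : exp (- (2) * logS 1) = exp (- (2 - 1) * logS 1) * exp (- (2 - 1) * logS 1).
  { rewrite -exp_plus. f_equal. ring. }
  rewrite !l1. lra.
- rewrite sum_Sn /plus /=. have := zeta_term_le 2 (S N) ltac:(lra). lra.
Qed.

(** For |t| >= t0 the polar parts are at most 2 T / t0^2, and the remainders are at most 75 (3 + T)
    <= 300 T. *)
Lemma DS_bound t0 s t th T : 0 < t0 <= 1 -> 1 < s <= 2 -> t0 <= Rabs t <= T -> 1 <= T ->
  Rabs (DS ones s t th) <= (2 / t0 ^ 2 + 300) * T /\ Rabs (DS logS s t th) <= (2 / t0 ^ 2 + 300) * T.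
Proof.
move=> h0 hs ht hT.
have hq : t0 ^ 2 <= (s - 1) ^ 2 + t ^ 2 by rewrite -(pow2_abs t); have := pow2_ge_0 (s - 1); nra.
have ht2 : 0 < t0 ^ 2 by nra.
have hiq : / ((s - 1) ^ 2 + t ^ 2) <= / t0 ^ 2 by apply Rinv_le_contravar.
have hiq0 : 0 < / ((s - 1) ^ 2 + t ^ 2) by apply Rinv_0_lt_compat; lra.
have hp : 0 < / t0 ^ 2 by apply Rinv_0_lt_compat.
have hc := Rabs_cos_le (t * ln 1 + th). have hsn := Rabs_sin_le (t * ln 1 + th).
have b0 : Rabs (zeta_prim s t th 1) <= 2 / t0 ^ 2 * T.
{ rewrite /zeta_prim /Rdiv !Rabs_mult. have -> : - (s - 1) * ln 1 = 0 by rewrite ln_1; ring.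
  rewrite exp_0 Rabs_R1 Rmult_1_l (Rabs_pos_eq (/ _)); last lra.
  have := Rabs_lin2 (- (s - 1)) t _ _ hc hsn. rewrite Rabs_Ropp (Rabs_pos_eq (s - 1)); last lra.
  move=> h. apply: (Rle_trans _ ((2 * T) * / t0 ^ 2)); last lra.
  apply Rmult_le_compat; try lra. apply Rabs_pos. }
have b1 : Rabs (logzeta_prim s t th 1) <= 2 / t0 ^ 2 * T.
{ have e : logzeta_prim s t th 1 = - ((((s - 1) ^ 2 - t ^ 2) * cos (t * ln 1 + th) - 2 * (s - 1) * t * sin (t * ln 1 + th)) *
    / ((s - 1) ^ 2 + t ^ 2)) * / ((s - 1) ^ 2 + t ^ 2).
  { rewrite /logzeta_prim. have -> : - (s - 1) * ln 1 = 0 by rewrite ln_1; ring. rewrite exp_0 {1}ln_1. field. lra. }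
  rewrite e Rabs_mult Rabs_Ropp Rabs_mult (Rabs_pos_eq (/ _)); last lra.
  have h2 := Rabs_lin2 ((s - 1) ^ 2 - t ^ 2) (- (2 * (s - 1) * t)) _ _ hc hsn.
  have h5 : Rabs ((s - 1) ^ 2 - t ^ 2) <= (s - 1) ^ 2 + t ^ 2
    by apply Rabs_le; have := pow2_ge_0 (s - 1); have := pow2_ge_0 t; lra.
  have h6 : Rabs (- (2 * (s - 1) * t)) <= (s - 1) ^ 2 + t ^ 2
    by rewrite Rabs_Ropp; apply Rabs_le; have := pow2_ge_0 (s - 1 - t); have := pow2_ge_0 (s - 1 + t); lra.
  have h7 : Rabs (((s - 1) ^ 2 - t ^ 2) * cos (t * ln 1 + th) - 2 * (s - 1) * t * sin (t * ln 1 + th))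
    <= 2 * ((s - 1) ^ 2 + t ^ 2).
  { have -> : ((s - 1) ^ 2 - t ^ 2) * cos (t * ln 1 + th) - 2 * (s - 1) * t * sin (t * ln 1 + th) =
    ((s - 1) ^ 2 - t ^ 2) * cos (t * ln 1 + th) + - (2 * (s - 1) * t) * sin (t * ln 1 + th) by ring. lra. }
  move: h7. set A := Rabs _. set Q := (s - 1) ^ 2 + t ^ 2 in hq hiq hiq0 *. move=> h7.
  have h8 : A * / Q <= 2.
  { have := Rmult_le_compat_r (/ Q) _ _ ltac:(lra) h7. have -> : 2 * Q * / Q = 2 by field; lra. by []. }
  apply: (Rle_trans _ (2 * / Q)); first by apply Rmult_le_compat_r; lra.
  rewrite /Rdiv. nra. }
have r0 := zeta_remainder s t th hs. have r1 := logzeta_remainder s t th hs.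
have tr a b : Rabs a <= Rabs (a + b) + Rabs b.
{ have {1}-> : a = (a + b) + - b by ring. apply: Rle_trans; first apply Rabs_triang. rewrite Rabs_Ropp. lra. }
split.
- apply: Rle_trans; first apply (tr _ (zeta_prim s t th 1)). nra.
- apply: Rle_trans; first apply (tr _ (logzeta_prim s t th 1)). nra.
Qed.

Lemma pow8_le a b : 0 <= b -> a ^ 8 <= b ^ 8 -> a <= b.
Proof.
move=> hb h. case: (Rle_dec a b) => // hn. exfalso.
have h1 : b ^ 2 < a ^ 2 by nra. have h2 : (b ^ 2) ^ 2 < (a ^ 2) ^ 2 by have := pow2_ge_0 b; nra.
have h3 : ((b ^ 2) ^ 2) ^ 2 < ((a ^ 2) ^ 2) ^ 2 by have := pow2_ge_0 (b ^ 2); nra.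
rewrite -!pow_mult /= in h3. move: h => /=. lra.
Qed.

Section Lambda.
Variable Lam : nat -> R.
Hypothesis Lam_adm : admissible Lam.
Hypothesis Lam_conv : log_convolution Lam.

Lemma DScos_conv s t : 1 < s -> DScos logS s t = DScos Lam s t * DScos ones s t - DSsin Lam s t * DSsin ones s t.
Proof. move=> hs. by rewrite /DScos (DS_conv Lam) // Rminus_0_l. Qed.

Lemma DSsin_conv s t : 1 < s -> DSsin logS s t = DScos Lam s t * DSsin ones s t + DSsin Lam s t * DScos ones s t.
Proof.
move=> hs. rewrite /DSsin (DS_conv Lam) // (DS_rot ones s t (- (PI / 2) - PI / 2)) //; last apply admissible_ones.
have -> : - (PI / 2) - PI / 2 = - PI by field. rewrite cos_neg sin_neg cos_PI sin_PI /DScos /DSsin. ring.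
Qed.

(** Half the derivative of |zeta|^2 is Re (zeta' conj(zeta)) = Re (zeta' / zeta) |zeta|^2; the
    convolution identities express this without forming a quotient or a logarithm of zeta. *)
Lemma zeta_sq_derive s t : 1 < s -> is_derive (fun s => zeta_sq s t) s (- 2 * DScos Lam s t * zeta_sq s t).
Proof.
move=> hs. rewrite /zeta_sq.
have -> : - 2 * DScos Lam s t * (DScos ones s t ^ 2 + DSsin ones s t ^ 2) =
  INR 2 * (- DScos logS s t) * DScos ones s t ^ 1 + INR 2 * (- DSsin logS s t) * DSsin ones s t ^ 1.
{ rewrite DScos_conv // DSsin_conv //. simpl. ring. }
have hx : is_derive (fun s => DScos ones s t) s (- DScos logS s t) := DS_derive s t 0 hs.
have hy : is_derive (fun s => DSsin ones s t) s (- DSsin logS s t) := DS_derive s t (- (PI / 2)) hs.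
exact (is_derive_plus _ _ _ _ _ (is_derive_pow _ 2 _ _ hx) (is_derive_pow _ 2 _ _ hy)).
Qed.

(* |zeta(s)|^6 |zeta(s - it)|^8 |zeta(s - 2it)|^2, nonincreasing in s by the 3-4-1 inequality. *)
Definition Phi t s := zeta_sq s 0 ^ 3 * (zeta_sq s t ^ 4 * zeta_sq s (2 * t)).

(** The exponents of [Phi] become the coefficients 3, 4, 1 of its logarithmic derivative, so that
    the trigonometric inequality turns into monotonicity in s. *)
Lemma Phi_derive s t : 1 < s ->
  is_derive (Phi t) s (- 2 * (3 * DScos Lam s 0 + 4 * DScos Lam s t + DScos Lam s (2 * t)) * Phi t s).
Proof.
move=> hs. rewrite /Phi.
have h0 := is_derive_pow _ 3 _ _ (zeta_sq_derive s 0 hs). have h1 := is_derive_pow _ 4 _ _ (zeta_sq_derive s t hs).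
have h2 := zeta_sq_derive s (2 * t) hs.
have := Derive.is_derive_mult _ _ _ _ _ h0 (Derive.is_derive_mult _ _ _ _ _ h1 h2).
set d := (Z in is_derive _ _ Z). set d' := (Z in _ -> is_derive _ _ Z). suff -> : d = d' by [].
rewrite /d /d' /=. ring.
Qed.

Lemma three_four_one s t : 1 < s -> 0 <= 3 * DScos Lam s 0 + 4 * DScos Lam s t + DScos Lam s (2 * t).
Proof.
move=> hs. rewrite /DScos /DS -!Series_scal_l.
have e0 := ex_series_scal_l 3 _ (ex_dterm Lam s 0 0 Lam_adm hs).
have e1 := ex_series_scal_l 4 _ (ex_dterm Lam s t 0 Lam_adm hs).
have e2 := ex_dterm Lam s (2 * t) 0 Lam_adm hs.
rewrite -Series_plus // -Series_plus //; last exact (ex_series_plus _ _ e0 e1).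
apply Series_ge0; last exact (ex_series_plus _ _ (ex_series_plus _ _ e0 e1) e2).
move=> n. rewrite /dterm !Rplus_0_r Rmult_0_l cos_0.
have -> : 2 * t * logS n = 2 * (t * logS n) by ring. rewrite cos_2a_cos.
set c := cos _. have [h1 _] := Lam_adm n. have h2 := exp_pos (- s * logS n).
have -> : 3 * (Lam n * exp (- s * logS n) * 1) + 4 * (Lam n * exp (- s * logS n) * c) + Lam n * exp (- s * logS n) * (2 * c * c - 1)
  = 2 * (Lam n * exp (- s * logS n)) * (1 + c) ^ 2 by ring.
apply Rmult_le_pos; last apply pow2_ge_0. have := Rmult_le_pos _ _ h1 (Rlt_le _ _ h2). lra.
Qed.

(** By monotonicity it suffices to look at s = 2, where each of the 3 + 4 + 1 factors |zeta|^2 is at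
    least 1/16 by [DScos_2_lower]. *)
Lemma Phi_lower s t : 1 < s <= 2 -> (/ 16) ^ 8 <= Phi t s.
Proof.
move=> hs.
have hP s' : 0 <= Phi t s' by apply Rmult_le_pos; [|apply Rmult_le_pos]; try apply pow_le; apply zeta_sq_ge0.
have [c [hc1 hc2]] := mvt (Phi t) _ s 2 ltac:(lra) (fun x hx => Phi_derive x t ltac:(lra)).
have h3 := three_four_one c t ltac:(lra). have h4 := hP c.
have h5 : Phi t 2 <= Phi t s.
{ have := Rmult_le_pos _ _ h3 h4. move: hc2. set A := _ + _ + _. set B := Phi t c. nra. }
apply: Rle_trans h5.
have hq t' : / 16 <= zeta_sq 2 t'.
{ rewrite /zeta_sq. have := DScos_2_lower t'. have := pow2_ge_0 (DSsin ones 2 t'). nra. }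
rewrite /Phi. have -> : (/ 16) ^ 8 = (/ 16) ^ 3 * ((/ 16) ^ 4 * / 16) by ring.
apply Rmult_le_compat; try (apply pow_le; lra).
- apply Rmult_le_pos; [apply pow_le|]; lra.
- apply pow_incr; split; [lra|apply hq].
- apply Rmult_le_compat; try (apply pow_le); try lra; [apply pow_incr; split; [lra|apply hq]|apply hq].
Qed.

(** In [Phi_lower], |zeta(s)|^2 is at most 4 / (s - 1)^2 and |zeta(s - 2 i t)|^2 at most 8 B^2 T^2;
    the constant is 512 = 4^3 * 8. *)
Lemma zeta_sq_lower t0 B s t T : 0 < t0 <= 1 -> B = 2 / t0 ^ 2 + 300 -> 1 < s <= 2 -> t0 <= Rabs t <= T -> 1 <= T ->
  (/ 16) ^ 8 * (s - 1) ^ 6 <= 512 * B ^ 2 * T ^ 2 * zeta_sq s t ^ 4.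
Proof.
move=> h0 hB hs ht hT.
have h1 := Phi_lower s t hs.
have [x1 x2] := DScos_0_bounds s ltac:(lra).
have hq0 : zeta_sq s 0 * (s - 1) ^ 2 <= 4.
{ rewrite /zeta_sq DSsin_0. have h2 : DScos ones s 0 * (s - 1) <= 2.
  { have := Rmult_le_compat_r (s - 1) _ _ ltac:(lra) x2. rewrite Rmult_plus_distr_r Rinv_l; lra. }
  have -> : (DScos ones s 0 ^ 2 + 0 ^ 2) * (s - 1) ^ 2 = (DScos ones s 0 * (s - 1)) ^ 2 by ring.
  have : 0 <= DScos ones s 0 * (s - 1) by apply Rmult_le_pos; lra. nra. }
have hq2 : zeta_sq s (2 * t) <= 8 * B ^ 2 * T ^ 2.
{ have ht2 : t0 <= Rabs (2 * t) <= 2 * T by rewrite Rabs_mult (Rabs_pos_eq 2); lra.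
  have [b1 _] := DS_bound t0 s (2 * t) 0 (2 * T) h0 hs ht2 ltac:(lra).
  have [b2 _] := DS_bound t0 s (2 * t) (- (PI / 2)) (2 * T) h0 hs ht2 ltac:(lra).
  rewrite -hB in b1 b2. rewrite /zeta_sq /DScos /DSsin -(pow2_abs (DS _ _ _ 0)) -(pow2_abs (DS _ _ _ (- _))).
  have := Rabs_pos (DS ones s (2 * t) 0). have := Rabs_pos (DS ones s (2 * t) (- (PI / 2))).
  move=> p1 p2. have := pow_incr _ _ 2 (conj p1 b2). have := pow_incr _ _ 2 (conj p2 b1). nra. }
have g0 := zeta_sq_ge0 s 0. have g1 := zeta_sq_ge0 s t. have g2 := zeta_sq_ge0 s (2 * t).
have a0 : 0 <= (s - 1) ^ 6 by apply pow_le; lra.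
apply: (Rle_trans _ (Phi t s * (s - 1) ^ 6)); first by apply Rmult_le_compat_r.
have -> : Phi t s * (s - 1) ^ 6 = (zeta_sq s 0 * (s - 1) ^ 2) ^ 3 * (zeta_sq s t ^ 4 * zeta_sq s (2 * t)) by rewrite /Phi; ring.
have -> : 512 * B ^ 2 * T ^ 2 * zeta_sq s t ^ 4 = 4 ^ 3 * (zeta_sq s t ^ 4 * (8 * B ^ 2 * T ^ 2)) by ring.
have p2 : 0 <= (s - 1) ^ 2 by apply pow2_ge_0.
apply Rmult_le_compat.
- apply pow_le, Rmult_le_pos; lra.
- apply Rmult_le_pos; [by apply pow_le|lra].
- apply pow_incr; split => //. apply Rmult_le_pos; lra.
- apply Rmult_le_compat_l => //. by apply pow_le.
Qed.

End Lambda.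

(** * Polynomial growth and Lipschitz bounds for - zeta' / zeta - zeta *)

Lemma Cmod_le_abs (x y : R) : Cmod (x, y) <= Rabs x + Rabs y.
Proof.
rewrite /Cmod /=. apply: (Rle_trans _ (sqrt ((Rabs x + Rabs y) ^ 2))).
- apply sqrt_le_1_alt. have := Rabs_pos x. have := Rabs_pos y.
  have := pow2_abs x. have := pow2_abs y. nra.
- rewrite sqrt_pow2; first lra. have := Rabs_pos x. have := Rabs_pos y. lra.
Qed.

(* Small enough for the pole to dominate: |zeta_reg| <= 600 and |polar| <= 2 * strip when
   s - 1 and |t| are at most strip. *)
Definition strip := / 2400.
Definition DSC a s t : C := (DScos a s t, DSsin a s t).
Definition polar (s t : R) : C := (s - 1, - t).

Lemma Cmod_DSC s t : Cmod (DSC ones s t) ^ 2 = zeta_sq s t.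
Proof. rewrite /Cmod pow2_sqrt //. exact (zeta_sq_ge0 s t). Qed.

(* Uniformity in s as s tends to 1 replaces a continuation to the line Re s = 1. *)
Definition poly_lip (f : R -> R -> C) := exists K m, 0 <= K /\
  forall T s t t', 1 <= T -> 1 < s <= 1 + strip -> Rabs t <= T -> Rabs t' <= T ->
  Cmod (f s t) <= K * T ^ m /\ Cmod (f s t - f s t') <= K * T ^ m * Rabs (t - t').

Lemma pow_ge1 T m : 1 <= T -> 1 <= T ^ m.
Proof. move=> h. exact: pow_R1_Rle. Qed.

Lemma poly_lip_add f g : poly_lip f -> poly_lip g -> poly_lip (fun s t => f s t + g s t)%C.
Proof.
move=> [K1 [m1 [p1 h1]]] [K2 [m2 [p2 h2]]]. exists (K1 + K2), (m1 + m2)%nat. split; first lra.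
move=> T s t t' hT hs ht ht'. have [a1 b1] := h1 T s t t' hT hs ht ht'. have [a2 b2] := h2 T s t t' hT hs ht ht'.
have e1 := pow_ge1 T m1 hT. have e2 := pow_ge1 T m2 hT. have hp := Rabs_pos (t - t').
have d1 : K1 * T ^ m1 <= K1 * (T ^ m1 * T ^ m2) by apply Rmult_le_compat_l => //; nra.
have d2 : K2 * T ^ m2 <= K2 * (T ^ m1 * T ^ m2) by apply Rmult_le_compat_l => //; nra.
rewrite pow_add. split.
- apply: Rle_trans; first apply Cmod_triangle. lra.
- have -> : (f s t + g s t - (f s t' + g s t') = (f s t - f s t') + (g s t - g s t'))%C by ring.
  apply: Rle_trans; first apply Cmod_triangle. nra.
Qed.

Lemma poly_lip_mul f g : poly_lip f -> poly_lip g -> poly_lip (fun s t => f s t * g s t)%C.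
Proof.
move=> [K1 [m1 [p1 h1]]] [K2 [m2 [p2 h2]]]. exists (2 * K1 * K2), (m1 + m2)%nat. split; first nra.
move=> T s t t' hT hs ht ht'. have [a1 b1] := h1 T s t t' hT hs ht ht'. have [a2 b2] := h2 T s t t' hT hs ht ht'.
have [a1' _] := h1 T s t' t hT hs ht' ht.
have e1 := pow_ge1 T m1 hT. have e2 := pow_ge1 T m2 hT. have hp := Rabs_pos (t - t').
have q1 : 0 <= K1 * T ^ m1 by apply Rmult_le_pos; lra.
have q2 : 0 <= K2 * T ^ m2 by apply Rmult_le_pos; lra.
have -> : 2 * K1 * K2 * T ^ (m1 + m2) = 2 * ((K1 * T ^ m1) * (K2 * T ^ m2)) by rewrite pow_add; ring.
have := Cmod_ge_0 (f s t). have := Cmod_ge_0 (g s t). have := Cmod_ge_0 (f s t'). move=> c1 c2 c3.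
split.
- rewrite Cmod_mult. have := Rmult_le_compat _ _ _ _ c3 c2 a1 a2. nra.
- have -> : (f s t * g s t - f s t' * g s t' = (f s t - f s t') * g s t + f s t' * (g s t - g s t'))%C by ring.
  apply: Rle_trans; first apply Cmod_triangle. rewrite !Cmod_mult.
  have := Rmult_le_compat _ _ _ _ (Cmod_ge_0 _) c2 b1 a2.
  have := Rmult_le_compat _ _ _ _ c1 (Cmod_ge_0 _) a1' b2. lra.
Qed.

(** From 1/a - 1/b = - (a - b) / (a b): the lower bound enters twice, hence an exponent 2 k. *)
Lemma poly_lip_inv f : poly_lip f ->
  (exists c k, 0 < c /\ forall T s t, 1 <= T -> 1 < s <= 1 + strip -> Rabs t <= T -> c <= Cmod (f s t) * T ^ k) ->
  poly_lip (fun s t => / f s t)%C.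
Proof.
move=> [K1 [m1 [p1 h1]]] [c [k [hc h2]]]. exists (/ c + K1 * / c ^ 2), (m1 + 2 * k)%nat.
have ic : 0 < / c by apply Rinv_0_lt_compat.
have ic2 : 0 < / c ^ 2 by apply Rinv_0_lt_compat, pow_lt.
split; first nra.
move=> T s t t' hT hs ht ht'. have [a1 b1] := h1 T s t t' hT hs ht ht'.
have e1 := pow_ge1 T m1 hT. have e2 := pow_ge1 T k hT. have hp := Rabs_pos (t - t').
have H t1 : Rabs t1 <= T -> f s t1 <> RtoC 0 /\ / Cmod (f s t1) <= / c * T ^ k.
{ move=> ht1. have h := h2 T s t1 hT hs ht1. have h0 : 0 < Cmod (f s t1).
  { case: (Rle_lt_or_eq_dec _ _ (Cmod_ge_0 (f s t1))) => // e. rewrite -e in h. lra. }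
  split; first by apply Cmod_gt_0.
  apply (Rmult_le_reg_r (Cmod (f s t1))) => //. rewrite Rinv_l; last lra.
  apply (Rmult_le_reg_l c) => //. rewrite Rmult_1_r.
  have -> : c * (/ c * T ^ k * Cmod (f s t1)) = Cmod (f s t1) * T ^ k by field; lra. lra. }
have [n1 i1] := H t ht. have [n2 i2] := H t' ht'.
have i0 : 0 <= / Cmod (f s t) by left; apply Rinv_0_lt_compat, Cmod_gt_0.
have i0' : 0 <= / Cmod (f s t') by left; apply Rinv_0_lt_compat, Cmod_gt_0.
rewrite pow_add pow_mult.
have e3 : T ^ k <= (T ^ 2) ^ k by apply pow_incr; nra.
have e4 : (T ^ 2) ^ k = T ^ k * T ^ k by rewrite -pow_mult -pow_add; f_equal; lia.
split.
- rewrite Cmod_inv //. apply: (Rle_trans _ _ _ i1).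
  apply Rmult_le_compat; try lra; last by rewrite e4; nra. nra.
- have -> : (/ f s t - / f s t' = - (f s t - f s t') * (/ f s t * / f s t'))%C by field; split.
  rewrite !Cmod_mult Cmod_opp !Cmod_inv //.
  have b2 := Rmult_le_compat _ _ _ _ i0 i0' i1 i2.
  have b3 := Rmult_le_compat _ _ _ _ (Cmod_ge_0 _) (Rmult_le_pos _ _ i0 i0') b1 b2.
  apply: (Rle_trans _ _ _ b3).
  have -> : K1 * T ^ m1 * Rabs (t - t') * (/ c * T ^ k * (/ c * T ^ k)) = (K1 * / c ^ 2) * ((T ^ m1 * (T ^ k * T ^ k)) * Rabs (t - t')).
  { field. lra. }
  rewrite e4 -(Rmult_assoc (K1 * / c ^ 2)). apply Rmult_le_compat_r => //. apply Rmult_le_compat_r; last lra.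
  apply Rmult_le_pos; nra.
Qed.

Lemma poly_lip_const (c : C) : poly_lip (fun _ _ => c).
Proof.
exists (Cmod c), O. split; first apply Cmod_ge_0. move=> T s t t' _ _ _ _. split; first by simpl; lra.
have -> : (c - c = 0)%C by ring. rewrite Cmod_0. apply Rmult_le_pos; last apply Rabs_pos. simpl. have := Cmod_ge_0 c; lra.
Qed.

Lemma poly_lip_polar : poly_lip polar.
Proof.
exists 2, 1%nat. split; first lra. move=> T s t t' hT hs ht ht'. split.
- apply: Rle_trans; first apply Cmod_le_abs. rewrite Rabs_Ropp Rabs_pos_eq; last lra. move: hs. rewrite /strip. lra.
- have -> : (polar s t - polar s t')%C = (0, t' - t) by rewrite /polar /Cminus /Cplus /Copp /=; f_equal; ring.
  apply: Rle_trans; first apply Cmod_le_abs. rewrite Rabs_R0 (Rabs_minus_sym t'). have := Rabs_pos (t - t'). nra.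
Qed.

Definition zeta_reg s t : C := (DSC ones s t - / polar s t)%C.
Definition logzeta_reg s t : C := (DSC logS s t - / (polar s t * polar s t))%C.

(** Identifies the boundary terms at u = 1 with the complex pole, so that the remainder estimates
    apply to [zeta_reg]. *)
Lemma zeta_regE s t : 1 < s -> zeta_reg s t = (DScos ones s t + zeta_prim s t 0 1, DSsin ones s t + zeta_prim s t (- (PI / 2)) 1).
Proof.
move=> hs. rewrite /zeta_reg /DSC /polar /Cminus /Cplus /Copp /Cinv /zeta_prim /= ln_1 !Rmult_0_r exp_0 !Rplus_0_l cos_0 sin_0.
rewrite cos_neg sin_neg cos_PI2 sin_PI2. f_equal; field; nra.
Qed.

Lemma logzeta_regE s t : 1 < s -> logzeta_reg s t = (DScos logS s t + logzeta_prim s t 0 1, DSsin logS s t + logzeta_prim s t (- (PI / 2)) 1).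
Proof.
move=> hs. rewrite /logzeta_reg /DSC /polar /Cminus /Cplus /Copp /Cinv /Cmult /logzeta_prim /= ln_1 !Rmult_0_r exp_0 !Rplus_0_l cos_0 sin_0.
rewrite cos_neg sin_neg cos_PI2 sin_PI2.
have h : (s - 1) * (s - 1) + t * t <> 0 by nra.
have h' : ((s - 1) * (s - 1) - - t * - t) * ((s - 1) * (s - 1) - - t * - t) + ((s - 1) * - t + - t * (s - 1)) * ((s - 1) * - t + - t * (s - 1)) <> 0.
{ have -> : ((s - 1) * (s - 1) - - t * - t) * ((s - 1) * (s - 1) - - t * - t) + ((s - 1) * - t + - t * (s - 1)) * ((s - 1) * - t + - t * (s - 1))
   = ((s - 1) * (s - 1) + t * t) * ((s - 1) * (s - 1) + t * t) by ring. by apply Rmult_integral_contrapositive. }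
f_equal; field; repeat split; rewrite ?Rmult_1_r //; move: h' h; nra.
Qed.

Lemma poly_lip_zeta_reg : poly_lip zeta_reg.
Proof.
exists (2 * 300), 1%nat. split; first lra. move=> T s t t' hT hs ht ht'.
have hs2 : 1 < s <= 2 by move: hs; rewrite /strip; lra.
rewrite !zeta_regE; try lra. split.
- apply: Rle_trans; first apply Cmod_le_abs.
  have := zeta_remainder s t 0 hs2. have := zeta_remainder s t (- (PI / 2)) hs2. rewrite -!/(DScos _ _ _) -!/(DSsin _ _ _). nra.
- apply: Rle_trans; first apply Cmod_le_abs. rewrite /fst /snd.
  have h1 := zeta_remainder_lip s t t' 0 T hs2 ht ht'. have h2 := zeta_remainder_lip s t t' (- (PI / 2)) T hs2 ht ht'.
  rewrite -!/(DScos _ _ _) -!/(DSsin _ _ _) in h1 h2. have hp := Rabs_pos (t - t').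
  have : (3 + T) * Rabs (t - t') <= 4 * T * Rabs (t - t') by nra.
  move: h1 h2. rewrite /Rminus. simpl. lra.
Qed.

Lemma poly_lip_logzeta_reg : poly_lip logzeta_reg.
Proof.
exists (2 * 300), 1%nat. split; first lra. move=> T s t t' hT hs ht ht'.
have hs2 : 1 < s <= 2 by move: hs; rewrite /strip; lra.
rewrite !logzeta_regE; try lra. split.
- apply: Rle_trans; first apply Cmod_le_abs.
  have := logzeta_remainder s t 0 hs2. have := logzeta_remainder s t (- (PI / 2)) hs2. rewrite -!/(DScos _ _ _) -!/(DSsin _ _ _). nra.
- apply: Rle_trans; first apply Cmod_le_abs. rewrite /fst /snd.
  have h1 := logzeta_remainder_lip s t t' 0 T hs2 ht ht'. have h2 := logzeta_remainder_lip s t t' (- (PI / 2)) T hs2 ht ht'.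
  rewrite -!/(DScos _ _ _) -!/(DSsin _ _ _) in h1 h2. have hp := Rabs_pos (t - t').
  have : (3 + T) * Rabs (t - t') <= 4 * T * Rabs (t - t') by nra.
  move: h1 h2. rewrite /Rminus. simpl. lra.
Qed.

Section Lambda.
Variable Lam : nat -> R.
Hypothesis Lam_adm : admissible Lam.
Hypothesis Lam_conv : log_convolution Lam.

(** The bound of [zeta_sq_lower] for |zeta| degenerates like (s - 1)^(3/4). It is used for s >= 1 +
    e0 only; closer to 1, zeta is compared with its value at 1 + e0 through the bound B T for zeta',
    losing at most 2 B T e0. Since 3/4 < 1, a small e0 makes the value 4 B T e0 available at 1 +
    e0. *)
Lemma zeta_lower t0 : 0 < t0 <= 1 -> exists c, 0 < c /\ forall s t T, 1 < s <= 2 -> t0 <= Rabs t <= T -> 1 <= T ->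
  c <= Cmod (DSC ones s t) * T ^ 4.
Proof.
move=> h0. pose B := 2 / t0 ^ 2 + 300.
have hB : 1 <= B. { rewrite /B. have : 0 < / t0 ^ 2 by apply Rinv_0_lt_compat, pow_lt; lra. rewrite /Rdiv. lra. }
pose D := 512 * 4 ^ 8 * B ^ 10. have hD : 1 <= D. { rewrite /D. have := pow_ge1 B 10 hB. lra. }
pose kap := (/ 16) ^ 8. have hk : 0 < kap by apply pow_lt; lra.
have hk1 : kap <= 1. { rewrite /kap. rewrite -(pow1 8). apply pow_incr. lra. }
pose K := kap / D. have hK : 0 < K by apply Rdiv_lt_0_compat; lra.
have hK1 : K <= 1. { apply (Rmult_le_reg_r D); first lra. rewrite /K /Rdiv Rmult_assoc Rinv_l; lra. }
exists (2 * B * K). split; first by apply Rmult_lt_0_compat; lra.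
move=> s t T hs ht hT.
have hT5 := pow_ge1 T 5 hT. have hT5i : 0 < / T ^ 5 <= 1.
{ split; first by apply Rinv_0_lt_compat; lra. rewrite -Rinv_1. apply Rinv_le_contravar; lra. }
(* The requirement 512 B^2 T^2 (4 B T e0)^8 <= kap e0^6 reads D (T^5 e0)^2 <= kap. With T^5 e0 = K =
   kap / D it becomes kap K <= kap. *)
pose e0 := K * / T ^ 5. have he0 : 0 < e0 by apply Rmult_lt_0_compat; lra.
have he1 : e0 <= 1 by rewrite /e0; nra.
have big s' : 1 + e0 <= s' <= 2 -> 4 * B * T * e0 <= Cmod (DSC ones s' t).
{ move=> hs'. apply pow8_le; first apply Cmod_ge_0.
  have -> : Cmod (DSC ones s' t) ^ 8 = zeta_sq s' t ^ 4 by rewrite -Cmod_DSC -pow_mult.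
  have h := zeta_sq_lower Lam Lam_adm Lam_conv t0 B s' t T h0 eq_refl ltac:(lra) ht hT.
  have hP : 0 < 512 * B ^ 2 * T ^ 2 by have := pow_ge1 B 2 hB; have := pow_ge1 T 2 hT; nra.
  apply (Rmult_le_reg_l (512 * B ^ 2 * T ^ 2)) => //. apply: Rle_trans h.
  apply: (Rle_trans _ (kap * e0 ^ 6)); last first.
  { apply Rmult_le_compat_l; first lra. apply pow_incr. lra. }
  have -> : 512 * B ^ 2 * T ^ 2 * (4 * B * T * e0) ^ 8 = (D * (T ^ 5 * e0) ^ 2) * e0 ^ 6 by rewrite /D; ring.
  apply Rmult_le_compat_r; first by apply pow_le; lra.
  have -> : T ^ 5 * e0 = K by rewrite /e0; field; lra.
  have -> : D * K ^ 2 = kap * K by rewrite /K; field; lra. nra. }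
have -> : 2 * B * K = (2 * B * T * e0) * T ^ 4 by rewrite /e0; field; lra.
apply Rmult_le_compat_r; first by apply pow_le; lra.
have hp : 0 < B * T * e0 by apply Rmult_lt_0_compat; nra.
case: (Rle_dec (1 + e0) s) => hse; first by have := big s ltac:(lra); lra.
have h1 := big (1 + e0) ltac:(lra).
have dif th : Rabs (DS ones (1 + e0) t th - DS ones s t th) <= B * T * e0.
{ apply: (Rle_trans _ (B * T * Rabs (1 + e0 - s))).
  - apply (lipschitz_of_derive (fun s => DS ones s t th) (fun s => - DS logS s t th)).
    + move=> x hx. apply DS_derive. move: hx. rewrite Rmin_right; lra.
    + move=> x. rewrite Rmin_right ?Rmax_left; try lra. move=> hx. rewrite Rabs_Ropp.
      exact (proj2 (DS_bound t0 x t th T h0 ltac:(lra) ht hT)).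
  - apply Rmult_le_compat_l; first nra. rewrite Rabs_pos_eq; lra. }
have tri : Cmod (DSC ones (1 + e0) t) <= Cmod (DSC ones s t) + (B * T * e0 + B * T * e0).
{ have -> : DSC ones (1 + e0) t = Cplus (DSC ones s t) (DScos ones (1 + e0) t - DScos ones s t, DSsin ones (1 + e0) t - DSsin ones s t).
  { rewrite /DSC /Cplus /=. f_equal; ring. }
  apply: Rle_trans; first apply Cmod_triangle. apply Rplus_le_compat_l.
  apply: Rle_trans; first apply Cmod_le_abs. apply Rplus_le_compat; apply dif. }
lra.
Qed.

Lemma polar_neq0 s t : 1 < s -> polar s t <> RtoC 0.
Proof. move=> hs [h _]. lra. Qed.

Definition Lam_gap s t : C := (DSC Lam s t - DSC ones s t)%C.

(** The quantity is w zeta(s - i t) with w = [polar s t]. For |t| >= [strip] both factors are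
    bounded below; for smaller |t| the product of w and [zeta_reg] has modulus at most 1/2. *)
Lemma polar_zeta_lower : exists c k, 0 < c /\ forall T s t, 1 <= T -> 1 < s <= 1 + strip -> Rabs t <= T ->
  c <= Cmod (1 + polar s t * zeta_reg s t)%C * T ^ k.
Proof.
have [c [hc H]] := zeta_lower strip ltac:(rewrite /strip; lra).
exists (Rmin (/ 2) (strip * c)), 4%nat. split; first by apply Rmin_pos; [lra|apply Rmult_lt_0_compat => //; rewrite /strip; lra].
move=> T s t hT hs ht. have hT4 := pow_ge1 T 4 hT.
have hs2 : 1 < s <= 2 by move: hs; rewrite /strip; lra.
case: (Rle_dec strip (Rabs t)) => hd.
- apply: Rle_trans; first apply Rmin_r.
  have -> : (1 + polar s t * zeta_reg s t = polar s t * DSC ones s t)%C.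
  { rewrite /zeta_reg. field. apply polar_neq0; lra. }
  rewrite Cmod_mult Rmult_assoc. apply Rmult_le_compat; try lra; try (rewrite /strip; lra).
  + apply: (Rle_trans _ (Rabs t)) => //. have h := Rmax_Cmod (polar s t). rewrite /polar /fst /snd Rabs_Ropp in h.
    apply: Rle_trans h. apply Rmax_r.
  + by apply H.
- apply: Rle_trans; first apply Rmin_l.
  have hw : Cmod (polar s t) <= 2 * strip.
  { apply: Rle_trans; first apply Cmod_le_abs. rewrite Rabs_Ropp Rabs_pos_eq; lra. }
  have hG : Cmod (zeta_reg s t) <= 600.
  { rewrite zeta_regE; last lra. apply: Rle_trans; first apply Cmod_le_abs.
    have := zeta_remainder s t 0 hs2. have := zeta_remainder s t (- (PI / 2)) hs2. rewrite -!/(DScos _ _ _) -!/(DSsin _ _ _).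
    move: hd. rewrite /strip. lra. }
  have h1 : Cmod (polar s t * zeta_reg s t) <= / 2.
  { rewrite Cmod_mult. have := Rmult_le_compat _ _ _ _ (Cmod_ge_0 _) (Cmod_ge_0 _) hw hG. rewrite /strip. lra. }
  have h2 : 1 <= Cmod (1 + polar s t * zeta_reg s t)%C + Cmod (polar s t * zeta_reg s t)%C.
  { rewrite -{1}Cmod_1. have {1}-> : RtoC 1 = ((1 + polar s t * zeta_reg s t) + - (polar s t * zeta_reg s t))%C by ring.
    apply: Rle_trans; first apply Cmod_triangle. rewrite Cmod_opp. lra. }
  nra.
Qed.

(* Writing zeta = 1 / w + g0 and - zeta' = 1 / w^2 + g1 with w = polar s t, the poles cancel
   in - zeta' / zeta - zeta. *)
Lemma Lam_gapE s t : 1 < s <= 1 + strip ->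
  Lam_gap s t = ((polar s t * logzeta_reg s t + (RtoC (-2)) * zeta_reg s t + RtoC (-1) * (polar s t * (zeta_reg s t * zeta_reg s t))) * / (1 + polar s t * zeta_reg s t))%C.
Proof.
move=> hs. have hw := polar_neq0 s t ltac:(lra).
have [c [k [hc H]]] := polar_zeta_lower.
have hn : (1 + polar s t * zeta_reg s t)%C <> RtoC 0.
{ move=> e. have := H (Rmax 1 (Rabs t)) s t (Rmax_l _ _) hs (Rmax_r _ _). rewrite e Cmod_0. lra. }
have hz : DSC ones s t <> RtoC 0.
{ move=> e. apply hn. rewrite /zeta_reg e. field. done. }
have e : DSC logS s t = (DSC Lam s t * DSC ones s t)%C.
{ rewrite /DSC /Cmult /=. rewrite (DScos_conv Lam) // ?(DSsin_conv Lam) //; lra. }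
rewrite /Lam_gap /logzeta_reg e /zeta_reg. field. repeat split => //. move=> h; apply hn; rewrite /zeta_reg -h; field => //.
Qed.

Lemma poly_lip_ext f g : (forall s t, 1 < s <= 1 + strip -> f s t = g s t) -> poly_lip f -> poly_lip g.
Proof.
move=> e [K [m [hK h]]]. exists K, m. split => // T s t t' hT hs. rewrite -!e //. by apply h.
Qed.

Lemma poly_lip_Lam_gap : poly_lip Lam_gap.
Proof.
apply (poly_lip_ext _ _ (fun s t hs => eq_sym (Lam_gapE s t hs))).
have w := poly_lip_polar. have g0 := poly_lip_zeta_reg. have g1 := poly_lip_logzeta_reg. have c1 := poly_lip_const.
apply poly_lip_mul.
- repeat first [apply poly_lip_add|apply poly_lip_mul] => //.
- apply poly_lip_inv; last exact polar_zeta_lower. apply poly_lip_add => //. by apply poly_lip_mul.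
Qed.

End Lambda.

(** * A quantitative Riemann-Lebesgue lemma and the Fejer kernel *)

Lemma lipschitz_continuous (f : R -> R) x M : 0 <= M ->
  (forall y, Rabs (y - x) <= 1 -> Rabs (f y - f x) <= M * Rabs (y - x)) -> continuous f x.
Proof.
move=> hM h. apply continuity_pt_filterlim => eps heps.
exists (Rmin 1 (eps / (M + 1))). split.
{ apply Rmin_pos; first lra. apply Rdiv_lt_0_compat; lra. }
move=> y [_ hy]. rewrite /= /R_dist in hy *.
have h1 : Rabs (y - x) < 1 by have := Rmin_l 1 (eps / (M + 1)); lra.
have h2 : Rabs (y - x) < eps / (M + 1) by have := Rmin_r 1 (eps / (M + 1)); lra.
apply: Rle_lt_trans; first by apply h; lra.
have h3 : Rabs (y - x) * (M + 1) < eps.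
{ have := Rmult_lt_compat_r (M + 1) _ _ ltac:(lra) h2. rewrite /Rdiv Rmult_assoc Rinv_l; lra. }
have := Rabs_pos (y - x). nra.
Qed.

Lemma ex_RInt_cont (f : R -> R) a b : (forall x, continuous f x) -> ex_RInt f a b.
Proof. move=> h. apply (@ex_RInt_continuous R_CompleteNormedModule) => z _. apply h. Qed.

Lemma continuous_cosl w ph x : continuous (fun x => cos (w * x + ph)) x.
Proof. apply (@ex_derive_continuous R_AbsRing R_NormedModule). auto_derive => //. Qed.

(* Shifting x by the half period PI / w changes the sign of the cosine. *)
Lemma riemann_lebesgue (f : R -> R) w ph S M : 0 < w -> 0 <= S -> 0 <= M ->
  (forall x, continuous f x) ->
  (forall x, 0 <= x <= 1 -> Rabs (f x) <= S) ->
  (forall x y, 0 <= x <= 1 -> 0 <= y <= 1 -> Rabs (f x - f y) <= M * Rabs (x - y)) ->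
  Rabs (RInt (fun x => f x * cos (w * x + ph)) 0 1) <= (M + 2 * S) * (PI / w).
Proof.
move=> hw hS hM hc hb hl. set d := PI / w. have hd : 0 < d by apply Rdiv_lt_0_compat => //; apply PI_RGT_0.
pose c x := cos (w * x + ph).
have cc x : continuous c x by apply continuous_cosl.
pose g x := f x * c x.
have cg x : continuous g x by apply: continuous_mult.
have gb x : 0 <= x <= 1 -> Rabs (g x) <= S.
{ move=> hx. rewrite /g Rabs_mult. have := hb x hx. have := Rabs_cos_le (w * x + ph). rewrite -/(c x).
  have := Rabs_pos (f x). have := Rabs_pos (c x). nra. }
rewrite -/c -/g. have eg a b : ex_RInt g a b by apply ex_RInt_cont.
change (Rabs (RInt g 0 1) <= (M + 2 * S) * d).
(* If the half period d exceeds the interval, the trivial bound S is at most S d. *)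
case: (Rle_dec 1 d) => h1.
- apply: Rle_trans; first by apply (abs_RInt_le_const g 0 1 S); [lra|apply eg|exact gb]. nra.
- pose g' x := f (x - d) * c x.
  have cg' x : continuous g' x.
  { apply: continuous_mult => //. apply: continuous_comp; last by apply hc.
    apply (@ex_derive_continuous R_AbsRing R_NormedModule). auto_derive => //. }
  have e1 : RInt g 0 (1 - d) = - RInt g' d 1.
  { have eo : RInt (fun x => opp (g' x)) d 1 = - RInt g' d 1 := RInt_opp _ _ _ (ex_RInt_cont _ d 1 cg').
    rewrite -eo.
    have -> : RInt g 0 (1 - d) = RInt g (1 * d + - d) (1 * 1 + - d) by f_equal; ring.
    rewrite -(RInt_comp_lin g 1 (- d) d 1); last by apply eg.
    apply RInt_ext => x _. rewrite /scal /= /mult /= Rmult_1_l /g /g' /opp /=.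
    have -> : 1 * x + - d = x - d by ring.
    have -> : c (x - d) = - c x.
    { rewrite /c. have -> : w * (x - d) + ph = w * x + ph - PI by rewrite /d; field; lra.
      rewrite cos_minus cos_PI sin_PI. ring. }
    ring. }
  have e2 := RInt_Chasles g 0 (1 - d) 1 (eg _ _) (eg _ _).
  have e3 := RInt_Chasles g 0 d 1 (eg _ _) (eg _ _).
  rewrite /plus /= in e2 e3.
  have e4 : RInt g d 1 - RInt g' d 1 = RInt (fun x => minus (g x) (g' x)) d 1.
  { rewrite RInt_minus //. by apply ex_RInt_cont. }
  have b1 := abs_RInt_le_const g 0 d S ltac:(lra) (eg _ _) (fun x hx => gb x ltac:(lra)).
  have b2 := abs_RInt_le_const g (1 - d) 1 S ltac:(lra) (eg _ _) (fun x hx => gb x ltac:(lra)).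
  have b3 : Rabs (RInt (fun x => minus (g x) (g' x)) d 1) <= (1 - d) * (M * d).
  { apply abs_RInt_le_const; first lra.
    - apply: ex_RInt_minus => //. by apply ex_RInt_cont.
    - move=> x hx. rewrite /minus /plus /opp /= /g /g'.
      have -> : f x * c x + - (f (x - d) * c x) = (f x - f (x - d)) * c x by ring.
      rewrite Rabs_mult. have h2 := hl x (x - d) ltac:(lra) ltac:(lra).
      have e : x - (x - d) = d by ring. rewrite e (Rabs_pos_eq d) in h2; last lra.
      have := Rabs_cos_le (w * x + ph). rewrite -/(c x). have := Rabs_pos (f x - f (x - d)). have := Rabs_pos (c x). nra. }
  rewrite -e4 in b3.
  (* Two end pieces of length d, each at most S d, and the integral of (f x - f (x - d)) c x, at
     most M d. *)
  have e5 : 2 * RInt g 0 1 = RInt g 0 d + RInt g (1 - d) 1 + (RInt g d 1 - RInt g' d 1) by lra.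
  move: b1 b2 b3 => /Rabs_le_between b1 /Rabs_le_between b2 /Rabs_le_between b3.
  have : M * d * (1 - d) <= M * d by nra. move=> b4.
  apply Rabs_le. nra.
Qed.

(* The Fejer kernel, as the Fourier transform of the triangle function. *)
Definition Fej (u : R) : R := RInt (fun x => 2 * (1 - x) * cos (u * x)) 0 1.

Lemma Fej_integrand_continuous u x : continuous (fun x => 2 * (1 - x) * cos (u * x)) x.
Proof. apply (@ex_derive_continuous R_AbsRing R_NormedModule). auto_derive => //. Qed.

Lemma RInt_triangle : RInt (fun x => 2 * (1 - x)) 0 1 = 1.
Proof.
have h : is_RInt (fun x => 2 * (1 - x)) 0 1 (minus (2 * 1 - 1 ^ 2) (2 * 0 - 0 ^ 2)).
{ apply (@is_RInt_derive R_CompleteNormedModule (fun x => 2 * x - x ^ 2)) => x _.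
  - auto_derive => //. ring.
  - apply (@ex_derive_continuous R_AbsRing R_NormedModule). auto_derive => //. }
rewrite (is_RInt_unique _ _ _ _ h) /minus /plus /opp /=. ring.
Qed.

Lemma Rabs_Fej_le u : Rabs (Fej u) <= 1.
Proof.
rewrite -RInt_triangle. apply (norm_RInt_le (fun x => 2 * (1 - x) * cos (u * x)) (fun x => 2 * (1 - x)) 0 1); first lra.
- move=> x hx. rewrite /norm /= /abs /= Rabs_mult (Rabs_pos_eq (2 * (1 - x))); last lra.
  have := Rabs_cos_le (u * x). nra.
- apply: RInt_correct. apply ex_RInt_cont, Fej_integrand_continuous.
- apply: RInt_correct. apply ex_RInt_cont => x. apply (@ex_derive_continuous R_AbsRing R_NormedModule). auto_derive => //.
Qed.

(** The kernel is (sin (u / 2) / (u / 2))^2; the form multiplied by u^2 also covers u = 0. *)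
Lemma FejE u : Fej u * u ^ 2 = 2 * (1 - cos u).
Proof.
case: (Req_dec u 0) => [->|hu]; first by rewrite cos_0; ring.
have h : is_RInt (fun x => 2 * (1 - x) * cos (u * x)) 0 1
  (minus (2 * (1 - 1) * sin (u * 1) / u - 2 * cos (u * 1) / u ^ 2) (2 * (1 - 0) * sin (u * 0) / u - 2 * cos (u * 0) / u ^ 2)).
{ apply (@is_RInt_derive R_CompleteNormedModule (fun x => 2 * (1 - x) * sin (u * x) / u - 2 * cos (u * x) / u ^ 2)) => x _.
  - auto_derive => //. simpl. field. done.
  - apply Fej_integrand_continuous. }
rewrite /Fej (is_RInt_unique _ _ _ _ h) /minus /plus /opp /= Rmult_0_r Rmult_1_r sin_0 cos_0. field. done.
Qed.

Lemma Fej_ge0 u : 0 <= Fej u.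
Proof.
case: (Req_dec u 0) => [->|hu].
- apply RInt_ge_0; first lra.
  + apply ex_RInt_cont, Fej_integrand_continuous.
  + move=> x hx. rewrite Rmult_0_l cos_0. lra.
- have h := FejE u. have hp : 0 < u ^ 2 by have := pow2_gt_0 u hu. have [_ hc] := COS_bound u. nra.
Qed.

Lemma Fej_le_inv_sq u : Fej u * u ^ 2 <= 4.
Proof. rewrite FejE. have := COS_bound u. lra. Qed.

Lemma cos_lower x : 1 - x ^ 2 / 2 <= cos x.
Proof.
wlog hx : x / 0 <= x.
{ move=> H. case: (Rle_dec 0 x) => h; first by apply H.
  have := H (- x) ltac:(lra). rewrite cos_neg. lra. }
have [c [hc h]] := mvt (fun x => cos x + x ^ 2 / 2) (fun x => - sin x + x) 0 x hx
  (fun y _ => ltac:(auto_derive => //; field)).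
rewrite cos_0 in h.
have hs : sin c <= c. { case: (Rle_lt_or_eq_dec 0 c ltac:(lra)) => h0; [left; by apply sin_lt_x|rewrite -h0 sin_0; lra]. }
have : 0 <= (- sin c + c) * (x - 0) by apply Rmult_le_pos; lra. lra.
Qed.

(** The cosine in the integrand is at least 1/2, and the triangle has mass 1. A positive lower bound
    on [-1, 1] is what lets translates of the kernel majorize other functions in [layers]. *)
Lemma Fej_lower u : Rabs u <= 1 -> / 2 <= Fej u.
Proof.
move=> hu.
have -> : / 2 = / 2 * 1 by ring. rewrite -RInt_triangle.
have ec : forall x, continuous (fun x => 2 * (1 - x)) x.
{ move=> x. apply (@ex_derive_continuous R_AbsRing R_NormedModule). auto_derive => //. }
have es : RInt (fun x => scal (/ 2) (2 * (1 - x))) 0 1 = / 2 * RInt (fun x => 2 * (1 - x)) 0 1 := RInt_scal _ _ _ _ (ex_RInt_cont _ 0 1 ec).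
rewrite -es.
apply RInt_le; first lra.
- apply: ex_RInt_scal. by apply ex_RInt_cont.
- apply ex_RInt_cont, Fej_integrand_continuous.
- move=> x hx. rewrite /scal /= /mult /=. have h := cos_lower (u * x).
  have h1 : u ^ 2 <= 1 by rewrite -(pow2_abs u); have := Rabs_pos u; nra.
  have h2 : (u * x) ^ 2 <= 1 by rewrite Rpow_mult_distr; have := pow2_ge_0 u; nra.
  nra.
Qed.

Lemma Fej_even u : Fej (- u) = Fej u.
Proof.
apply RInt_ext => x _. have -> : - u * x = - (u * x) by ring. by rewrite cos_neg.
Qed.

Lemma cos_lip x y : Rabs (cos x - cos y) <= Rabs (x - y).
Proof.
rewrite -[Z in _ <= Z]Rmult_1_l. apply (lipschitz_of_derive cos (fun x => - sin x)).
- move=> z _. apply is_derive_cos.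
- move=> z _. rewrite Rabs_Ropp. apply Rabs_sin_le.
Qed.

Lemma Fej_lip u v : Rabs (Fej u - Fej v) <= 2 * Rabs (u - v).
Proof.
rewrite /Fej. have e1 : ex_RInt (fun x => 2 * (1 - x) * cos (u * x)) 0 1 by apply ex_RInt_cont, Fej_integrand_continuous.
have e2 : ex_RInt (fun x => 2 * (1 - x) * cos (v * x)) 0 1 by apply ex_RInt_cont, Fej_integrand_continuous.
have em : RInt (fun x => minus (2 * (1 - x) * cos (u * x)) (2 * (1 - x) * cos (v * x))) 0 1 =
  RInt (fun x => 2 * (1 - x) * cos (u * x)) 0 1 - RInt (fun x => 2 * (1 - x) * cos (v * x)) 0 1 := RInt_minus _ _ _ _ e1 e2.
rewrite -em.
have -> : 2 * Rabs (u - v) = (1 - 0) * (2 * Rabs (u - v)) by ring.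
apply abs_RInt_le_const; first lra; first exact (ex_RInt_minus _ _ _ _ e1 e2).
move=> x hx. rewrite /minus /plus /opp /=.
have -> : 2 * (1 - x) * cos (u * x) + - (2 * (1 - x) * cos (v * x)) = 2 * (1 - x) * (cos (u * x) - cos (v * x)) by ring.
rewrite Rabs_mult (Rabs_pos_eq (2 * (1 - x))); last lra.
have h := cos_lip (u * x) (v * x). have e : u * x - v * x = (u - v) * x by ring.
rewrite e Rabs_mult (Rabs_pos_eq x) in h; last lra.
have := Rabs_pos (u - v). have := Rabs_pos (cos (u * x) - cos (v * x)). nra.
Qed.

Lemma Fej_continuous u : continuous Fej u.
Proof. apply (lipschitz_continuous _ _ 2); first lra. move=> y _. apply Fej_lip. Qed.

Lemma series_tail (b w : nat -> R) N : (forall n, Rabs (b n) <= w n) -> ex_series w ->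
  Rabs (Series b - sum_n b N) <= Series w - sum_n w N.
Proof.
move=> h hw.
have hb : ex_series b by apply (@ex_series_le R_AbsRing R_CompleteNormedModule _ w).
have lb : is_lim_seq (sum_n b) (Series b) := Series_correct _ hb.
have lw : is_lim_seq (sum_n w) (Series w) := Series_correct _ hw.
have l1 : is_lim_seq (fun M => Rabs (sum_n b (M + N) - sum_n b N)) (Rabs (Series b - sum_n b N)).
{ apply (is_lim_seq_abs _ (Series b - sum_n b N)). apply is_lim_seq_minus'; last apply is_lim_seq_const.
  by apply (is_lim_seq_incr_n (sum_n b)). }
have l2 : is_lim_seq (fun M => sum_n w (M + N) - sum_n w N) (Series w - sum_n w N).
{ apply is_lim_seq_minus'; last apply is_lim_seq_const. by apply (is_lim_seq_incr_n (sum_n w)). }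
refine (is_lim_seq_le _ _ (Rabs _) (Series w - sum_n w N) _ l1 l2).
elim=> [|M IH]; first by rewrite !Rminus_diag_eq // Rabs_R0; lra.
rewrite /= !sum_Sn /plus /=.
have -> : sum_n b (M + N) + b (S (M + N)) - sum_n b N = (sum_n b (M + N) - sum_n b N) + b (S (M + N)) by ring.
apply: Rle_trans; first apply Rabs_triang. have := h (S (M + N)). lra.
Qed.

Lemma sum_n_RInt (F : nat -> R -> R) N a b : (forall n x, continuous (F n) x) ->
  sum_n (fun n => RInt (F n) a b) N = RInt (fun x => sum_n (fun n => F n x) N) a b /\
  forall x, continuous (fun x => sum_n (fun n => F n x) N) x.
Proof.
move=> h. elim: N => [|N [IH1 IH2]].
- split=> [|x].
  + rewrite sum_O. apply RInt_ext => x _. by rewrite sum_O.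
  + apply (continuous_ext (F O)); last by apply h. move=> z. by rewrite sum_O.
- split=> [|x].
  + rewrite sum_Sn IH1 -(@RInt_plus R_CompleteNormedModule); try by apply ex_RInt_cont.
    apply RInt_ext => x _. by rewrite sum_Sn.
  + apply (continuous_ext (fun x => plus (sum_n (fun n => F n x) N) (F (S N) x))).
    * move=> z. by rewrite sum_Sn.
    * apply: continuous_plus; [apply IH2|apply h].
Qed.

(** Rescaled to [0, 1], the amplitude has size 2 S0 and Lipschitz constant at most 4 S0 T, against a
    frequency T y, so the factor T cancels. With T + 1 <= 2 T and PI <= 4 the constant is 32. *)
Lemma fourier_bound (A : R -> R) S0 T y ph : 0 <= S0 -> 1 <= T -> 0 < y ->
  (forall x, continuous A x) ->
  (forall t, Rabs t <= T -> Rabs (A t) <= S0) ->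
  (forall t t', Rabs t <= T -> Rabs t' <= T -> Rabs (A t - A t') <= S0 * Rabs (t - t')) ->
  Rabs (RInt (fun x => 2 * (1 - x) * A (x * T) * cos (T * y * x + ph)) 0 1) <= 32 * S0 / y.
Proof.
move=> h0 hT hy hc hb hl.
have hin x : 0 <= x <= 1 -> Rabs (x * T) <= T by move=> hx; rewrite Rabs_pos_eq; nra.
apply: Rle_trans.
- apply (riemann_lebesgue (fun x => 2 * (1 - x) * A (x * T)) (T * y) ph (2 * S0) (4 * S0 * T)); try nra.
  + move=> x. apply: (continuous_mult (fun x => 2 * (1 - x)) (fun x => A (x * T))).
    * apply (@ex_derive_continuous R_AbsRing R_NormedModule). auto_derive => //.
    * apply: continuous_comp; last by apply hc.
      apply (@ex_derive_continuous R_AbsRing R_NormedModule). auto_derive => //.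
  + move=> x hx. rewrite Rabs_mult (Rabs_pos_eq (2 * (1 - x))); last lra.
    have := hb _ (hin x hx). have := Rabs_pos (A (x * T)). nra.
  + move=> x z hx hz.
    have -> : 2 * (1 - x) * A (x * T) - 2 * (1 - z) * A (z * T) = 2 * (1 - z) * (A (x * T) - A (z * T)) + 2 * (z - x) * A (x * T) by ring.
    apply: Rle_trans; first apply Rabs_triang. rewrite !Rabs_mult (Rabs_pos_eq 2); last lra.
    rewrite (Rabs_pos_eq (1 - z)); last lra. rewrite (Rabs_minus_sym z x).
    have h1 := hl _ _ (hin x hx) (hin z hz). have e : x * T - z * T = (x - z) * T by ring.
    rewrite e Rabs_mult (Rabs_pos_eq T) in h1; last lra.
    have h2 := hb _ (hin x hx). have := Rabs_pos (A (x * T)). have := Rabs_pos (x - z).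
    have := Rabs_pos (A (x * T) - A (z * T)). move=> p1 p2 p3.
    have : 2 * (1 - z) * Rabs (A (x * T) - A (z * T)) <= 2 * (S0 * (Rabs (x - z) * T)) by nra.
    have : Rabs (x - z) * Rabs (A (x * T)) <= Rabs (x - z) * S0 by apply Rmult_le_compat_l.
    have : Rabs (x - z) * S0 <= S0 * (Rabs (x - z) * T) by rewrite (Rmult_comm _ S0); apply Rmult_le_compat_l => //; nra.
    nra.
- have hpi := PI_4. have hpi0 := PI_RGT_0.
  have -> : (4 * S0 * T + 2 * (2 * S0)) * (PI / (T * y)) = (4 * S0 * (T + 1) / T * PI) / y by field; lra.
  apply Rmult_le_compat_r; first by left; apply Rinv_0_lt_compat.
  have : (T + 1) / T <= 2.
  { apply (Rmult_le_reg_r T); first lra. rewrite /Rdiv Rmult_assoc Rinv_l; lra. }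
  have : 0 <= (T + 1) / T by apply Rmult_le_pos; [lra|left; apply Rinv_0_lt_compat; lra].
  have -> : 4 * S0 * (T + 1) / T * PI = 4 * S0 * ((T + 1) / T * PI) by field; lra.
  move=> p1 p2. have : (T + 1) / T * PI <= 8 by nra. nra.
Qed.

Lemma Rabs_le_sub (a b : R) : Rabs a <= Rabs (a - b) + Rabs b.
Proof. have {1}-> : a = (a - b) + b by ring. apply Rabs_triang. Qed.

Lemma im_le_Cmod (c : C) : Rabs (snd c) <= Cmod c.
Proof. exact (Rle_trans _ _ _ (Rmax_r _ _) (Rmax_Cmod c)). Qed.

(** * Sums of Lambda - 1 against the Fejer kernel *)

Section Lambda.
Variable Lam : nat -> R.
Hypothesis Lam_adm : admissible Lam.
Hypothesis Lam_conv : log_convolution Lam.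

Definition fejer_term s T y n := (Lam n - 1) * exp (- s * logS n) * Fej (T * (logS n - y)).

(* The last summand accounts for the truncation of the Dirichlet series at N. *)
Lemma fejer_bound : exists K m, 0 <= K /\ forall s T y N, 1 < s <= 1 + strip -> 1 <= T -> 0 < y ->
  Rabs (sum_n (fejer_term s T y) N) <= K * T ^ m / y + 2 * (Series (weight s) - sum_n (weight s) N).
Proof.
have [K [m [hK H]]] := poly_lip_Lam_gap Lam Lam_adm Lam_conv.
exists (64 * K), m. split; first lra. move=> s T y N hs hT hy.
have hs1 : 1 < s by lra.
pose A t := DScos Lam s t - DScos ones s t. pose B t := DSsin Lam s t - DSsin ones s t.
have hA t : Rabs (A t) <= Cmod (Lam_gap Lam s t) by apply (re_le_Cmod (Lam_gap Lam s t)).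
have hB t : Rabs (B t) <= Cmod (Lam_gap Lam s t) by apply (im_le_Cmod (Lam_gap Lam s t)).
have hA' t t' : Rabs (A t - A t') <= Cmod (Lam_gap Lam s t - Lam_gap Lam s t') by apply (re_le_Cmod (Lam_gap Lam s t - Lam_gap Lam s t')).
have hB' t t' : Rabs (B t - B t') <= Cmod (Lam_gap Lam s t - Lam_gap Lam s t') by apply (im_le_Cmod (Lam_gap Lam s t - Lam_gap Lam s t')).
have hc (f : R -> R) : (forall t t', Rabs (f t - f t') <= Cmod (Lam_gap Lam s t - Lam_gap Lam s t')) -> forall x, continuous f x.
{ move=> hf x. pose T1 := Rabs x + 1. have hx := Rabs_pos x.
  apply (lipschitz_continuous _ _ (K * T1 ^ m)).
  - apply Rmult_le_pos => //. apply pow_le. rewrite /T1; lra.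
  - move=> z hz. apply: (Rle_trans _ _ _ (hf z x)). apply (H T1 s z x) => //; rewrite /T1; try lra.
    have -> : z = (z - x) + x by ring. apply: Rle_trans; first apply Rabs_triang. lra. }
have hS0 : 0 <= K * T ^ m by apply Rmult_le_pos => //; apply pow_le; lra.
have bA := fourier_bound A (K * T ^ m) T y 0 hS0 hT hy (hc A hA')
  (fun t ht => Rle_trans _ _ _ (hA t) (proj1 (H T s t t hT hs ht ht)))
  (fun t t' ht ht' => Rle_trans _ _ _ (hA' t t') (proj2 (H T s t t' hT hs ht ht'))).
have bB := fourier_bound B (K * T ^ m) T y (- (PI / 2)) hS0 hT hy (hc B hB')
  (fun t ht => Rle_trans _ _ _ (hB t) (proj1 (H T s t t hT hs ht ht)))
  (fun t t' ht ht' => Rle_trans _ _ _ (hB' t t') (proj2 (H T s t t' hT hs ht ht'))).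
(* The sum V1 + V2 is 2 (1 - x) times the real part of (A + i B) exp (- i t y) at t = x T, split
   into two integrands of the shape of [fourier_bound]; this doubles 32 to 64. *)
pose V1 x := 2 * (1 - x) * A (x * T) * cos (T * y * x + 0).
pose V2 x := 2 * (1 - x) * B (x * T) * cos (T * y * x + - (PI / 2)).
have clin x : continuous (fun x => 2 * (1 - x)) x by apply (@ex_derive_continuous R_AbsRing R_NormedModule); auto_derive.
have cT x : continuous (fun x => x * T) x by apply (@ex_derive_continuous R_AbsRing R_NormedModule); auto_derive.
have cV1 x : continuous V1 x.
{ apply: continuous_mult; last by apply continuous_cosl. apply: continuous_mult => //.
  apply: (continuous_comp (fun x => x * T) A) => //. by apply hc. }
have cV2 x : continuous V2 x.
{ apply: continuous_mult; last by apply continuous_cosl. apply: continuous_mult => //.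
  apply: (continuous_comp (fun x => x * T) B) => //. by apply hc. }
(* At the angle - t y the n-th cosine is cos (t (log n - y)), so integration over t = x T produces
   the Fejer kernel. *)
pose F n x := 2 * (1 - x) * (dterm Lam s (x * T) (- (x * T * y)) n - dterm ones s (x * T) (- (x * T * y)) n).
have cF n x : continuous (F n) x.
{ apply (@ex_derive_continuous R_AbsRing R_NormedModule). rewrite /F /dterm. auto_derive => //. }
have eF n : RInt (F n) 0 1 = fejer_term s T y n.
{ rewrite /fejer_term /Fej.
  have es : RInt (fun x => scal ((Lam n - 1) * exp (- s * logS n)) (2 * (1 - x) * cos (T * (logS n - y) * x))) 0 1 =
    (Lam n - 1) * exp (- s * logS n) * RInt (fun x => 2 * (1 - x) * cos (T * (logS n - y) * x)) 0 1
    := RInt_scal _ _ _ _ (ex_RInt_cont _ 0 1 (Fej_integrand_continuous _)).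
  rewrite -es. apply RInt_ext => x _. rewrite /F /dterm /ones /scal /= /mult /=.
  have -> : x * T * logS n + - (x * T * y) = T * (logS n - y) * x by ring. Rring. }
have [e1 cS] := sum_n_RInt F N 0 1 cF.
rewrite -(sum_n_ext _ _ N eF) e1.
pose W x := V1 x + V2 x.
have cW x : continuous W x by apply: continuous_plus.
(* W x is the full series, by [DS_rot] at the angle - t y; the finite sum misses a tail majorized by
   [weight], and 2 bounds the factor 2 (1 - x). *)
have close x : 0 <= x <= 1 -> Rabs (sum_n (fun n => F n x) N - W x) <= 2 * (Series (weight s) - sum_n (weight s) N) .
{ move=> hx. set t := x * T. set th := - (t * y).
  pose b n := dterm Lam s t th n - dterm ones s t th n.
  have eb n : Rabs (b n) <= weight s n.
  { have h := Lam_adm n. rewrite /b /dterm /ones /weight.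
    have -> : Lam n * exp (- s * logS n) * cos (t * logS n + th) - 1 * exp (- s * logS n) * cos (t * logS n + th)
      = (Lam n - 1) * exp (- s * logS n) * cos (t * logS n + th) by ring.
    rewrite !Rabs_mult (Rabs_pos_eq (exp _)); last by left; apply exp_pos.
    have hl := logS_ge0 n. have h1 : Rabs (Lam n - 1) <= (1 + logS n) ^ 2 by apply Rabs_le; nra.
    have h2 := Rabs_cos_le (t * logS n + th). have h3 := exp_pos (- s * logS n). have h4 := Rabs_pos (Lam n - 1).
    apply: (Rle_trans _ (Rabs (Lam n - 1) * exp (- s * logS n) * 1)).
    - apply Rmult_le_compat_l => //. apply Rmult_le_pos; lra.
    - rewrite Rmult_1_r. apply Rmult_le_compat_r; lra. }
  have eW : W x = 2 * (1 - x) * Series b.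
  { have a1 := admissible_ones. rewrite /b Series_minus; [|by apply ex_dterm|by apply ex_dterm].
    rewrite -/(DS Lam s t th) -/(DS ones s t th) (DS_rot Lam) // (DS_rot ones) //.
    rewrite /W /V1 /V2 /A /B cos_negpi2 Rplus_0_r -/t.
    rewrite -/(DScos Lam s t) -/(DScos ones s t) -/(DSsin Lam s t) -/(DSsin ones s t) /th cos_neg sin_neg.
    have -> : T * y * x = t * y by rewrite /t; ring. ring. }
  have eSum : sum_n (fun n => F n x) N = 2 * (1 - x) * sum_n b N by rewrite sum_n_scal_l.
  rewrite eW eSum -Rmult_minus_distr_l Rabs_mult (Rabs_pos_eq (2 * (1 - x))); last lra.
  have h := series_tail b (weight s) N eb (ex_series_weight s hs1). rewrite Rabs_minus_sym in h.
  have := Rabs_pos (sum_n b N - Series b). nra. }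
have em : RInt (fun x => minus (sum_n (fun n => F n x) N) (W x)) 0 1 =
  RInt (fun x => sum_n (fun n => F n x) N) 0 1 - RInt W 0 1 := RInt_minus _ _ _ _ (ex_RInt_cont _ 0 1 cS) (ex_RInt_cont _ 0 1 cW).
have ep : RInt W 0 1 = RInt V1 0 1 + RInt V2 0 1 := RInt_plus _ _ _ _ (ex_RInt_cont _ 0 1 cV1) (ex_RInt_cont _ 0 1 cV2).
have bm := abs_RInt_le_const (fun x => minus (sum_n (fun n => F n x) N) (W x)) 0 1 _ ltac:(lra)
  (ex_RInt_minus _ _ _ _ (ex_RInt_cont _ 0 1 cS) (ex_RInt_cont _ 0 1 cW)) close.
rewrite em ep in bm.
apply: (Rle_trans _ _ _ (Rabs_le_sub _ (RInt V1 0 1 + RInt V2 0 1))).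
have := Rabs_triang (RInt V1 0 1) (RInt V2 0 1).
have -> : 64 * K * T ^ m / y = 32 * (K * T ^ m) / y + 32 * (K * T ^ m) / y by field; lra.
move: bA bB. rewrite -/V1 -/V2. lra.
Qed.
End Lambda.

(** * Counting in logarithmic windows and unsmoothing *)

Definition le_ind n z : R := match Rle_dec (logS n) z with left _ => 1 | right _ => 0 end.

Lemma le_ind_cases n z : (logS n <= z /\ le_ind n z = 1) \/ (~ logS n <= z /\ le_ind n z = 0).
Proof. rewrite /le_ind. case: Rle_dec => h; [by left|by right]. Qed.

Lemma le_ind_bounds n z : 0 <= le_ind n z <= 1.
Proof. rewrite /le_ind. case: Rle_dec; lra. Qed.

Lemma le_ind_mono n z z' : z <= z' -> le_ind n z <= le_ind n z'.
Proof. rewrite /le_ind => h. case: Rle_dec => h1; case: Rle_dec => h2; lra. Qed.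

Lemma logS_le_iff n z : logS n <= z <-> INR (S n) <= exp z.
Proof.
rewrite -exp_logS. split=> h; first by apply exp_mono.
apply Rnot_lt_le => h1. have := exp_increasing _ _ h1. lra.
Qed.

Lemma sum_SnR (a : nat -> R) N : sum_n a (S N) = sum_n a N + a (S N).
Proof. exact (sum_Sn a N). Qed.

(** Either the truncation N has not reached exp z and every term counts, or the count is final and
    within 1 of exp z; the induction on N switches once from the first case to the second. *)
Lemma count_cases z N : 0 <= z ->
  (INR (S N) <= exp z /\ sum_n (fun n => le_ind n z) N = INR (S N)) \/
  (exp z < INR (S N) /\ exp z - 1 <= sum_n (fun n => le_ind n z) N <= exp z).
Proof.
move=> hz. have h1 := exp_ge1 z hz.
elim: N => [|N IH].
- left. rewrite sum_O /le_ind /=. split => //. case: Rle_dec => // h. exfalso. apply h. by apply logS_le_iff.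
- rewrite sum_SnR.
  have e : INR (S (S N)) = INR (S N) + 1 by rewrite (S_INR (S N)).
  case: (le_ind_cases (S N) z) => [[h ->]|[h ->]].
  + move/logS_le_iff in h. left. split => //. case: IH => [[_ ->]|[h2 _]]; lra.
  + have h2 : exp z < INR (S (S N)) by apply Rnot_le_lt => h3; apply h, logS_le_iff.
    right. split => //. rewrite Rplus_0_r. case: IH => [[h3 ->]|[_ h3]]; lra.
Qed.

Lemma count_upper z N : 0 <= z -> sum_n (fun n => le_ind n z) N <= exp z.
Proof. move=> hz. case: (count_cases z N hz) => [[h ->]|[_ h]]; lra. Qed.

Lemma count_lower z N : 0 <= z -> exp z <= INR (S N) -> exp z - 1 <= sum_n (fun n => le_ind n z) N.
Proof. move=> hz hN. case: (count_cases z N hz) => [[h ->]|[_ h]]; lra. Qed.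

Lemma count_window z z' N : 0 <= z <= z' -> sum_n (fun n => le_ind n z' - le_ind n z) N <= exp z' - exp z + 1.
Proof.
move=> hz. rewrite -sum_n_minusR.
case: (count_cases z N ltac:(lra)) => [[h1 e1]|[h1 h2]]; case: (count_cases z' N ltac:(lra)) => [[h3 e3]|[h3 h4]]; have := exp_mono z z' ltac:(lra); lra.
Qed.

Lemma Series_ge_sum_n (w : nat -> R) N : (forall n, 0 <= w n) -> ex_series w -> sum_n w N <= Series w.
Proof.
move=> h hw. have := series_tail w w N (fun n => Req_le _ _ (Rabs_pos_eq _ (h n))) hw.
have := Rabs_pos (Series w - sum_n w N). lra.
Qed.

Lemma sum_n_Rplus (a b : nat -> R) N : sum_n (fun n => a n + b n) N = sum_n a N + sum_n b N.
Proof. exact (sum_n_plus a b N). Qed.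

(* The layer j <= |u n| <= j + 1 is covered by the translates of k by j and - j; beyond J
   only the bound G of g is used. *)
Lemma layers (b u : nat -> R) (k g : R -> R) (phi : nat -> R) (J N : nat) (B G : R) :
  (forall n, 0 <= b n) -> (forall j, 0 <= phi j) -> 0 <= G ->
  (forall x, 0 <= k x) -> (forall x, Rabs x <= 1 -> / 2 <= k x) ->
  (forall j, (j <= J)%nat -> sum_n (fun n => b n * k (u n - INR j)) N <= B) ->
  (forall j, (j <= J)%nat -> sum_n (fun n => b n * k (u n + INR j)) N <= B) ->
  (forall x j, INR j <= Rabs x -> g x <= phi j) ->
  (forall x, INR J <= Rabs x -> g x <= G) ->
  sum_n (fun n => b n * g (u n)) N <= 4 * B * sum_n phi J + G * sum_n b N.
Proof.
move=> hb hphi hG hk hk2 hB1 hB2 hg hg2.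
pose R1 n := sum_n (fun j => phi j * (k (u n - INR j) + k (u n + INR j))) J.
have hR1 n : 0 <= R1 n.
{ apply sum_n_ge0 => j. apply Rmult_le_pos => //. have := hk (u n - INR j). have := hk (u n + INR j). lra. }
(* The factor 2 undoes k >= 1/2. Together with the two translates, each bounded by B, it gives the
   constant 4. *)
have pt n : g (u n) <= 2 * R1 n + G.
{ case: (Rle_dec (INR J) (Rabs (u n))) => hJ; first by have := hg2 _ hJ; have := hR1 n; lra.
  have [j [hj1 hj2]] := nfloor_ex (Rabs (u n)) (Rabs_pos _).
  have hjJ : (j <= J)%nat.
  { apply INR_le. lra. }
  have h1 := hg _ j hj1.
  have h2 : / 2 <= k (u n - INR j) + k (u n + INR j).
  { case: (Rle_dec 0 (u n)) => hu.
    - rewrite Rabs_pos_eq // in hj1 hj2. have := hk2 (u n - INR j) ltac:(apply Rabs_le; lra). have := hk (u n + INR j). lra.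
    - rewrite Rabs_left in hj1 hj2; try lra. have := hk2 (u n + INR j) ltac:(apply Rabs_le; lra). have := hk (u n - INR j). lra. }
  have h3 : phi j * (k (u n - INR j) + k (u n + INR j)) <= R1 n.
  { have hpos i : 0 <= phi i * (k (u n - INR i) + k (u n + INR i)).
    { apply Rmult_le_pos => //. have := hk (u n - INR i). have := hk (u n + INR i). lra. }
    apply: (Rle_trans _ (sum_n (fun j => phi j * (k (u n - INR j) + k (u n + INR j))) j)); last by apply sum_n_mono.
    case: j {hj1 hj2 hjJ h1 h2} => [|j]; first by rewrite sum_O; lra.
    rewrite sum_SnR. have := sum_n_ge0 _ j hpos. lra. }
  have := hphi j. nra. }
have e : sum_n (fun n => b n * R1 n) N <= 2 * B * sum_n phi J.
{ have -> : sum_n (fun n => b n * R1 n) N = sum_n (fun j => phi j * (sum_n (fun n => b n * k (u n - INR j)) N + sum_n (fun n => b n * k (u n + INR j)) N)) J.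
  { rewrite (sum_n_ext _ (fun n => sum_n (fun j => b n * (phi j * (k (u n - INR j) + k (u n + INR j)))) J)); last first.
    { move=> n. by rewrite /R1 sum_n_scal_l. }
    have := sum_n_switch (fun n j => b n * (phi j * (k (u n - INR j) + k (u n + INR j)))) N J.
    move=> ->. apply sum_n_ext => j. rewrite -sum_n_Rplus sum_n_scal_l. apply sum_n_ext => n. Rring. }
  rewrite sum_n_scal_l. rewrite {hR1 pt}.
  have : forall J', (J' <= J)%nat -> sum_n (fun j => phi j * (sum_n (fun n => b n * k (u n - INR j)) N + sum_n (fun n => b n * k (u n + INR j)) N)) J' <= sum_n (fun j => 2 * B * phi j) J'.
  { have one_ j : (j <= J)%nat -> phi j * (sum_n (fun n => b n * k (u n - INR j)) N + sum_n (fun n => b n * k (u n + INR j)) N) <= 2 * B * phi j.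
    { move=> hj. have := hB1 j hj. have := hB2 j hj. have := hphi j. nra. }
    elim=> [|J' IH] hJ'; first by rewrite !sum_O; apply one_.
    rewrite !sum_SnR. have := one_ _ hJ'. have := IH ltac:(lia). lra. }
  apply. lia. }
apply: (Rle_trans _ (sum_n (fun n => b n * (2 * R1 n + G)) N)).
- apply sum_n_le => n. by apply Rmult_le_compat_l.
- have -> : sum_n (fun n => b n * (2 * R1 n + G)) N = 2 * sum_n (fun n => b n * R1 n) N + G * sum_n b N.
  { rewrite !sum_n_scal_l -sum_n_Rplus. apply sum_n_ext => n. Rring. }
  lra.
Qed.

Definition Fej_int (x : R) : R := RInt Fej 0 x.

Lemma ex_RInt_Fej a b : ex_RInt Fej a b.
Proof. apply ex_RInt_cont, Fej_continuous. Qed.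

Lemma Fej_int_diff x y : Fej_int y - Fej_int x = RInt Fej x y.
Proof.
have h : Fej_int x + RInt Fej x y = Fej_int y := RInt_Chasles Fej 0 x y (ex_RInt_Fej _ _) (ex_RInt_Fej _ _). lra.
Qed.

Lemma Fej_int_odd x : Fej_int (- x) = - Fej_int x.
Proof.
rewrite /Fej_int. have h := RInt_comp_lin Fej (-1) 0 0 x (ex_RInt_Fej _ _).
have -> : RInt Fej 0 (- x) = RInt Fej (-1 * 0 + 0) (-1 * x + 0) by f_equal; ring.
rewrite -h. have <- : RInt (fun y => opp (Fej y)) 0 x = - RInt Fej 0 x := RInt_opp _ _ _ (ex_RInt_Fej 0 x).
apply RInt_ext => y _. have -> : -1 * y + 0 = - y by ring. rewrite Fej_even /scal /= /mult /= /opp /=. Rring.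
Qed.

Lemma Fej_int_mono x y : x <= y -> Fej_int x <= Fej_int y.
Proof.
move=> h. have := RInt_ge_0 Fej x y h (ex_RInt_Fej _ _) (fun z _ => Fej_ge0 z). rewrite -Fej_int_diff. lra.
Qed.

Lemma Fej_int_tail x y : 0 < x <= y -> Fej_int y - Fej_int x <= 4 / x.
Proof.
move=> h. rewrite Fej_int_diff.
have hi : is_RInt (fun u => 4 / u ^ 2) x y (minus (- 4 / y) (- 4 / x)).
{ apply (@is_RInt_derive R_CompleteNormedModule (fun u => - 4 / u)) => u; rewrite Rmin_left ?Rmax_right; try lra; move=> hu.
  - auto_derive; first lra. field. lra.
  - apply (@ex_derive_continuous R_AbsRing R_NormedModule). auto_derive. nra. }
apply: (Rle_trans _ (RInt (fun u => 4 / u ^ 2) x y)).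
- apply RInt_le; try lra; first exact: ex_RInt_Fej.
  + eexists; exact hi.
  + move=> u hu. have hu2 : 0 < u ^ 2 by nra.
    apply (Rmult_le_reg_r (u ^ 2)) => //. have -> : 4 / u ^ 2 * u ^ 2 = 4 by field; lra. apply Fej_le_inv_sq.
- rewrite (is_RInt_unique _ _ _ _ hi) /minus /plus /opp /=.
  have -> : - 4 / y + - (- 4 / x) = 4 / x - 4 / y by field; lra.
  have : 0 < 4 / y by apply Rdiv_lt_0_compat; lra. lra.
Qed.

Lemma Fej_int_0 : Fej_int 0 = 0.
Proof. exact (RInt_point 0 Fej). Qed.

Lemma Fej_int_1 : / 2 <= Fej_int 1 <= 1.
Proof.
rewrite /Fej_int. split.
- have -> : / 2 = RInt (fun _ => / 2) 0 1 by rewrite RInt_const /scal /= /mult /=; Rring.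
  apply RInt_le; [lra|apply ex_RInt_const|apply ex_RInt_Fej|].
  move=> x hx. apply Fej_lower, Rabs_le. lra.
- have := abs_RInt_le_const Fej 0 1 1 ltac:(lra) (ex_RInt_Fej _ _) (fun x _ => Rabs_Fej_le x).
  have := Rle_abs (RInt Fej 0 1). lra.
Qed.

(** The order of the tail of the Fejer integral, hence of the error that smoothing makes near an end
    of a window. *)
Definition decay u := / Rmax 1 (Rabs u).

Lemma decay_even u : decay (- u) = decay u.
Proof. by rewrite /decay Rabs_Ropp. Qed.

Lemma decay_gt0 u : 0 < decay u.
Proof. apply Rinv_0_lt_compat. have := Rmax_l 1 (Rabs u). lra. Qed.

(** The kernel has mass at most 1 on [0, 1] and at most 4 / x beyond x >= 1, whence 5. *)
Lemma Fej_int_decay x y : 0 <= x <= y -> 0 <= Fej_int y - Fej_int x <= 5 * decay x.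
Proof.
move=> h. split; first by have := Fej_int_mono x y; lra.
have h1 := Fej_int_1. have h0 := Fej_int_0.
rewrite /decay Rabs_pos_eq; last lra. case: (Rle_dec x 1) => hx.
- rewrite Rmax_left // Rinv_1. have := Fej_int_mono 0 x ltac:(lra). case: (Rle_dec 1 y) => hy.
  + have := Fej_int_tail 1 y ltac:(lra). lra.
  + have := Fej_int_mono y 1 ltac:(lra). lra.
- rewrite Rmax_right; last lra. have := Fej_int_tail x y ltac:(lra). have : 0 < / x by apply Rinv_0_lt_compat; lra.
  rewrite /Rdiv. lra.
Qed.

(* I is the indicator of the window 0 < p <= H; the error is concentrated at its two ends. *)
Lemma Fej_int_window p H : 0 <= H ->
  let I := match Rle_dec p H with left _ => 1 | right _ => 0 end - match Rle_dec p 0 with left _ => 1 | right _ => 0 end in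
  Rabs (Fej_int p - Fej_int (p - H) - 2 * Fej_int H * I) <= 5 * (decay p + decay (p - H)).
Proof.
move=> hH I. have r1 := decay_gt0 p. have r2 := decay_gt0 (p - H).
have e : Fej_int (p - H) = - Fej_int (H - p) by rewrite -Fej_int_odd; f_equal; ring.
have e' : decay (p - H) = decay (H - p) by rewrite -decay_even; f_equal; ring.
rewrite /I. case: (Rle_dec p H) => h1; case: (Rle_dec p 0) => h2.
- have -> : Fej_int p = - Fej_int (- p) by rewrite Fej_int_odd; ring.
  have := Fej_int_decay (- p) (H - p) ltac:(lra). rewrite decay_even => h. rewrite e. apply Rabs_le. lra.
- rewrite e e'. have := Fej_int_decay p H ltac:(lra). have := Fej_int_decay (H - p) H ltac:(lra). move=> a b. apply Rabs_le. lra.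
- lra.
- have := Fej_int_decay (p - H) p ltac:(lra). move=> a. apply Rabs_le. lra.
Qed.

Definition unit_ind x : R := match Rle_dec (Rabs x) 1 with left _ => 1 | right _ => 0 end.

Lemma unit_ind_ge0 x : 0 <= unit_ind x.
Proof. rewrite /unit_ind. case: Rle_dec; lra. Qed.

Lemma unit_ind_lower x : Rabs x <= 1 -> / 2 <= unit_ind x.
Proof. rewrite /unit_ind. case: Rle_dec; lra. Qed.

Lemma exp_2_le x : 0 <= x <= 2 -> exp x <= 1 + 9 * x.
Proof.
move=> hx. have h := exp_lower (- x). have e : exp (- x) * exp x = 1 by rewrite -exp_plus Rplus_opp_l exp_0.
have h3 := exp_le_3. have h9 : exp x <= 9.
{ apply: (Rle_trans _ (exp (1 + 1))); first by apply exp_mono; lra. rewrite exp_plus. have := exp_pos 1. nra. }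
have := exp_pos x. nra.
Qed.

(** On the order of exp z / T integers have their logarithm within 1 / T of z, each of weight at
    most exp (- (z - 1 / T)); the rounding error 1 of the count is absorbed by exp z >= T. *)
Lemma window_ones s T z N : 1 < s -> 1 <= T -> 2 / T <= z -> T <= exp z ->
  sum_n (fun n => exp (- s * logS n) * unit_ind (T * (logS n - z))) N <= 22 / T.
Proof.
move=> hs hT hz hTz. have iT : 0 < / T <= 1.
{ split; first by apply Rinv_0_lt_compat; lra. rewrite -Rinv_1. apply Rinv_le_contravar; lra. }
pose c := exp (- (z - / T)). have hc : 0 < c := exp_pos _.
rewrite /Rdiv in hz.
(* A difference of indicators excludes its left end, so the window is widened to z - 2 / T. *)
apply: (Rle_trans _ (c * sum_n (fun n => le_ind n (z + / T) - le_ind n (z - 2 * / T)) N)).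
- rewrite sum_n_scal_l. apply sum_n_le => n. rewrite /unit_ind. case: Rle_dec => h.
  + have h1 : - / T <= logS n - z <= / T.
    { move: h => /Rabs_le_between [h1 h2]. have e : logS n - z = T * (logS n - z) * / T by field; lra.
      rewrite e. split; nra. }
    case: (le_ind_cases n (z + / T)) => [[_ ->]|[k _]]; last lra.
    case: (le_ind_cases n (z - 2 * / T)) => [[k _]|[_ ->]]; first lra.
    rewrite Rmult_1_r Rminus_0_r Rmult_1_r. apply exp_mono. have := logS_ge0 n. nra.
  + rewrite Rmult_0_r. apply Rmult_le_pos; first lra.
    have := le_ind_mono n (z - 2 * / T) (z + / T) ltac:(lra). lra.
- have h := count_window (z - 2 * / T) (z + / T) N ltac:(lra).
  apply: (Rle_trans _ (c * (exp (z + / T) - exp (z - 2 * / T) + 1))); first by apply Rmult_le_compat_l; lra.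
  have e1 : c * exp (z + / T) = exp (2 * / T) by rewrite /c -exp_plus; f_equal; ring.
  have e2 : c * exp (z - 2 * / T) = exp (- / T) by rewrite /c -exp_plus; f_equal; ring.
  have e3 : c = exp (/ T) * / exp z by rewrite /c -exp_Ropp -exp_plus; f_equal; ring.
  have e4 : / exp z <= / T by apply Rinv_le_contravar; lra.
  have e5 : exp (/ T) <= 3 by apply: Rle_trans exp_le_3; apply exp_mono; lra.
  have e6 := exp_2_le (2 * / T) ltac:(lra). have e7 := exp_lower (- / T).
  have e8 : c <= 3 * / T.
  { rewrite e3. have := exp_pos (/ T). have : 0 < / exp z by apply Rinv_0_lt_compat, exp_pos. nra. }
  rewrite Rmult_plus_distr_l Rmult_minus_distr_l e1 e2 /Rdiv. lra.
Qed.

Lemma nat_floor_half x : 8 <= x -> exists J, INR J <= x / 4 /\ x / 8 <= INR J.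
Proof.
move=> hx. have [J [h1 h2]] := nfloor_ex (x / 4) ltac:(lra). exists J. lra.
Qed.

Lemma exp_eighth_ge y : 256 <= y -> y <= exp (y / 8).
Proof.
move=> hy. have h := exp_lower (y / 16).
have -> : exp (y / 8) = exp (y / 16) ^ 2 by rewrite /= Rmult_1_r -exp_plus; f_equal; field.
have := pow_incr _ _ 2 (conj (ltac:(lra) : 0 <= 1 + y / 16) h). nra.
Qed.

Lemma ones_mass_le y N : 1 <= y -> sum_n (fun n => exp (- (1 + / y) * logS n)) N <= 2 * y.
Proof.
move=> hy. have iy : 0 < / y by apply Rinv_0_lt_compat; lra.
apply: Rle_trans; first by apply zeta_partial_sum_le; lra.
have -> : / (1 + / y - 1) = y by field; lra.
have := exp_pos (- (1 + / y - 1) * logS N). nra.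
Qed.

Section Weights.
Variables (y T : R).
Hypothesis y_large : 256 <= y.
Hypothesis hT : 1 <= T <= y.

(** In layer j, at distance about j / T from z, the kernel is at most 16 / (j + 1)^2, and unit
    windows have mass O(1 / T). Only layers up to J, between T z / 8 and T z / 4, are used, which
    keeps the windows at logarithms of order y; beyond them the bound 4 / J^2 is multiplied by the
    total mass 2 y. *)
Lemma Fej_ones_sum_le z N : y / 4 <= z <= 4 * y ->
  sum_n (fun n => exp (- (1 + / y) * logS n) * Fej (T * (logS n - z))) N <= 12000 / T.
Proof.
move=> hz. set s := 1 + / y. have iy : 0 < / y by apply Rinv_0_lt_compat; lra.
have s_gt1 : 1 < s by rewrite /s; lra. have hTz : y / 4 <= T * z by nra.
have [J [hJ1 hJ2]] := nat_floor_half (T * z) ltac:(lra).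
have iT : 0 < / T <= 1.
{ split; first by apply Rinv_0_lt_compat; lra. rewrite -Rinv_1. apply Rinv_le_contravar; lra. }
have hJ0 : 0 < INR J by lra.
have win z' : 3 / 4 * z <= z' -> sum_n (fun n => exp (- s * logS n) * unit_ind (T * (logS n - z'))) N <= 22 / T.
{ move=> hz'. apply window_ones; [exact s_gt1|lra|rewrite /Rdiv; lra|].
  apply: (Rle_trans _ y); first lra. apply: Rle_trans; first exact (exp_eighth_ge y y_large). apply exp_mono. lra. }
have hj j : (j <= J)%nat -> 0 <= INR j * / T <= z / 4.
{ move=> h. have h1 := le_INR _ _ h. have h0 := pos_INR j. split; first by apply Rmult_le_pos; lra.
  apply (Rmult_le_reg_r T); first lra. rewrite Rmult_assoc Rinv_l; lra. }
have := layers (fun n => exp (- s * logS n)) (fun n => T * (logS n - z)) unit_ind Fej (fun j => 16 * exp (- (2) * logS j)) J N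
  (22 / T) (4 / INR J ^ 2).
move=> H. apply: Rle_trans.
- apply: H.
  + move=> n; left; apply exp_pos.
  + move=> j; have := exp_pos (- (2) * logS j); lra.
  + left. apply Rdiv_lt_0_compat; [lra|by apply pow_lt].
  + exact unit_ind_ge0.
  + exact unit_ind_lower.
  + move=> j h. have := hj j h. move=> h1.
    rewrite (sum_n_ext _ (fun n => exp (- s * logS n) * unit_ind (T * (logS n - (z + INR j * / T))))); first by apply win; lra.
    move=> n. f_equal. f_equal. field. lra.
  + move=> j h. have := hj j h. move=> h1.
    rewrite (sum_n_ext _ (fun n => exp (- s * logS n) * unit_ind (T * (logS n - (z - INR j * / T))))); first by apply win; lra.
    move=> n. f_equal. f_equal. field. lra.
  + move=> x j hx. have -> : - (2) * logS j = - (logS j + logS j) by ring. rewrite exp_Ropp exp_plus exp_logS.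
    have hp := INR_S_pos j. rewrite S_INR in hp *.
    have hpp : 0 < (INR j + 1) * (INR j + 1) by apply Rmult_lt_0_compat.
    apply (Rmult_le_reg_r ((INR j + 1) * (INR j + 1))) => //.
    rewrite Rmult_assoc Rinv_l; last lra.
    have k1 := Fej_le_inv_sq x. have k2 := Rabs_Fej_le x. have k3 := Fej_ge0 x. rewrite (Rabs_pos_eq _ k3) in k2.
    rewrite -(pow2_abs x) in k1. have h0 := pos_INR j.
    have h1 : INR j ^ 2 <= Rabs x ^ 2 by apply pow_incr.
    have h2 : Fej x * INR j ^ 2 <= 4 by have := Rmult_le_compat_l _ _ _ k3 h1; lra.
    have h3 : (INR j + 1) * (INR j + 1) <= 2 * INR j ^ 2 + 2 by have := pow2_ge_0 (INR j - 1); lra.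
    have := Rmult_le_compat_l _ _ _ k3 h3. lra.
  + move=> x hx. apply (Rmult_le_reg_r (INR J ^ 2)); first by apply pow_lt.
    have -> : 4 / INR J ^ 2 * INR J ^ 2 = 4 by field; lra.
    have k1 := Fej_le_inv_sq x. have k3 := Fej_ge0 x. rewrite -(pow2_abs x) in k1.
    have h1 : INR J ^ 2 <= Rabs x ^ 2 by apply pow_incr; lra.
    have := Rmult_le_compat_l _ _ _ k3 h1. lra.
- have m : sum_n (fun n => exp (- s * logS n)) N <= 2 * y by apply ones_mass_le; lra.
  have e1 : sum_n (fun j => 16 * exp (- (2) * logS j)) J <= 32.
  { rewrite -sum_n_scal_l. have := zeta_partial_sum_le 2 J ltac:(lra). have := exp_pos (- (2 - 1) * logS J). lra. }
  have e2 : 4 / INR J ^ 2 * (2 * y) <= 8192 / T.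
  { have h1 : T * y / 32 <= INR J by nra.
    have h2 : (T * y / 32) ^ 2 <= INR J ^ 2 by apply pow_incr; nra.
    apply (Rmult_le_reg_r (INR J ^ 2 * T)); first by apply Rmult_lt_0_compat; [apply pow_lt|]; lra.
    have -> : 4 / INR J ^ 2 * (2 * y) * (INR J ^ 2 * T) = 8 * y * T by field; lra.
    have -> : 8192 / T * (INR J ^ 2 * T) = 8192 * INR J ^ 2 by field; lra.
    have : 8 * y * T <= 8192 * (T * y / 32) ^ 2.
    { have -> : 8192 * (T * y / 32) ^ 2 = 8 * (y * T) * (y * T) by field. have : 1 <= y * T by nra. nra. }
    lra. }
  have m0 : 0 <= 4 / INR J ^ 2 by left; apply Rdiv_lt_0_compat; [lra|by apply pow_lt].
  have h22 : 4 * (22 / T) * sum_n (fun j => 16 * exp (- (2) * logS j)) J <= 4 * (22 / T) * 32.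
  { apply Rmult_le_compat_l => //. rewrite /Rdiv. lra. }
  have := Rmult_le_compat_l _ _ _ m0 m. rewrite /Rdiv in e2 h22 *. lra.
Qed.

(** [decay] is majorized by translates of [Fej] with coefficients 2 / (j + 1), whose sum over the
    layers is the logarithmic loss. The weights b are general because both the constant 1 and Lambda
    are inserted. *)
Lemma decay_sum_le (b : nat -> R) C z N : (forall n, 0 <= b n) -> 0 <= C ->
  (forall z', y / 4 <= z' <= 4 * y -> sum_n (fun n => b n * Fej (T * (logS n - z'))) N <= C / T) ->
  sum_n b N <= C * y -> y / 2 <= z <= 2 * y ->
  sum_n (fun n => b n * decay (T * (logS n - z))) N <= 32 * C * (1 + ln y) / T.
Proof.
move=> hb hC hK hm hz. have hTz : y / 2 <= T * z by nra.
have [J [hJ1 hJ2]] := nat_floor_half (T * z) ltac:(lra).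
have iT : 0 < / T <= 1.
{ split; first by apply Rinv_0_lt_compat; lra. rewrite -Rinv_1. apply Rinv_le_contravar; lra. }
have hJ0 : 0 < INR J by lra.
have hj j : (j <= J)%nat -> 0 <= INR j * / T <= z / 4.
{ move=> h. have h1 := le_INR _ _ h. have h0 := pos_INR j. split; first by apply Rmult_le_pos; lra.
  apply (Rmult_le_reg_r T); first lra. rewrite Rmult_assoc Rinv_l; lra. }
have := layers b (fun n => T * (logS n - z)) Fej decay (fun j => 2 * exp (- logS j)) J N (C / T) (/ INR J).
move=> H. apply: Rle_trans.
- apply: H => //.
  + move=> j; have := exp_pos (- logS j); lra.
  + left. by apply Rinv_0_lt_compat.
  + exact Fej_ge0.
  + exact Fej_lower.
  + move=> j h. have := hj j h. move=> h1.
    rewrite (sum_n_ext _ (fun n => b n * Fej (T * (logS n - (z + INR j * / T))))); first by apply hK; lra.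
    move=> n. f_equal. f_equal. field. lra.
  + move=> j h. have := hj j h. move=> h1.
    rewrite (sum_n_ext _ (fun n => b n * Fej (T * (logS n - (z - INR j * / T))))); first by apply hK; lra.
    move=> n. f_equal. f_equal. field. lra.
  + move=> x j hx. rewrite exp_Ropp exp_logS /decay. have hp := INR_S_pos j. rewrite S_INR in hp *.
    have h0 := pos_INR j. have m1 := Rmax_l 1 (Rabs x). have m2 := Rmax_r 1 (Rabs x).
    have -> : 2 * / (INR j + 1) = / ((INR j + 1) / 2) by field; lra.
    apply Rinv_le_contravar; lra.
  + move=> x hx. rewrite /decay. apply Rinv_le_contravar => //. have := Rmax_r 1 (Rabs x). lra.
- have hly : 0 <= ln y by rewrite -ln_1; apply ln_le; lra.
  have e1 : sum_n (fun j => 2 * exp (- logS j)) J <= 2 * (1 + 2 * ln y).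
  { rewrite -sum_n_scal_l. apply Rmult_le_compat_l; first lra.
    have h1 : forall J, sum_n (fun j => exp (- logS j)) J <= 1 + logS J.
    { elim=> [|J' IH]; first by rewrite sum_O /logS /= ln_1 Ropp_0 exp_0; lra.
      rewrite sum_SnR. have := logS_step J'. lra. }
    apply: Rle_trans; first apply h1. apply Rplus_le_compat_l.
    (* J + 1 <= y^2, since J <= T z / 4 with T <= y and z <= 2 y. *)
    have -> : 2 * ln y = ln (y * y) by rewrite ln_mult; lra.
    rewrite /logS. apply ln_le; first apply INR_S_pos. rewrite S_INR. nra. }
  have e2 : / INR J * (C * y) <= 16 * C / T.
  { have h1 : T * y / 16 <= INR J by nra.
    have h2 : / INR J <= / (T * y / 16) by apply Rinv_le_contravar => //; nra.
    have -> : 16 * C / T = / (T * y / 16) * (C * y) by field; lra.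
    apply Rmult_le_compat_r => //. nra. }
  have m0 : 0 <= / INR J by left; apply Rinv_0_lt_compat.
  have hCT : 0 <= C / T by apply Rmult_le_pos; lra.
  have h3 : 4 * (C / T) * sum_n (fun j => 2 * exp (- logS j)) J <= 4 * (C / T) * (2 * (1 + 2 * ln y)).
  { apply Rmult_le_compat_l => //. lra. }
  have h4 := Rmult_le_compat_l _ _ _ m0 hm.
  have -> : 32 * C * (1 + ln y) / T = 32 * (C / T) * (1 + ln y) by field; lra.
  have e3 : 16 * C / T = 16 * (C / T) by field; lra. nra.
Qed.
End Weights.

Lemma Fej_int_window_logS T z h n : 0 < T -> 0 <= h ->
  Rabs (Fej_int (T * (logS n - z)) - Fej_int (T * (logS n - (z + h))) - 2 * Fej_int (T * h) * (le_ind n (z + h) - le_ind n z))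
  <= 5 * (decay (T * (logS n - z)) + decay (T * (logS n - (z + h)))).
Proof.
move=> hT hh. have := Fej_int_window (T * (logS n - z)) (T * h) ltac:(nra). cbv zeta.
have -> : T * (logS n - z) - T * h = T * (logS n - (z + h)) by ring.
rewrite /le_ind. case: (Rle_dec (T * _) (T * h)) => h1; case: (Rle_dec (T * _) 0) => h2; case: (Rle_dec (logS n) (z + h)) => h3;
case: (Rle_dec (logS n) z) => h4 //; exfalso; nra.
Qed.

Lemma Fej_int_window_RInt T z h n :
  RInt (fun z' => T * Fej (T * (logS n - z'))) z (z + h) = Fej_int (T * (logS n - z)) - Fej_int (T * (logS n - (z + h))).
Proof.
have h1 := RInt_comp_lin Fej (- T) (T * logS n) z (z + h) (ex_RInt_Fej _ _).
have e1 : - T * z + T * logS n = T * (logS n - z) by ring. have e2 : - T * (z + h) + T * logS n = T * (logS n - (z + h)) by ring.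
rewrite e1 e2 -Fej_int_diff in h1.
have h2 : RInt (fun z' => opp (scal (- T) (Fej (- T * z' + T * logS n)))) z (z + h) = - RInt (fun z' => scal (- T) (Fej (- T * z' + T * logS n))) z (z + h).
{ apply: (RInt_opp (V := R_CompleteNormedModule)). apply: ex_RInt_comp_lin. apply ex_RInt_Fej. }
rewrite h1 in h2.
have -> : Fej_int (T * (logS n - z)) - Fej_int (T * (logS n - (z + h))) = - (Fej_int (T * (logS n - (z + h))) - Fej_int (T * (logS n - z))) by ring.
rewrite -h2. apply RInt_ext => x _. rewrite /scal /opp /= /mult /=.
have -> : - T * x + T * logS n = T * (logS n - x) by ring. Rring.
Qed.

(** * Lambda - 1 on short windows *)

Section Lambda.
Variable Lam : nat -> R.
Hypothesis Lam_adm : admissible Lam.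
Hypothesis Lam_conv : log_convolution Lam.

Lemma Lam_mass_le : exists K, 0 <= K /\ forall s N, 1 < s <= 1 + strip ->
  sum_n (fun n => Lam n * exp (- s * logS n)) N <= K + 1 + / (s - 1).
Proof.
have [K [m [hK H]]] := poly_lip_Lam_gap Lam Lam_adm Lam_conv. exists K. split => // s N hs.
have [h _] := H 1 s 0 0 ltac:(lra) hs ltac:(rewrite Rabs_R0; lra) ltac:(rewrite Rabs_R0; lra).
rewrite pow1 Rmult_1_r in h.
have h1 := Rle_trans _ _ _ (re_le_Cmod (Lam_gap Lam s 0)) h. rewrite /Lam_gap /= in h1.
have [_ h2] := DScos_0_bounds s ltac:(lra). have h3 := Rle_abs (DScos Lam s 0 + - DScos ones s 0).
have e n : Lam n * exp (- s * logS n) = dterm Lam s 0 0 n.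
{ rewrite /dterm Rmult_0_l Rplus_0_l cos_0. ring. }
rewrite (sum_n_ext _ _ N e).
have : sum_n (dterm Lam s 0 0) N <= DScos Lam s 0.
{ apply Series_ge_sum_n; last by apply ex_dterm; [|lra].
  move=> n. rewrite -e. apply Rmult_le_pos; [apply Lam_adm|left; apply exp_pos]. }
lra.
Qed.

(** Integrating T times the Fejer bound over centres in [z, z + h] gives O(1 / T) for the smoothed
    window. Passing to the sharp window costs [decay] at both ends, summed against Lambda + 1, which
    is (1 + ln y) / T. The normalization 2 Fej_int (T h) is at least 1 because T h >= 1. *)
Lemma window_bound : exists C m, 0 <= C /\ (0 < m)%nat /\ forall y T, 2400 <= y -> 1 <= T -> T ^ m <= y ->
  exists N0, forall N z h, (N0 <= N)%nat -> y / 2 <= z <= y -> 0 < h <= 1 -> 1 <= T * h ->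
  Rabs (sum_n (fun n => (Lam n - 1) * exp (- (1 + / y) * logS n) * (le_ind n (z + h) - le_ind n z)) N) <= C * (1 + ln y) / T.
Proof.
have [K [m [hK HF]]] := fejer_bound Lam Lam_adm Lam_conv.
have [K0 [hK0 HM]] := Lam_mass_le.
pose C1 := 12001 + 4 * K + K0 + 2.
(* Two extra powers of T turn K T^m / y into O(1 / T^2). The factor 640 = 5 * 4 * 32 combines
   [Fej_int_window], four sums, and [decay_sum_le]. *)
exists (4 * K + 1 + 640 * C1), (m + 2)%nat.
split; first by rewrite /C1; lra. split; first lia.
move=> y T hy hT hTm. set s := 1 + / y.
have iy : 0 < / y <= / 2400. { split; first by apply Rinv_0_lt_compat; lra. apply Rinv_le_contravar; lra. }
have hs : 1 < s <= 1 + strip by rewrite /s /strip; lra.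
have hm1 := pow_ge1 T m hT.
rewrite pow_add in hTm. have hT2 : T ^ 2 = T * T by ring. rewrite hT2 in hTm.
have hTy : T <= y. { apply: Rle_trans hTm. have : 1 <= T * T by nra. nra. }
have iT : 0 < / T <= 1.
{ split; first by apply Rinv_0_lt_compat; lra. rewrite -Rinv_1. apply Rinv_le_contravar; lra. }
have hly : 0 <= ln y by rewrite -ln_1; apply ln_le; lra.
(* N0 depends on y and T; this is harmless because the window sums are eventually constant in N. *)
have [N0 hN0] : exists N0, forall N, (N0 <= N)%nat -> 2 * (Series (weight s) - sum_n (weight s) N) <= / T * / T.
{ have hl : is_lim_seq (sum_n (weight s)) (Series (weight s)) := Series_correct _ (ex_series_weight s (proj1 hs)).
  have heps : 0 < / T * / T / 2 by apply Rdiv_lt_0_compat; [nra|lra].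
  have [N0 h0] := (proj2 (is_lim_seq_spec _ _) hl) (mkposreal _ heps).
  exists N0 => N hN. have := h0 N hN. rewrite /= Rabs_minus_sym => h1.
  have := Rle_abs (Series (weight s) - sum_n (weight s) N). lra. }
exists N0 => N z h hN hz hh hTh.
have fej z' : y / 4 <= z' <= 4 * y -> Rabs (sum_n (fejer_term Lam s T z') N) <= (4 * K + 1) * (/ T * / T).
{ move=> hz'. apply: Rle_trans; first by apply HF => //; lra.
  have h1 := hN0 N hN.
  have h2 : K * T ^ m / z' <= 4 * K * (/ T * / T).
  { apply (Rmult_le_reg_r (z' * (T * T))); first by apply Rmult_lt_0_compat; [lra|nra].
    have -> : K * T ^ m / z' * (z' * (T * T)) = K * (T ^ m * (T * T)) by field; lra.
    have -> : 4 * K * (/ T * / T) * (z' * (T * T)) = K * (4 * z') by field; lra.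
    apply Rmult_le_compat_l => //. lra. }
  lra. }
have Sone z' : y / 4 <= z' <= 4 * y -> sum_n (fun n => exp (- s * logS n) * Fej (T * (logS n - z'))) N <= C1 / T.
{ move=> hz'. apply: Rle_trans; first by apply (Fej_ones_sum_le y T); lra.
  apply Rmult_le_compat_r; [lra|rewrite /C1; lra]. }
(* Lambda = 1 + (Lambda - 1): the upper bound for Lambda near z' comes from the Fejer estimate
   itself. *)
have SLam z' : y / 4 <= z' <= 4 * y -> sum_n (fun n => Lam n * exp (- s * logS n) * Fej (T * (logS n - z'))) N <= C1 / T.
{ move=> hz'. have h1 : sum_n (fun n => exp (- s * logS n) * Fej (T * (logS n - z'))) N <= 12000 / T by apply (Fej_ones_sum_le y T); lra.
  have h2 := fej z' hz'. have h3 := Rle_abs (sum_n (fejer_term Lam s T z') N).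
  have e : sum_n (fun n => Lam n * exp (- s * logS n) * Fej (T * (logS n - z'))) N =
    sum_n (fun n => exp (- s * logS n) * Fej (T * (logS n - z'))) N + sum_n (fejer_term Lam s T z') N.
  { rewrite -sum_n_Rplus. apply sum_n_ext => n. rewrite /fejer_term. Rring. }
  rewrite e /C1. have : (4 * K + 1) * (/ T * / T) <= (4 * K + 1) * / T by apply Rmult_le_compat_l; nra.
  rewrite /Rdiv in h1 *. nra. }
have hC1 : 0 <= C1 by rewrite /C1; lra.
have p1 n : 0 <= exp (- s * logS n) by left; apply exp_pos.
have pL n : 0 <= Lam n * exp (- s * logS n) by apply Rmult_le_pos => //; apply Lam_adm.
have m1 : sum_n (fun n => exp (- s * logS n)) N <= C1 * y.
{ apply: Rle_trans; first by apply (ones_mass_le y); lra. apply Rmult_le_compat_r; rewrite /C1; lra. }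
have mL : sum_n (fun n => Lam n * exp (- s * logS n)) N <= C1 * y.
{ apply: Rle_trans; first by apply HM. have -> : / (s - 1) = y by rewrite /s; field; lra.
  rewrite /C1. nra. }
have R1 z' : y / 2 <= z' <= 2 * y -> sum_n (fun n => exp (- s * logS n) * decay (T * (logS n - z'))) N <= 32 * C1 * (1 + ln y) / T.
{ move=> hz'. apply (decay_sum_le y T) => //; lra. }
have RL z' : y / 2 <= z' <= 2 * y -> sum_n (fun n => Lam n * exp (- s * logS n) * decay (T * (logS n - z'))) N <= 32 * C1 * (1 + ln y) / T.
{ move=> hz'. apply (decay_sum_le y T) => //; lra. }
pose a n := (Lam n - 1) * exp (- s * logS n).
pose I n := le_ind n (z + h) - le_ind n z.
pose P n := Fej_int (T * (logS n - z)) - Fej_int (T * (logS n - (z + h))).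
have bP : Rabs (sum_n (fun n => a n * P n) N) <= (4 * K + 1) / T.
{ pose F n z' := a n * (T * Fej (T * (logS n - z'))).
  have cT n x : continuous (fun z' => T * Fej (T * (logS n - z'))) x.
  { apply: continuous_mult; first apply continuous_const.
    apply: (continuous_comp (fun z' => T * (logS n - z')) Fej); last apply Fej_continuous.
    apply (@ex_derive_continuous R_AbsRing R_NormedModule). auto_derive => //. }
  have cF n x : continuous (F n) x by apply: continuous_mult; [apply continuous_const|apply cT].
  have eF n : RInt (F n) z (z + h) = a n * P n.
  { rewrite /P -Fej_int_window_RInt. exact (RInt_scal _ _ _ _ (ex_RInt_cont _ z (z + h) (cT n))). }
  have [e1 e2] := sum_n_RInt F N z (z + h) cF.
  rewrite -(sum_n_ext _ _ N eF) e1.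
  apply: (Rle_trans _ ((z + h - z) * ((4 * K + 1) / T))).
  - apply abs_RInt_le_const; [lra|by apply ex_RInt_cont|].
    move=> x hx. have -> : sum_n (fun n => F n x) N = T * sum_n (fejer_term Lam s T x) N.
    { rewrite sum_n_scal_l. apply sum_n_ext => n. rewrite /F /a /fejer_term. Rring. }
    rewrite Rabs_mult (Rabs_pos_eq T); last lra. have h1 := fej x ltac:(lra).
    have -> : (4 * K + 1) / T = T * ((4 * K + 1) * (/ T * / T)) by field; lra.
    apply Rmult_le_compat_l; lra.
  - have : 0 <= (4 * K + 1) / T by apply Rmult_le_pos; lra. nra. }
have hKI : / 2 <= Fej_int (T * h) by have := Fej_int_mono 1 (T * h) hTh; have := Fej_int_1; lra.
pose rs n := decay (T * (logS n - z)) + decay (T * (logS n - (z + h))).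
have dif : Rabs (sum_n (fun n => a n * P n) N - 2 * Fej_int (T * h) * sum_n (fun n => a n * I n) N) <= 640 * C1 * (1 + ln y) / T.
{ rewrite sum_n_scal_l sum_n_minusR. apply: Rle_trans; first apply Rabs_sum_n.
  apply: (Rle_trans _ (sum_n (fun n => 5 * ((Lam n * exp (- s * logS n) + exp (- s * logS n)) * rs n)) N)).
  - apply sum_n_le => n.
    have -> : a n * P n - 2 * Fej_int (T * h) * (a n * I n) = a n * (P n - 2 * Fej_int (T * h) * I n) by ring.
    rewrite Rabs_mult. have h1 := Fej_int_window_logS T z h n ltac:(lra) ltac:(lra). rewrite -/(I n) -/(P n) -/(rs n) in h1.
    have h2 : Rabs (a n) <= Lam n * exp (- s * logS n) + exp (- s * logS n).
    { rewrite /a Rmult_minus_distr_r Rmult_1_l. have := pL n. have := p1 n. move=> ? ?. apply Rabs_le. lra. }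
    have h3 := Rmult_le_compat _ _ _ _ (Rabs_pos _) (Rabs_pos _) h2 h1. lra.
  - rewrite -sum_n_scal_l.
    have -> : sum_n (fun n => (Lam n * exp (- s * logS n) + exp (- s * logS n)) * rs n) N =
      (sum_n (fun n => Lam n * exp (- s * logS n) * decay (T * (logS n - z))) N + sum_n (fun n => exp (- s * logS n) * decay (T * (logS n - z))) N) +
      (sum_n (fun n => Lam n * exp (- s * logS n) * decay (T * (logS n - (z + h)))) N + sum_n (fun n => exp (- s * logS n) * decay (T * (logS n - (z + h)))) N).
    { rewrite -!sum_n_Rplus. apply sum_n_ext => n. rewrite /rs. Rring. }
    have := R1 z ltac:(lra). have := RL z ltac:(lra). have := R1 (z + h) ltac:(lra). have := RL (z + h) ltac:(lra).
    have -> : 640 * C1 * (1 + ln y) / T = 20 * (32 * C1 * (1 + ln y) / T) by field; lra. lra. }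
change (Rabs (sum_n (fun n => a n * I n) N) <= (4 * K + 1 + 640 * C1) * (1 + ln y) / T).
move: bP dif. set A := sum_n _ _. set B := sum_n _ _. move=> bP dif.
have h1 : Rabs (2 * Fej_int (T * h) * B) <= (4 * K + 1) / T + 640 * C1 * (1 + ln y) / T.
{ have -> : 2 * Fej_int (T * h) * B = A - (A - 2 * Fej_int (T * h) * B) by ring.
  apply: Rle_trans; first apply Rabs_triang. rewrite Rabs_Ropp. lra. }
rewrite Rabs_mult (Rabs_pos_eq (2 * Fej_int (T * h))) in h1; last lra.
have h2 := Rabs_pos B.
have h3 : (4 * K + 1) / T <= (4 * K + 1) * (1 + ln y) / T.
{ rewrite /Rdiv. apply Rmult_le_compat_r; nra. }
have -> : (4 * K + 1 + 640 * C1) * (1 + ln y) / T = (4 * K + 1) * (1 + ln y) / T + 640 * C1 * (1 + ln y) / T by field; lra.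
nra.
Qed.
End Lambda.

(** * Removal of the weight n^(-s) and asymptotics of psi *)

Lemma exp_secant z h : 0 <= h -> h * exp z <= exp (z + h) - exp z.
Proof. move=> hh. rewrite exp_plus. have := exp_lower h. have := exp_pos z. nra. Qed.

(** On the window n^(-s) lies between exp (- s (z + h)) and exp (- s z); sandwiching the sums of b
    and of 1 costs a factor exp (s h) = 1 + O(h). *)
Lemma window_unweight (b : nat -> R) s z h E N : 1 < s <= 2 -> 0 < h <= 1 -> 0 <= E -> (forall n, 0 <= b n) ->
  Rabs (sum_n (fun n => (b n - 1) * exp (- s * logS n) * (le_ind n (z + h) - le_ind n z)) N) <= E ->
  let D := sum_n (fun n => b n * (le_ind n (z + h) - le_ind n z)) N in
  let D1 := sum_n (fun n => le_ind n (z + h) - le_ind n z) N in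
  D1 - 2 * h * D1 - E * exp (s * z) <= D <= D1 + 18 * h * D1 + E * exp (s * (z + h)).
Proof.
move=> hs hh hE hb hw D D1.
pose I n := le_ind n (z + h) - le_ind n z.
have hI n : I n = 0 \/ (I n = 1 /\ z <= logS n <= z + h).
{ rewrite /I. case: (le_ind_cases n (z + h)) => [[k1 ->]|[k1 ->]]; case: (le_ind_cases n z) => [[k2 ->]|[k2 ->]]; lra. }
pose A := sum_n (fun n => b n * exp (- s * logS n) * I n) N.
pose B := sum_n (fun n => exp (- s * logS n) * I n) N.
have hAB : Rabs (A - B) <= E.
{ rewrite /A /B sum_n_minusR. apply: Rle_trans hw. right. f_equal. apply sum_n_ext => n. rewrite /I. Rring. }
move/Rabs_le_between: hAB => hAB.
have bnd n (c : R) : 0 <= c -> exp (- s * (z + h)) * (c * I n) <= c * exp (- s * logS n) * I n <= exp (- s * z) * (c * I n).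
{ move=> hc. case: (hI n) => [->|[-> [k1 k2]]]; first lra.
  have e1 : exp (- s * (z + h)) <= exp (- s * logS n) by apply exp_mono; nra.
  have e2 : exp (- s * logS n) <= exp (- s * z) by apply exp_mono; nra. nra. }
have a1 : exp (- s * (z + h)) * D <= A.
{ rewrite /D /A sum_n_scal_l. apply sum_n_le => n. apply bnd, hb. }
have a2 : A <= exp (- s * z) * D.
{ rewrite /D /A sum_n_scal_l. apply sum_n_le => n. apply bnd, hb. }
have b1 : exp (- s * (z + h)) * D1 <= B.
{ rewrite /D1 /B sum_n_scal_l. apply sum_n_le => n. have := bnd n 1 ltac:(lra). rewrite -/(I n). lra. }
have b2 : B <= exp (- s * z) * D1.
{ rewrite /D1 /B sum_n_scal_l. apply sum_n_le => n. have := bnd n 1 ltac:(lra). rewrite -/(I n). lra. }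
have hD1 : 0 <= D1.
{ apply sum_n_ge0 => n. have := le_ind_mono n z (z + h). lra. }
have p1 := exp_pos (s * (z + h)). have p2 := exp_pos (s * z).
have i1 : exp (s * (z + h)) * exp (- s * (z + h)) = 1
  by rewrite -exp_plus -exp_0; f_equal; ring.
have i2 : exp (s * z) * exp (- s * z) = 1
  by rewrite -exp_plus -exp_0; f_equal; ring.
have i3 : exp (s * (z + h)) * exp (- s * z) = exp (s * h) by rewrite -exp_plus; f_equal; ring.
have i4 : exp (s * z) * exp (- s * (z + h)) = exp (- (s * h)) by rewrite -exp_plus; f_equal; ring.
split.
- have h1 : exp (s * z) * (exp (- s * (z + h)) * D1) <= exp (s * z) * (exp (- s * z) * D + E) by apply Rmult_le_compat_l; lra.
  rewrite (Rmult_plus_distr_l (exp (s * z))) -!Rmult_assoc i2 i4 in h1.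
  have := exp_lower (- (s * h)). move=> h2. have : (1 - 2 * h) * D1 <= exp (- (s * h)) * D1 by apply Rmult_le_compat_r; nra. lra.
- have h1 : exp (s * (z + h)) * (exp (- s * (z + h)) * D) <= exp (s * (z + h)) * (exp (- s * z) * D1 + E) by apply Rmult_le_compat_l; lra.
  rewrite (Rmult_plus_distr_l (exp (s * (z + h)))) -!Rmult_assoc i1 i3 in h1.
  have h2 := exp_2_le (s * h) ltac:(nra). have : exp (s * h) * D1 <= (1 + 18 * h) * D1 by apply Rmult_le_compat_r; nra. lra.
Qed.

Section Lambda.
Variable Lam : nat -> R.
Hypothesis Lam_adm : admissible Lam.
Hypothesis Lam_conv : log_convolution Lam.

(** Truncated to remain a finite sum; once N + 1 >= exp z it is the Chebyshev function at exp z. *)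
Definition chebyshev_psi z N := sum_n (fun n => Lam n * le_ind n z) N.

Lemma chebyshev_psi_crude z N : 0 <= z -> 0 <= chebyshev_psi z N <= (1 + z) * exp z.
Proof.
move=> hz. split.
- apply sum_n_ge0 => n. apply Rmult_le_pos; [apply Lam_adm|apply le_ind_bounds].
- apply: (Rle_trans _ ((1 + z) * sum_n (fun n => le_ind n z) N)).
  + rewrite sum_n_scal_l. apply sum_n_le => n. have := Lam_adm n. case: (le_ind_cases n z) => [[h ->]|[h ->]]; lra.
  + apply Rmult_le_compat_l; [lra|by apply count_upper].
Qed.

(* A natural number of the order of y^(1 / (2 m)). *)
Lemma choose_scale (m : nat) : (0 < m)%nat -> exists c, 0 <= c /\ forall y, 1 <= y ->
  exists tau, (0 < tau)%nat /\ INR tau ^ (2 * m) <= y /\ (1 + ln y) ^ 2 <= c * INR tau.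
Proof.
move=> hm. have hM : 0 < INR (2 * m) by apply lt_0_INR; lia.
pose d := / INR (2 * m). have hd : 0 < d by apply Rinv_0_lt_compat.
exists (2 * (1 + 2 / d) ^ 2). split; first by have := pow2_ge_0 (1 + 2 / d); lra.
move=> y hy. have hly : 0 <= ln y by rewrite -ln_1; apply ln_le; lra.
have hx1 : 1 <= exp (d * ln y) by apply exp_ge1; nra.
have [tau [h1 h2]] := nfloor_ex (exp (d * ln y)) ltac:(lra).
have h3 : (0 < tau)%nat. { apply INR_lt. simpl. case: tau h1 h2 => [|t] h1 h2; [simpl in h2; lra|apply INR_S_pos]. }
exists tau. split => //. have h4 : 1 <= INR tau by apply (le_INR 1); lia.
split.
- apply: (Rle_trans _ (exp (d * ln y) ^ (2 * m))); first by apply pow_incr; lra.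
  right. rewrite -Rpower_pow; last apply exp_pos. rewrite /Rpower ln_exp /d -Rmult_assoc Rinv_r; last lra.
  rewrite Rmult_1_l exp_ln; lra.
- have := log_weight_le d (ln y) hd hly. have : 0 <= (1 + 2 / d) ^ 2 by apply pow2_ge_0. nra.
Qed.

(** With T = t^2 and windows of width 1 / t, the relative error per window is O((1 + ln y) / t):
    unweighting costs 1 / t, and the weighted error (1 + ln y) / t^2 is divided by the width.
    Windows from about y / 2 to y telescope, the initial part is crudely small, and (1 + ln y)^2 <=
    c t leaves 1 / (1 + ln y). *)
Lemma chebyshev_psi_asymp : exists C, 0 <= C /\ forall y, 2400 <= y -> exists N1, forall N, (N1 <= N)%nat ->
  Rabs (chebyshev_psi y N - exp y) * (1 + ln y) <= C * exp y.
Proof.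
have [C [m [hC [hm HW]]]] := window_bound Lam Lam_adm Lam_conv.
have [c [hc Hc]] := choose_scale m hm.
(* In units of w / t, w the length of the window, 37 = 1 + 18 + 18 collects rounding of the counts
   and unweighting. The 27 bounds exp 3, as s (z + 1 / t) <= z + 3. *)
pose C2 := 37 + 27 * C.
exists (C2 * c + 9). split; first by rewrite /C2; nra.
move=> y hy. have [tau [ht0 [ht1 ht2]]] := Hc y ltac:(lra).
have ht : 1 <= INR tau by apply (le_INR 1); lia.
move: (INR tau) ht ht1 ht2 => t ht ht1 ht2.
have it : 0 < / t <= 1. { split; first by apply Rinv_0_lt_compat; lra. rewrite -Rinv_1. apply Rinv_le_contravar; lra. }
have hT : 1 <= t ^ 2 := pow_ge1 t 2 ht.
have hTm : (t ^ 2) ^ m <= y by rewrite -pow_mult.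
have [N0 HN0] := HW y (t ^ 2) hy hT hTm.
have [N2 hN2] := INR_unbounded (exp (y + 1)).
exists (max N0 N2) => N hN.
have hNe : exp (y + 1) <= INR (S N).
{ have := le_INR N2 (S N) ltac:(lia). lra. }
have hly : 0 <= ln y by rewrite -ln_1; apply ln_le; lra.
have hy8 := exp_eighth_ge y (ltac:(lra)).
pose s := 1 + / y.
have iy : 0 < / y <= / 2400. { split; first by apply Rinv_0_lt_compat; lra. apply Rinv_le_contravar; lra. }
have hs : 1 < s <= 2 by rewrite /s; lra.
have hTy : t ^ 2 <= y.
{ apply: Rle_trans hTm. rewrite -{1}(pow_1 (t ^ 2)). apply Rle_pow => //. }
pose eta := C2 * (1 + ln y) / t.
have heta : 0 <= eta by rewrite /eta /Rdiv; apply Rmult_le_pos; [apply Rmult_le_pos; rewrite /C2; lra|lra].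
have win z : y / 2 <= z <= y -> z + / t <= y + 1 ->
  Rabs (chebyshev_psi (z + / t) N - chebyshev_psi z N - (exp (z + / t) - exp z)) <= eta * (exp (z + / t) - exp z).
{ move=> hz hz1. have hTh : 1 <= t ^ 2 * / t by have -> : t ^ 2 * / t = t by field; lra.
  have hW := HN0 N z (/ t) ltac:(lia) hz it hTh. rewrite -/s in hW.
  set E := C * (1 + ln y) / t ^ 2 in hW.
  have hE : 0 <= E by rewrite /E /Rdiv; apply Rmult_le_pos; [nra|left; apply Rinv_0_lt_compat; lra].
  have := window_unweight Lam s z (/ t) E N hs it hE (fun n => proj1 (Lam_adm n)) hW. cbv zeta.
  have -> : sum_n (fun n => Lam n * (le_ind n (z + / t) - le_ind n z)) N = chebyshev_psi (z + / t) N - chebyshev_psi z N.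
  { rewrite /chebyshev_psi sum_n_minusR. apply sum_n_ext => n. Rring. }
  set D := _ - chebyshev_psi z N. rewrite -sum_n_minusR. set w := exp (z + / t) - exp z.
  have ez : 0 < exp z := exp_pos z.
  have hw : / t * exp z <= w by apply exp_secant; lra.
  have c1 := count_upper (z + / t) N ltac:(lra). have c2 := count_upper z N ltac:(lra).
  have c3 : exp (z + / t) - 1 <= sum_n (fun n => le_ind n (z + / t)) N.
  { apply count_lower; first lra. apply: Rle_trans hNe. apply exp_mono. lra. }
  have c4 : exp z - 1 <= sum_n (fun n => le_ind n z) N.
  { apply count_lower; first lra. apply: Rle_trans hNe. apply exp_mono. lra. }
  set D1 := sum_n (fun n => le_ind n (z + / t)) N - sum_n (fun n => le_ind n z) N. have hD1 : w - 1 <= D1 <= w + 1 by rewrite /D1 /w; lra.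
  have hez : t ^ 2 <= exp z.
  { apply (Rle_trans _ _ _ hTy), (Rle_trans _ _ _ hy8), exp_mono. lra. }
  have hw1 : 1 <= w * / t.
  { apply: (Rle_trans _ (/ t * exp z * / t)); last by apply Rmult_le_compat_r; lra.
    have -> : / t * exp z * / t = exp z * / t ^ 2 by rewrite -pow_inv; ring.
    apply (Rmult_le_reg_r (t ^ 2)); first lra. rewrite Rmult_assoc Rinv_l; lra. }
  have hw2 : exp z <= w * t.
  { apply (Rmult_le_reg_l (/ t)); first lra. have -> : / t * (w * t) = w by field; lra. lra. }
  have hw0 : 0 < w by apply: Rlt_le_trans hw; apply Rmult_lt_0_compat; lra.
  have ex2 : exp (s * (z + / t)) <= 27 * exp z.
  { have -> : s * (z + / t) = z + (z * / y + s * / t) by rewrite /s; ring.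
    rewrite exp_plus Rmult_comm. apply Rmult_le_compat_r; first lra.
    apply: (Rle_trans _ (exp (1 + (1 + 1)))).
    - apply exp_mono. have hzy : z * / y <= 1 by apply (Rmult_le_reg_r y); [lra|rewrite Rmult_assoc Rinv_l; lra].
      nra.
    - rewrite !exp_plus. have := exp_le_3. have := exp_pos 1. nra. }
  have ex1 : exp (s * z) <= 27 * exp z by apply: Rle_trans ex2; apply exp_mono; nra.
  have hEw : E * (27 * exp z) <= 27 * C * ((1 + ln y) * / t) * w.
  { apply: (Rle_trans _ (E * (27 * (w * t)))); first by apply Rmult_le_compat_l; lra.
    right. rewrite /E. field. lra. }
  have k1 : E * exp (s * z) <= E * (27 * exp z) by apply Rmult_le_compat_l.
  have k2 : E * exp (s * (z + / t)) <= E * (27 * exp z) by apply Rmult_le_compat_l.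
  have k3 : / t * D1 <= / t * w + / t by have := Rmult_le_compat_l (/ t) D1 (w + 1) ltac:(lra) ltac:(lra); lra.
  have k4 : / t <= w * / t by lra.
  have k5 : w * / t <= ((1 + ln y) * / t) * w.
  { have : / t <= (1 + ln y) * / t by nra. nra. }
  have -> : eta * w = 37 * (((1 + ln y) * / t) * w) + 27 * C * ((1 + ln y) * / t) * w by rewrite /eta /C2; field; lra.
  move=> [u1 u2]. apply Rabs_le. lra. }
(* The J windows are laid backwards from y: the last ends exactly at y, the first starts in
   [y / 2, y / 2 + 1]. *)
have [J [hJ1 hJ2]] := nfloor_ex (y * t / 2) ltac:(nra).
pose z0 := y - INR J * / t.
have hz0 : y / 2 <= z0 <= y / 2 + 1.
{ have e : y / 2 = (y * t / 2) * / t by field; lra.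
  have q1 : INR J * / t <= y * t / 2 * / t by apply Rmult_le_compat_r; lra.
  have q2 : y * t / 2 * / t <= (INR J + 1) * / t by apply Rmult_le_compat_r; lra.
  rewrite /z0. lra. }
have tel j : (j <= J)%nat -> Rabs (chebyshev_psi (z0 + INR j * / t) N - chebyshev_psi z0 N - (exp (z0 + INR j * / t) - exp z0)) <= eta * (exp (z0 + INR j * / t) - exp z0).
{ elim: j => [|j IH] hj.
  - rewrite /= Rmult_0_l Rplus_0_r !Rminus_diag_eq // Rabs_R0. lra.
  - have IH' := IH ltac:(lia). set zj := z0 + INR j * / t in IH'.
    have e : z0 + INR (S j) * / t = zj + / t by rewrite S_INR /zj; ring.
    rewrite e. have hjj : zj + / t <= y.
    { rewrite -e /z0. have := le_INR _ _ hj. move=> hjJ. have := Rmult_le_compat_r (/ t) _ _ ltac:(lra) hjJ. lra. }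
    have hj0 : 0 <= INR j * / t by apply Rmult_le_pos; [apply pos_INR|lra].
    have h1 := win zj ltac:(rewrite /zj in hjj *; lra) ltac:(lra).
    move: IH' h1 => /Rabs_le_between IH' /Rabs_le_between h1. apply Rabs_le. lra. }
have := tel J (le_n J). have -> : z0 + INR J * / t = y by rewrite /z0; ring.
move=> hfin.
have hp := chebyshev_psi_crude z0 N ltac:(lra).
have ey := exp_pos y. have ez0 := exp_pos z0.
have h1 : Rabs (chebyshev_psi y N - exp y) <= eta * exp y + (2 + z0) * exp z0.
{ move: hfin => /Rabs_le_between hfin. have := Rmult_le_pos _ _ heta (Rlt_le _ _ ez0).
  have z0p : 0 <= z0 by lra.
  have := Rmult_le_pos _ _ z0p (Rlt_le _ _ ez0). move=> ? ?. apply Rabs_le. lra. }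
have h2 : (2 + z0) * exp z0 * (1 + ln y) <= 9 * exp y.
{ have q1 : 1 + ln y <= y by have := exp_lower (ln y); rewrite exp_ln; lra.
  have q2 : exp z0 <= 3 * exp (y / 2).
  { apply: (Rle_trans _ (exp (1 + y / 2))); first by apply exp_mono; lra.
    rewrite exp_plus. apply Rmult_le_compat_r; [left; apply exp_pos|apply exp_le_3]. }
  have q3 : exp y = exp (y / 8) ^ 4 * exp (y / 2).
  { rewrite /= Rmult_1_r -!exp_plus. f_equal. field. }
  have q4 : y ^ 4 <= exp (y / 8) ^ 4 by apply pow_incr; lra.
  have q5 := exp_pos (y / 2).
  have q6 : (2 + z0) * (1 + ln y) <= y ^ 4.
  { apply: (Rle_trans _ ((y + y) * y)); first by apply Rmult_le_compat; lra.
    have -> : y ^ 4 = y * y * (y * y) by ring. have hyy : 2 <= y * y by nra.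
    have := Rmult_le_compat_r (y * y) _ _ ltac:(lra) hyy. lra. }
  have -> : (2 + z0) * exp z0 * (1 + ln y) = ((2 + z0) * (1 + ln y)) * exp z0 by ring.
  have q7 : 0 <= (2 + z0) * (1 + ln y) by apply Rmult_le_pos; lra.
  have q8 := Rmult_le_compat _ _ _ _ q7 (Rlt_le _ _ ez0) q6 q2.
  have q9 := Rmult_le_compat_r _ _ _ (Rlt_le _ _ q5) q4. rewrite q3. lra. }
have h3 : eta * (1 + ln y) <= C2 * c.
{ have -> : eta * (1 + ln y) = C2 * ((1 + ln y) ^ 2 * / t) by rewrite /eta; field; lra.
  apply Rmult_le_compat_l; first by rewrite /C2; lra.
  apply (Rmult_le_reg_r t); first lra. rewrite Rmult_assoc Rinv_l; lra. }
have := Rmult_le_compat_r (1 + ln y) _ _ ltac:(lra) h1. nra.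
Qed.
End Lambda.

End Analytic.

(** * From the Chebyshev function to the prime counting function *)

Module PrimeCount.
Import Reals Lra Lia Psatz Coquelicot structures all_boot Analytic.
Set Bullet Behavior "Strict Subproofs".
Open Scope R_scope.

(** Makes the general lemmas on iterated operators apply to sums of Stdlib reals. *)
HB.instance Definition _ := Monoid.isComLaw.Build R 0 Rplus
  (fun x y z => esym (Rplus_assoc x y z)) Rplus_comm Rplus_0_l.

Lemma sum_n_big (f : nat -> R) N : sum_n f N = \big[Rplus/0]_(i < N.+1) f i.
Proof.
elim: N => [|N IH]; first by rewrite sum_O big_ord1.
by rewrite sum_SnR IH (big_ord_recr N.+1).
Qed.

(** [primes n] lists the distinct prime divisors, so it is a singleton exactly for prime powers; the
    value at 0 and 1 is 0. *)
Definition mangoldt (n : nat) : R := if primes n is [:: p] then ln (INR p) else 0.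

Lemma leb_leq m n : Nat.leb m n = (m <= n)%N.
Proof. by elim: m n => [|m IH] [|n] //=; rewrite IH. Qed.

Lemma mangoldt_pow p j : prime p -> mangoldt (p ^ j.+1) = ln (INR p).
Proof. by move=> pp; rewrite /mangoldt primesX // primes_prime. Qed.

Lemma mangoldt_neq0 d : mangoldt d <> 0 -> exists p j, prime p /\ d = (p ^ j.+1)%N.
Proof.
rewrite /mangoldt. case e: (primes d) => [//|p [|? ?]] // _.
have hp : p \in primes d by rewrite e inE eqxx.
have pp : prime p by move: hp; rewrite mem_primes => /andP [].
have d0 : (0 < d)%N by move: hp; rewrite mem_primes => /and3P [].
exists p, (logn p d).-1. split=> //.
rewrite prednK; last by rewrite logn_gt0.
rewrite {1}(prod_prime_decomp d0) prime_decompE e /=. by rewrite big_seq1.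
Qed.

(** Induction on n = p m with p the least prime factor: the only prime power dividing n but not m is
    p^(v + 1), v the exponent of p in m, and it adds ln p. *)
Lemma mangoldt_divisors B n : (0 < n)%N -> (n < B)%N -> \big[Rplus/0]_(d < B | (d %| n)%N) mangoldt d = ln (INR n).
Proof.
elim/ltn_ind: n => n IH n0 nB.
case: (ltnP 1 n) => [n1|]; last first.
  move=> n1. have -> : n = 1%N by apply/eqP; rewrite eqn_leq n1 n0.
  rewrite /= ln_1 big1 // => d. rewrite dvdn1 => /eqP ->. by rewrite /mangoldt.
have pp := pdiv_prime n1. set p := pdiv n in pp.
have [m nm] : exists m, n = (p * m)%N by exists (n %/ p); rewrite mulnC divnK // pdiv_dvd.
have m0 : (0 < m)%N by move: n0; rewrite nm muln_gt0 => /andP [].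
have mn : (m < n)%N by rewrite nm ltn_Pmull // prime_gt1.
have dvd_mn d : (d %| m)%N -> (d %| n)%N by move=> h; rewrite nm dvdn_mull.
have pos k : (0 < k)%N -> 0 < INR k by move=> h; apply lt_0_INR; apply/ltP.
rewrite (bigID (fun d : 'I_B => (d %| m)%N)) /=.
have -> : \big[Rplus/0]_(d < B | (d %| n)%N && (d %| m)%N) mangoldt d = ln (INR m).
  rewrite -(IH m mn m0 (ltn_trans mn nB)). apply: eq_bigl => d. by case h: (d %| m)%N; rewrite ?andbF // dvd_mn.
set q := (p ^ (logn p m).+1)%N.
have qn : (q %| n)%N by rewrite nm /q expnS dvdn_mul // pfactor_dvdnn.
have qB : (q < B)%N by apply: leq_ltn_trans nB; apply: dvdn_leq.
have qm : ~~ (q %| m)%N by rewrite /q pfactor_dvdn // ltnn.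
rewrite (bigD1 (Ordinal qB)) /=; last by rewrite qn qm.
rewrite big1 ?mangoldt_pow //; last first.
{ move=> d /andP [/andP [dn dm] dq].
  case: (Req_dec (mangoldt d) 0) => // /mangoldt_neq0 [r [j [rp dj]]]. exfalso.
  move/negP: dq; apply. apply/eqP/val_inj => /=. rewrite dj in dn dm *.
  rewrite /q. have lm : ~~ (j < logn r m)%N by rewrite -pfactor_dvdn.
  have ln_ : (j < logn r n)%N by rewrite -pfactor_dvdn.
  rewrite nm lognM // ?prime_gt0 // logn_prime // in ln_.
  case e: (r == p) in ln_.
  - move/eqP: e => e. subst r. move: lm ln_. rewrite -leqNgt add1n ltnS => h1 h2.
    by have -> : j = logn p m by apply/eqP; rewrite eqn_leq h1 h2.
  - move: lm. by rewrite ln_. }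
rewrite nm mult_INR ln_mult; [|by apply: pos; apply: prime_gt0|by apply: pos].
rewrite Rplus_0_r. ring.
Qed.

Definition Lam (n : nat) : R := mangoldt n.+1.

Lemma Lam_adm : admissible Lam.
Proof.
move=> n. have h0 := logS_ge0 n.
case: (Req_dec (Lam n) 0) => [->|]; first lra.
move=> /mangoldt_neq0 [p [j [pp e]]]. rewrite /Lam e mangoldt_pow //.
have h1 : (p <= n.+1)%N by rewrite e -{1}(expn1 p) leq_exp2l // prime_gt1.
have hp : 1 <= INR p by apply (le_INR 1); apply/leP; apply: prime_gt0.
have h2 : ln (INR p) <= logS n by apply ln_le; [lra|apply le_INR; apply/leP].
have h3 : 0 <= ln (INR p) by rewrite -ln_1; apply ln_le; lra.
lra.
Qed.

Lemma big_Rmult_l (I : finType) (P : pred I) (F : I -> R) c : c * \big[Rplus/0]_(i | P i) F i = \big[Rplus/0]_(i | P i) (c * F i).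
Proof. apply: (big_morph (Rmult c)); [exact: Rmult_plus_distr_l|exact: Rmult_0_r]. Qed.

Lemma Lam_conv N (f : nat -> R) :
  sum_n (fun n => logS n * f (S n)) N =
  sum_n (fun m => sum_n (fun k => if Nat.leb (S m * S k) (S N) then Lam m * f (S m * S k)%nat else 0) N) N.
Proof.
rewrite !sum_n_big.
transitivity (\big[Rplus/0]_(n < N.+1) \big[Rplus/0]_(m < N.+1 | (m.+1 %| n.+1)%N) (Lam m * f n.+1)).
- apply: eq_bigr => n _. rewrite Rmult_comm.
  have := mangoldt_divisors N.+2 n.+1 isT (ltn_ord n). rewrite -/(logS n) => <-.
  rewrite big_mkcond big_ord_recl /= Rplus_0_l -big_mkcond big_Rmult_l.
  by apply: eq_bigr => m _; rewrite Rmult_comm.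
- rewrite (eq_bigr _ (fun n _ => big_mkcond _ _)) exchange_big /=. apply: eq_bigr => m _. rewrite sum_n_big.
  (* Both sides count pairs (k, n) with (m + 1)(k + 1) = n + 1: given n there is at most one k,
     given k at most one n. *)
  transitivity (\big[Rplus/0]_(k < N.+1) \big[Rplus/0]_(n < N.+1) if (m.+1 * k.+1 == n.+1)%N then Lam m * f n.+1 else 0).
  + rewrite exchange_big. apply: eq_bigr => n _. case: ifP => h.
    * have [k hk] : exists k, n.+1 = (m.+1 * k.+1)%N.
        move/dvdnP: h => [[|k] hk]; first by []. by exists k; rewrite hk mulnC.
      have kN : (k < N.+1)%N.
        by apply: leq_trans (ltn_ord n); rewrite hk leq_pmull.
      rewrite (bigD1 (Ordinal kN)) //= -hk eqxx big1 ?Rplus_0_r //.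
      move=> k' hk'. case: eqP => // e. case/eqP: hk'. apply: val_inj => /=.
      move: e; rewrite hk => /eqP. by rewrite eqn_pmul2l // => /eqP [].
    * rewrite big1 // => k _. case: eqP => // e. move: h. by rewrite -e dvdn_mulr.
  + apply: eq_bigr => k _. rewrite leb_leq. case: ifP => h.
    * have hN : ((m.+1 * k.+1).-1 < N.+1)%N by exact: h.
      rewrite (bigD1 (Ordinal hN)) //= eqxx big1 ?Rplus_0_r //.
      move=> n hn. case: eqP => // e. case/eqP: hn. apply: val_inj. exact: esym (congr1 predn e).
    * rewrite big1 // => n _. case: eqP => // e.
      have h1 : (m.+1 * k.+1 <= N.+1)%N by rewrite e; exact: ltn_ord.
      by move: (etrans (esym h) h1).
Qed.

(** * Comparison of pi with psi *)

Definition primepi (M : nat) : nat := \sum_(p < M.+1 | prime p) 1.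

Lemma big_Rle (I : finType) (P : pred I) (F G : I -> R) : (forall i, P i -> F i <= G i) ->
  \big[Rplus/0]_(i | P i) F i <= \big[Rplus/0]_(i | P i) G i.
Proof.
move=> h. apply: (big_ind2 (fun x y => x <= y)) => //; first lra.
move=> x1 x2 y1 y2 h1 h2. lra.
Qed.

Lemma big_Rge0 (I : finType) (P : pred I) (F : I -> R) : (forall i, P i -> 0 <= F i) -> 0 <= \big[Rplus/0]_(i | P i) F i.
Proof. move=> h. apply: (big_ind (fun x => 0 <= x)) => //; [lra|move=> x y ? ?; lra]. Qed.

Lemma primepi_const M c : \big[Rplus/0]_(p < M.+1 | prime p) c = INR (primepi M) * c.
Proof.
rewrite /primepi. apply: (big_rec2 (fun x (y : nat) => x = INR y * c)) => [|i y x _ ->]; first by rewrite Rmult_0_l.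
rewrite add1n S_INR. ring.
Qed.

Lemma INR_pos n : (0 < n)%N -> 0 < INR n.
Proof. move=> h. apply lt_0_INR. by apply/ltP. Qed.

Lemma INR_leq m n : (m <= n)%N -> INR m <= INR n.
Proof. move=> h. apply le_INR. by apply/leP. Qed.

Lemma chebyshev_psi_big M N : (0 < M)%N -> (M <= N)%N -> chebyshev_psi Lam (ln (INR M)) N = \big[Rplus/0]_(d < M.+1) mangoldt d.
Proof.
move=> M0 MN. rewrite /chebyshev_psi sum_n_big.
have e (n : nat) : Lam n * le_ind n (ln (INR M)) = if (n < M)%N then Lam n else 0.
{ case: (le_ind_cases n (ln (INR M))) => [[h ->]|[h ->]].
  - move/logS_le_iff: h. rewrite exp_ln; last by apply INR_pos. move/INR_le/leP => ->. by rewrite Rmult_1_r.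
  - case: ifP => h1; last by rewrite Rmult_0_r. exfalso. apply h, logS_le_iff. rewrite exp_ln; last by apply INR_pos. by apply INR_leq. }
rewrite (eq_bigr (fun n : 'I_N.+1 => if (n < M)%N then Lam n else 0)) => [|n _]; last exact: e.
rewrite -big_mkcond big_ord_recl {1}/mangoldt /= Rplus_0_l.
have MN' : (M <= N.+1)%N by apply: leqW.
by rewrite -(big_ord_widen _ (fun n => Lam n) MN').
Qed.

(** The number of powers of p up to M is the integer part of log_p M, and p to that exponent is at
    most M. *)
Lemma mangoldt_prime_part p M : prime p -> (p <= M)%N ->
  \big[Rplus/0]_(d < M.+1) (if primes d == [:: p] then ln (INR p) else 0) <= ln (INR M).
Proof.
move=> pp pM. have p1 : 1 < INR p by apply (lt_INR 1); apply/ltP; apply: prime_gt1.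
have hl : 0 < ln (INR p) by rewrite -ln_1; apply ln_increasing; lra.
set L := trunc_log p M.
have M0 : (0 < M)%N by apply: leq_trans pM; apply: prime_gt0.
apply: (Rle_trans _ (\big[Rplus/0]_(d < M.+1) \big[Rplus/0]_(j < L) (if (d == p ^ j.+1 :> nat)%N then ln (INR p) else 0))).
- apply: big_Rle => d _. case: ifP => h; last first.
  { apply: big_Rge0 => j _. case: ifP => _; lra. }
  have [j dj] : exists j, (d = p ^ j.+1 :> nat)%N.
  { move/eqP: h => h. have hne : mangoldt d <> 0 by rewrite /mangoldt h; lra.
    have [r [j [rp dj]]] := mangoldt_neq0 d hne.
    move: h. rewrite dj primesX // primes_prime // => -[<-]. by exists j. }
  have jL : (j < L)%N by rewrite /L -ltnS -(trunc_expnK j.+1 (prime_gt1 pp)) ltnS; apply: leq_trunc_log; rewrite -dj -ltnS.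
  rewrite (bigD1 (Ordinal jL)) //= dj eqxx. rewrite -[X in X <= _]Rplus_0_r. apply Rplus_le_compat_l.
  apply: big_Rge0 => j' _. case: ifP => _; lra.
- rewrite exchange_big /=.
  apply: (Rle_trans _ (\big[Rplus/0]_(j < L) ln (INR p))).
  + apply: big_Rle => j _. case: (ltnP (p ^ j.+1) M.+1) => hj.
    * rewrite (bigD1 (Ordinal hj)) //= eqxx big1 ?Rplus_0_r; first lra.
      move=> d hd. case: eqP => // e. case/eqP: hd. exact: val_inj.
    * rewrite big1; first lra. move=> d _. case: eqP => // e. move: (ltn_ord d). by rewrite e ltnNge hj.
  + have -> : \big[Rplus/0]_(j < L) ln (INR p) = INR L * ln (INR p).
    { rewrite big_const_ord. elim: (L) => [|L' IH]; first by rewrite /= Rmult_0_l.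
      rewrite iterS IH S_INR. ring. }
    rewrite -ln_pow; last lra. apply ln_le; first by apply pow_lt; lra.
    have -> : INR p ^ L = INR (p ^ L).
    { elim: (L) => [|L' IH] //. by rewrite expnS mult_INR -IH. }
    apply INR_leq. by apply: trunc_logP => //; apply: prime_gt1.
Qed.

Lemma mangoldt_sum_le_primepi M : (0 < M)%N -> \big[Rplus/0]_(d < M.+1) mangoldt d <= INR (primepi M) * ln (INR M).
Proof.
move=> M0. rewrite -primepi_const.
apply: (Rle_trans _ (\big[Rplus/0]_(d < M.+1) \big[Rplus/0]_(p < M.+1 | prime p) (if primes d == [:: val p] then ln (INR p) else 0))).
- apply: big_Rle => d _. rewrite {1}/mangoldt. case e: (primes d) => [|p [|r s]].
  + apply: big_Rge0 => p _ /=. lra.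
  + have hp : p \in primes d by rewrite e inE eqxx.
    move: hp; rewrite mem_primes => /and3P [pp d0 pd].
    have pM : (p < M.+1)%N by apply: leq_ltn_trans (ltn_ord d); apply: dvdn_leq.
    rewrite (bigD1 (Ordinal pM)) //= eqxx -[X in X <= _]Rplus_0_r. apply Rplus_le_compat_l.
    apply: big_Rge0 => q /andP [qp _]. case: ifP => _; last lra.
    rewrite -ln_1; apply ln_le; first lra. apply (INR_leq 1). exact: prime_gt0.
  + apply: big_Rge0 => p' _. rewrite eqseq_cons andbF. lra.
- rewrite exchange_big /=. apply: big_Rle => p pp. apply: mangoldt_prime_part => //. by rewrite -ltnS.
Qed.

(** A prime p with ln p > z is paid for by [mangoldt p]; the others are among the at most exp z
    positive integers up to exp z. *)
Lemma primepi_le_mangoldt_sum M z : (0 < M)%N -> 0 <= z -> INR (primepi M) * z <= \big[Rplus/0]_(d < M.+1) mangoldt d + z * exp z.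
Proof.
move=> M0 hz. rewrite -primepi_const.
apply: (Rle_trans _ (\big[Rplus/0]_(d < M.+1) (mangoldt d + z * (if (0 < d)%N then le_ind d.-1 z else 0)))).
- rewrite big_mkcond. apply: big_Rle => d _.
  have m0 : 0 <= mangoldt d.
  { case: (Req_dec (mangoldt d) 0) => [->|/mangoldt_neq0 [r [j [rp ->]]]]; first lra.
    rewrite mangoldt_pow // -ln_1. apply ln_le; first lra. apply (INR_leq 1). exact: prime_gt0. }
  have l0 := le_ind_bounds d.-1 z.
  case: ifP => pp.
  + rewrite prime_gt0 //. have e : mangoldt d = logS d.-1 by rewrite /mangoldt primes_prime // /logS prednK // prime_gt0.
    case: (le_ind_cases d.-1 z) => [[h ->]|[h ->]]; rewrite e in m0 *; lra.
  + case: ifP => _; nra.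
- rewrite big_split /=. apply Rplus_le_compat_l. rewrite -big_Rmult_l. apply Rmult_le_compat_l => //.
  rewrite big_ord_recl /= Rplus_0_l.
  have := count_upper z M.-1 hz. rewrite sum_n_big prednK //.
Qed.

(** With y = ln M, the choice z = y - 2 ln y makes z exp z at most M / y, while z = y (1 - r) with r
    = 2 ln y / y = O(1 / (1 + ln y)). The opposite inequality is psi(M) <= pi(M) ln M. *)
Lemma primepi_asymp : exists C, 0 <= C /\ forall M : nat, (0 < M)%N -> 2400 <= ln (INR M) ->
  Rabs (INR (primepi M) * ln (INR M) - INR M) * (1 + ln (ln (INR M))) <= C * INR M.
Proof.
have [C [hC H]] := chebyshev_psi_asymp Lam Lam_adm Lam_conv.
exists (C + 36 * (1 + C) + 2). split; first lra.
move=> M M0 hy. have Mp := INR_pos M M0. set y := ln (INR M) in hy *.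
have ey : exp y = INR M by rewrite exp_ln.
have [N1 HN] := H y hy. have := HN (maxn N1 M) ltac:(apply/leP; apply: leq_maxl).
rewrite chebyshev_psi_big //; last exact: leq_maxr. rewrite ey.
have low := mangoldt_sum_le_primepi M M0. rewrite -/y in low.
have hly : 0 <= ln y by rewrite -ln_1; apply ln_le; lra.
have hw2 := log_weight_le 1 (ln y) ltac:(lra) hly. rewrite Rmult_1_l exp_ln in hw2; last lra.
have hw1 : 1 + ln y <= y by have := exp_lower (ln y); rewrite exp_ln; lra.
pose r := 2 * ln y / y. have iy : 0 < / y by apply Rinv_0_lt_compat; lra.
have hr0 : 0 <= r by rewrite /r /Rdiv; apply Rmult_le_pos; lra.
have hr1 : r * (1 + ln y) <= 18.
{ have e : r * (1 + ln y) = 2 * (ln y * (1 + ln y)) * / y by rewrite /r; field; lra.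
  rewrite e. apply (Rmult_le_reg_r y); first lra. rewrite Rmult_assoc Rinv_l; last lra. nra. }
have hry : r * y = 2 * ln y by rewrite /r; field; lra.
have hln : 4 * ln y <= y.
{ have h1 := log_weight_le (/ 4) (ln y) ltac:(lra) hly.
  have h2 : exp (/ 4 * ln y) ^ 4 = y by transitivity (exp (ln y)); [rewrite /= Rmult_1_r -!exp_plus; f_equal; field|apply exp_ln; lra].
  have h3 := exp_lower (/ 4 * ln y). set x := exp (/ 4 * ln y) in h2 h3.
  have h4 : ln y <= 4 * (x - 1) by lra.
  have h5 : 16 * (x - 1) <= x ^ 4. { have : 0 <= (x ^ 2 - 4) ^ 2 by apply pow2_ge_0. have : 0 <= (x - 1) ^ 2 by apply pow2_ge_0. nra. }
  lra. }
have hr2 : r <= / 2 by apply (Rmult_le_reg_r y); lra.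
set z := y - 2 * ln y. have hz : 0 <= z by rewrite /z; lra.
have up := primepi_le_mangoldt_sum M z M0 hz.
have ez : exp z * y ^ 2 = INR M.
{ rewrite /z. have -> : y - 2 * ln y = y + (- ln y + - ln y) by ring. rewrite !exp_plus exp_Ropp exp_ln; last lra. rewrite ey. field. lra. }
set P := INR (primepi M) in low up *. set S := \big[Rplus/0]_(d < M.+1) mangoldt d in low up *.
move=> hS.
have hS1 : Rabs (S - INR M) <= C * INR M.
{ apply: Rle_trans hS. have := Rabs_pos (S - INR M). nra. }
have hz2 : z = y * (1 - r) by rewrite /z Rmult_minus_distr_l Rmult_1_r (Rmult_comm y) hry.
have up2 : P * y <= S * (1 + 2 * r) + 2 * INR M * / y.
{ have hS0 : 0 <= S + z * exp z by apply: Rle_trans up; apply Rmult_le_pos => //; apply pos_INR.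
  have e1 : 1 <= (1 - r) * (1 + 2 * r) by nra.
  have hP : 0 <= P by apply pos_INR.
  have h1 : P * y <= (P * z) * (1 + 2 * r).
  { rewrite hz2. have : 0 <= P * y by apply Rmult_le_pos; lra. nra. }
  have h2 : (P * z) * (1 + 2 * r) <= (S + z * exp z) * (1 + 2 * r) by apply Rmult_le_compat_r; lra.
  have h3 : z * exp z * (1 + 2 * r) <= 2 * INR M * / y.
  { have -> : 2 * INR M * / y = exp z * (2 * y) by rewrite -ez; field; lra.
    have -> : z * exp z * (1 + 2 * r) = exp z * (z * (1 + 2 * r)) by ring.
    apply Rmult_le_compat_l; [left; apply exp_pos|]. have : z * (1 + 2 * r) <= z * 2 by apply Rmult_le_compat_l; lra.
    rewrite /z. lra. }
  lra. }
apply (Rmult_le_reg_r (/ (1 + ln y))); first by apply Rinv_0_lt_compat; lra.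
have il : 0 < / (1 + ln y) by apply Rinv_0_lt_compat; lra.
have il1 : (1 + ln y) * / (1 + ln y) = 1 by rewrite Rinv_r; lra.
rewrite Rmult_assoc il1 Rmult_1_r.
have hS2 : Rabs (S - INR M) <= C * INR M * / (1 + ln y).
{ apply (Rmult_le_reg_r (1 + ln y)); first lra. rewrite (Rmult_assoc (C * _)) Rinv_l; lra. }
have a1 : r <= 18 * / (1 + ln y).
{ apply (Rmult_le_reg_r (1 + ln y)); first lra. rewrite Rmult_assoc Rinv_l; lra. }
have a2 : / y <= / (1 + ln y) by apply Rinv_le_contravar; lra.
move: hS1 hS2 => /Rabs_le_between hS1 /Rabs_le_between hS2.
have a3 : S * (2 * r) <= (1 + C) * INR M * (36 * / (1 + ln y)).
{ apply: (Rle_trans _ ((1 + C) * INR M * (2 * r))).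
  - apply Rmult_le_compat_r; lra.
  - apply Rmult_le_compat_l; [nra|lra]. }
have a4 : 2 * INR M * / y <= 2 * INR M * / (1 + ln y) by apply Rmult_le_compat_l; lra.
have a5 : 0 <= (36 * (1 + C) + 2) * INR M * / (1 + ln y) by apply Rmult_le_pos; [apply Rmult_le_pos|]; lra.
apply Rabs_le. lra.
Qed.

Lemma INR_expn m n : INR (m ^ n) = INR m ^ n.
Proof. elim: n => [|n IH] //. by rewrite expnS mult_INR IH. Qed.

Lemma ln2_half : / 2 <= ln 2.
Proof.
have := exp_lower (- ln 2). rewrite exp_Ropp exp_ln; lra.
Qed.

(** The integer k replaces ln ln M, as 2^(2^k) <= M forces k <= 2 (1 + ln ln M); this leaves a
    single logarithm to encode. When ln M < 2400, k is at most 4800 and the constant 4801 * 4800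
    suffices. *)
Lemma primepi_asymp_dyadic : exists C : nat, forall M k : nat, (2 ^ (2 ^ k) <= M)%N ->
  Rabs (INR (primepi M) * ln (INR M) - INR M) * INR k <= INR C * INR M.
Proof.
have [C [hC H]] := primepi_asymp.
have [C' hC'] := INR_unbounded (2 * C + 4801 * 4800).
exists C' => M k hk.
have M0 : (0 < M)%N by apply: leq_trans hk; rewrite expn_gt0.
have Mp : 1 <= INR M by apply (INR_leq 1).
have h0 : INR (2 ^ k) * / 2 <= ln (INR M).
{ apply: (Rle_trans _ (INR (2 ^ k) * ln 2)); first by apply Rmult_le_compat_l; [apply pos_INR|apply ln2_half].
  rewrite -ln_pow; last lra. apply ln_le; first by apply pow_lt; lra.
  have := INR_leq _ _ hk. by rewrite INR_expn. }
have hp := Rabs_pos (INR (primepi M) * ln (INR M) - INR M).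
have hk0 := pos_INR k.
case: (Rle_dec 2400 (ln (INR M))) => hy.
- have h1 : INR k <= 2 * (1 + ln (ln (INR M))).
  { have h2 : ln (INR (2 ^ k) * / 2) <= ln (ln (INR M)).
    { apply ln_le => //. apply Rmult_lt_0_compat; last lra. apply INR_pos. by rewrite expn_gt0. }
    rewrite ln_mult in h2; [|apply INR_pos; by rewrite expn_gt0|lra]. rewrite INR_expn ln_pow in h2; last (simpl; lra).
    rewrite ln_Rinv in h2; last lra. have e2 : INR 2 = 2 by [].
    rewrite e2 in h2. have := ln2_half. have : ln 2 <= 1.
    { have := exp_lower (ln 2). rewrite exp_ln; lra. }
    move=> q1 q2. nra. }
  have h3 := H M M0 hy. nra.
- have h1 : INR k <= 4800.
  { have : INR k <= INR (2 ^ k) by apply INR_leq; apply: ltnW; apply: ltn_expl. lra. }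
  have hl : 0 <= ln (INR M) by rewrite -ln_1; apply ln_le; lra.
  have hpi : INR (primepi M) <= INR M + 1.
  { rewrite -S_INR. apply INR_leq. rewrite /primepi sum1_card. apply: leq_trans (max_card _) _. by rewrite card_ord. }
  have h2 : Rabs (INR (primepi M) * ln (INR M) - INR M) <= 4801 * INR M.
  { have := pos_INR (primepi M). move=> q. have q2 : 0 <= INR (primepi M) * ln (INR M) by apply Rmult_le_pos.
    have q3 : INR (primepi M) * ln (INR M) <= (INR M + 1) * 2400 by apply Rmult_le_compat; lra.
    apply Rabs_le. lra. }
  have := Rmult_le_compat _ _ _ _ hp hk0 h2 h1. nra.
Qed.

(* An encoding of |pi(M) ln M - M| <= C M / k without real numbers, which carries the result
   from the Stdlib reals to any realType: x <= ln M iff (1 + x / n)^n <= M for all n. *)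
Lemma primepi_nat_bounds : exists C : nat, forall M k n : nat, (2 ^ (2 ^ k) <= M)%N -> (0 < n)%N ->
  ((k + C) * M <= n -> M ^ (k * primepi M) * (n - (k + C) * M) ^ n <= n ^ n)%N /\
  ((n + (k - C) * M) ^ n <= M ^ (k * primepi M) * n ^ n)%N.
Proof.
have [C H] := primepi_asymp_dyadic. exists C => M k n hk n0.
have M0 : (0 < M)%N by apply: leq_trans hk; rewrite expn_gt0.
have Mp := INR_pos M M0. have np := INR_pos n n0. have h := H M k hk.
set b := (k * primepi M)%N.
have eb : INR (M ^ b) = exp (INR b * ln (INR M)).
{ rewrite INR_expn -Rpower_pow //. }
have hb : INR b * ln (INR M) = INR k * (INR (primepi M) * ln (INR M)) by rewrite mult_INR; ring.
have hk0 := pos_INR k.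
have h' : - (INR C * INR M) <= INR k * (INR (primepi M) * ln (INR M)) - INR k * INR M <= INR C * INR M.
{ have e : Rabs (INR k * (INR (primepi M) * ln (INR M)) - INR k * INR M) <= INR C * INR M.
  { rewrite -Rmult_minus_distr_l Rabs_mult (Rabs_pos_eq (INR k)) //. lra. }
  by move/Rabs_le_between: e. }
have powexp x : exp x ^ n = exp (INR n * x).
{ elim: (n) => [|n' IH]; first by rewrite /= Rmult_0_l exp_0. rewrite S_INR /= IH -exp_plus. f_equal. ring. }
split.
- move=> han. set a := ((k + C) * M)%N in han *.
  apply/leP/INR_le. rewrite mult_INR eb !INR_expn.
  have ea : INR a = (INR k + INR C) * INR M by rewrite mult_INR plus_INR.
  have hba : INR b * ln (INR M) <= INR a by rewrite hb ea; lra.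
  have e1 : INR (n - a) = INR n - INR a by rewrite minus_INR //; apply/leP.
  have h1 : INR (n - a) <= INR n * exp (- (INR a / INR n)).
  { rewrite e1. have := exp_lower (- (INR a / INR n)). move=> h2.
    have := Rmult_le_compat_l _ _ _ (Rlt_le _ _ np) h2. have -> : INR n * (1 + - (INR a / INR n)) = INR n - INR a by field; lra. by []. }
  have h2 : INR (n - a) ^ n <= INR n ^ n * exp (- INR a).
  { apply: Rle_trans; first by apply pow_incr; split; [apply pos_INR|exact h1].
    rewrite Rpow_mult_distr powexp. right. f_equal. f_equal. field. lra. }
  apply: (Rle_trans _ (exp (INR a) * (INR n ^ n * exp (- INR a)))).
  + apply Rmult_le_compat; [left; apply exp_pos|apply pow_le, pos_INR|by apply exp_mono|exact h2].
  + have e2 : exp (INR a) * exp (- INR a) = 1 by rewrite -exp_plus Rplus_opp_r exp_0.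
    right. rewrite (Rmult_comm (INR n ^ n)) -Rmult_assoc e2. ring.
- set a := ((k - C) * M)%N.
  apply/leP/INR_le. rewrite mult_INR eb !INR_expn plus_INR.
  have hba : INR a <= INR b * ln (INR M).
  { have hl : 0 <= ln (INR M) by rewrite -ln_1; apply ln_le; [lra|apply (INR_leq 1)].
    (* The subtraction k - C is truncated: for k <= C the lower bound is 0. *)
    rewrite /a. case: (leqP k C) => hkC.
    - have -> : (k - C = 0)%N by apply/eqP. rewrite mul0n /=. apply Rmult_le_pos => //. apply pos_INR.
    - rewrite mult_INR minus_INR; last by apply/leP; apply: ltnW. rewrite hb. lra. }
  have h1 : INR n + INR a <= INR n * exp (INR a / INR n).
  { have := exp_lower (INR a / INR n). move=> h2.
    have := Rmult_le_compat_l _ _ _ (Rlt_le _ _ np) h2. have -> : INR n * (1 + INR a / INR n) = INR n + INR a by field; lra. by []. }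
  apply: Rle_trans; first by apply pow_incr; split; [have := pos_INR a; lra|exact h1].
  rewrite Rpow_mult_distr powexp Rmult_comm. apply Rmult_le_compat_r; first by apply pow_le; lra.
  apply exp_mono. have -> : INR n * (INR a / INR n) = INR a by field; lra. exact hba.
Qed.

End PrimeCount.

From mathcomp Require Import all_boot all_order all_algebra.
From mathcomp Require Import reals exp.
From mathcomp Require Import ring lra zify.
From mathcomp Require sequences.

Set Implicit Arguments.
Unset Strict Implicit.
Unset Printing Implicit Defensive.
Import Order.TTheory GRing.Theory Num.Theory.
Local Open Scope ring_scope.
Local Notation expR := sequences.expR.

Local Notation primepi := PrimeCount.primepi.

(** * Transfer of the estimate to an arbitrary realType *)

Section PNT.
Variable R : realType.
Implicit Types (x y : R) (n a b M : nat).

Lemma bernoulli x n : 0 <= x <= 1 -> 1 - n%:R * x <= (1 - x) ^+ n.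
Proof.
move=> hx; elim: n => [|n IH]; first by rewrite expr0; lra.
rewrite exprS -natr1.
have h1 : (1 - x) * (1 - n%:R * x) <= (1 - x) * (1 - x) ^+ n by apply: ler_wpM2l => //; lra.
apply: le_trans h1. have : 0 <= n%:R :> R by []. nra.
Qed.

(** Multiply exp x (1 - x) <= 1 by 1 + x, and exp (- x) (1 + x) <= 1 by 1 - x. These converses of 1
    + x <= exp x, up to x^2, let (1 + a / n)^n stand for exp a. *)
Lemma expR_sq_le x : 0 <= x <= 1 -> expR x * (1 - x ^+ 2) <= 1 + x /\ expR (- x) * (1 - x ^+ 2) <= 1 - x.
Proof.
move=> hx. have h1 := expR_ge1Dx x. have h2 := expR_ge1Dx (- x).
have p1 := expR_gt0 x. have p2 := expR_gt0 (- x).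
have e : expR x * expR (- x) = 1 by rewrite -expRD subrr expR0.
split; nra.
Qed.

(** The limit in n through the Archimedean property: if X > 1, any n > X c / (X - 1) violates the
    inequality. *)
Lemma le1_of_archi (X c : R) (m : nat) : 0 <= c -> 0 <= X ->
  (forall n, (0 < n)%N -> (m <= n)%N -> X * (1 - c / n%:R) <= 1) -> X <= 1.
Proof.
move=> hc hX h. rewrite leNgt; apply/negP => X1.
pose n := (Num.truncn (X * c / (X - 1))).+1.
have hn := h (n + m)%N isT (leq_addl _ _).
have n0 : 0 < (n + m)%:R :> R by rewrite ltr0n.
have h1 : X * c / (X - 1) < (n + m)%:R.
  have h2 : X * c / (X - 1) < n%:R by apply: Num.Theory.truncnS_gt.
  by apply: lt_le_trans h2 _; rewrite ler_nat leq_addr.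
have h2 : X * c < (n + m)%:R * (X - 1) by rewrite -ltr_pdivrMr //; lra.
have h3 : (X * (1 - c / (n + m)%:R)) * (n + m)%:R <= 1 * (n + m)%:R by rewrite ler_pM2r.
have e : (X * (1 - c / (n + m)%:R)) * (n + m)%:R = X * (n + m)%:R - X * c by field; lra.
lra.
Qed.

(** The n-th power of [expR_sq_le] at a / n and Bernoulli's inequality give exp (- a) (1 - a^2 / n)
    <= (1 - a / n)^n, so M^b exp (- a) (1 - a^2 / n) <= 1 for all n > a. *)
Lemma ln_le_nat M a b : (0 < M)%N ->
  (forall n, (0 < n)%N -> (a <= n)%N -> (M ^ b * (n - a) ^ n <= n ^ n)%N) ->
  b%:R * ln M%:R <= a%:R :> R.
Proof.
move=> M0 h. have Mp : 0 < M%:R :> R by rewrite ltr0n.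
suff : expR (b%:R * ln M%:R) * expR (- a%:R) <= 1 :> R by move=> le1; rewrite -subr_le0 -exp.ler_expR exp.expR0 exp.expRD.
rewrite expRM_natl lnK ?posrE //.
apply: (@le1_of_archi _ (a%:R ^+ 2) a.+1); first by rewrite exprn_ge0.
  by rewrite mulr_ge0 ?exprn_ge0 ?exp.expR_ge0.
move=> n n0 an. have np : 0 < n%:R :> R by rewrite ltr0n.
have hx : 0 <= (a%:R / n%:R : R) <= 1.
  by rewrite divr_ge0 //= ler_pdivrMr // mul1r ler_nat ltnW.
have h1 := h n n0 (ltnW an).
have h2 : (M%:R ^+ b) * (1 - a%:R / n%:R) ^+ n <= 1 :> R.
  have h3 : ((M ^ b * (n - a) ^ n)%N%:R : R) <= (n ^ n)%N%:R by rewrite ler_nat.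
  rewrite natrM !natrX natrB in h3; last exact: ltnW.
  rewrite -(ler_pM2r (exprn_gt0 n np)) mul1r -mulrA -exprMn mulrBl mul1r divfK //; lra.
apply: le_trans h2. rewrite -mulrA ler_pM2l ?exprn_gt0 //.
have e : expR (- a%:R) = expR (- (a%:R / n%:R)) ^+ n :> R.
  by rewrite -expRM_natl; congr expR; field; lra.
have hx2 : 0 <= (a%:R / n%:R : R) ^+ 2 <= 1 by rewrite exprn_ge0 ?exprn_ile1 //; case/andP: hx.
have h3 := bernoulli n hx2.
have -> : 1 - a%:R ^+ 2 / n%:R = 1 - n%:R * (a%:R / n%:R : R) ^+ 2 by field; lra.
apply: le_trans (_ : expR (- a%:R) * (1 - (a%:R / n%:R) ^+ 2) ^+ n <= _).
  by rewrite ler_pM2l ?expR_gt0.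
rewrite e -exprMn. apply: lerXn2r; rewrite ?nnegrE.
- by rewrite mulr_ge0 ?expR_ge0 // subr_ge0; case/andP: hx2.
- by rewrite subr_ge0; case/andP: hx.
- by case: (expR_sq_le hx).
Qed.

(** The hypothesis says (1 + a / n)^n <= M^b, and its left side is at least exp a (1 - a^2 / n) for
    n > a. *)
Lemma ln_ge_nat M a b : (0 < M)%N ->
  (forall n, (0 < n)%N -> ((n + a) ^ n <= M ^ b * n ^ n)%N) ->
  a%:R <= b%:R * ln M%:R :> R.
Proof.
move=> M0 h. have Mp : 0 < M%:R :> R by rewrite ltr0n.
suff : expR (a%:R) * expR (- (b%:R * ln M%:R)) <= 1 :> R by move=> le1; rewrite -subr_le0 -exp.ler_expR exp.expR0 exp.expRD.
rewrite expRN expRM_natl lnK ?posrE //.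
have Mb : 0 < M%:R ^+ b :> R by rewrite exprn_gt0.
apply: (@le1_of_archi _ (a%:R ^+ 2) a.+1); first by rewrite exprn_ge0.
  by rewrite mulr_ge0 ?exp.expR_ge0 // invr_ge0 exprn_ge0.
move=> n n0 an. have np : 0 < n%:R :> R by rewrite ltr0n.
have hx : 0 <= (a%:R / n%:R : R) <= 1.
  by rewrite divr_ge0 //= ler_pdivrMr // mul1r ler_nat ltnW.
have h2 : (1 + a%:R / n%:R) ^+ n <= M%:R ^+ b :> R.
  have h3 : (((n + a) ^ n)%N%:R : R) <= (M ^ b * n ^ n)%N%:R by rewrite ler_nat h.
  rewrite natrM !natrX natrD in h3.
  rewrite -(ler_pM2r (exprn_gt0 n np)) -exprMn mulrDl mul1r divfK //; lra.
rewrite mulrAC ler_pdivrMr // mul1r. apply: le_trans h2.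
have e : expR (a%:R) = expR (a%:R / n%:R) ^+ n :> R.
  by rewrite -expRM_natl; congr expR; field; lra.
have hx2 : 0 <= (a%:R / n%:R : R) ^+ 2 <= 1 by rewrite exprn_ge0 ?exprn_ile1 //; case/andP: hx.
have h3 := bernoulli n hx2.
have -> : 1 - a%:R ^+ 2 / n%:R = 1 - n%:R * (a%:R / n%:R : R) ^+ 2 by field; lra.
apply: le_trans (_ : expR (a%:R) * (1 - (a%:R / n%:R) ^+ 2) ^+ n <= _).
  by rewrite ler_pM2l ?expR_gt0.
rewrite e -exprMn. apply: lerXn2r; rewrite ?nnegrE.
- by rewrite mulr_ge0 ?expR_ge0 // subr_ge0; case/andP: hx2.
- by rewrite addr_ge0 //; case/andP: hx.
- by case: (expR_sq_le hx).
Qed.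

Lemma pnt_bound : exists C : nat, forall M k, (2 ^ (2 ^ k) <= M)%N ->
  `|(primepi M)%:R * ln M%:R - M%:R| * k%:R <= C%:R * M%:R :> R.
Proof.
have [C H] := PrimeCount.primepi_nat_bounds. exists C => M k hk.
have M0 : (0 < M)%N by apply: leq_trans hk; rewrite expn_gt0.
have h1 : (k * primepi M)%N%:R * ln M%:R <= ((k + C) * M)%N%:R :> R.
  by apply: ln_le_nat => // n n0 an; case: (H M k n hk n0) => h _; apply: h.
have h2 : ((k - C) * M)%N%:R <= (k * primepi M)%N%:R * ln M%:R :> R.
  by apply: ln_ge_nat => // n n0; case: (H M k n hk n0).
rewrite natrM in h1 h2. rewrite natrM natrD in h1.
have h3 : (k%:R - C%:R) * M%:R <= ((k - C) * M)%N%:R :> R.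
  rewrite natrM ler_pM2r ?ltr0n //. case: (leqP C k) => hC; first by rewrite natrB.
  by rewrite (eqP (ltnW hC)) subr_le0 ler_nat ltnW.
rewrite -[k%:R]ger0_norm // -normrM ler_norml. lra.
Qed.
End PNT.

(** * An upper bound for prime pairs *)

Section PeriodicSums.
Variable R : realFieldType.
Implicit Types (f g : nat -> R).

Definition periodic (M : nat) f := forall n, f (n + M)%N = f n.

Lemma periodic_mod M f n : periodic M f -> f (n %% M)%N = f n.
Proof.
move=> hf; rewrite {2}(divn_eq n M) addnC.
by elim: (n %/ M)%N => [|k IH]; rewrite ?mul0n ?addn0 // mulSn addnA addnAC hf.
Qed.

Lemma periodic_mull a b f : periodic b f -> periodic (a * b) f.
Proof. by move=> hf n; elim: a => [|a IH]; rewrite ?mul0n ?addn0 // mulSn addnA addnAC hf. Qed.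

Lemma periodic_mulr a b f : periodic a f -> periodic (a * b) f.
Proof. by rewrite mulnC; apply: periodic_mull. Qed.

Lemma periodicM M f g : periodic M f -> periodic M g -> periodic M (fun n => f n * g n).
Proof. by move=> hf hg n; rewrite hf hg. Qed.

Lemma sum_crt a b f g : (0 < a)%N -> (0 < b)%N -> coprime a b -> periodic a f -> periodic b g ->
  \sum_(n < a * b) f n * g n = (\sum_(n < a) f n) * (\sum_(n < b) g n).
Proof.
move=> a0 b0 cab hf hg.
pose h (n : 'I_(a * b)) : 'I_a * 'I_b := (Ordinal (ltn_pmod n a0), Ordinal (ltn_pmod n b0)).
have hb : bijective h.
  apply: inj_card_bij; last by rewrite card_prod !card_ord.
  move=> n m [e1 e2]; apply: val_inj => /=.
  have : n == m %[mod a * b] by rewrite chinese_remainder // e1 e2 !eqxx.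
  by rewrite !modn_small // => /eqP.
rewrite big_distrlr pair_big /= (reindex h) /=; last exact: onW_bij.
by apply: eq_bigr => n _; rewrite !periodic_mod.
Qed.

Lemma sum_ltD M N f : \sum_(n < M + N) f n = \sum_(n < M) f n + \sum_(n < N) f (n + M)%N.
Proof. by rewrite big_split_ord /=; congr (_ + _); apply: eq_bigr => i _; rewrite addnC. Qed.

Lemma sum_periodic_small M N f (B : R) : (0 < M)%N -> periodic M f -> \sum_(n < M) f n = 0 ->
  (forall n, `|f n| <= B) -> `|\sum_(n < N) f n| <= M%:R * B.
Proof.
move=> M0 hf s0 hB.
have B0 : 0 <= B by apply: le_trans (hB 0%N).
elim/ltn_ind: N => N IH. case: (ltnP N M) => NM.
  apply: le_trans (ler_norm_sum _ _ _) _. apply: le_trans (_ : \sum_(n < N) B <= _); first by apply: ler_sum.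
  by rewrite sumr_const card_ord -[_ *+ N]mulr_natl; apply: ler_wpM2r => //; rewrite ler_nat ltnW.
rewrite -(subnKC NM) sum_ltD s0 add0r (eq_bigr (fun n : 'I_(N - M) => f n)) => [|n _]; last exact: hf.
by apply: IH; lia.
Qed.

(** The first N terms fit into at most N / M + 1 full periods, and f >= 0 allows the last one to be
    completed. *)
Lemma sum_periodic_ge0 M N f (v : R) : (0 < M)%N -> periodic M f -> \sum_(n < M) f n = M%:R * v -> 0 <= v ->
  (forall n, 0 <= f n) -> \sum_(n < N) f n <= (N + M)%:R * v.
Proof.
move=> M0 hf sv v0 f0.
elim/ltn_ind: N => N IH. case: (ltnP N M) => NM.
  apply: le_trans (_ : M%:R * v <= _); last by apply: ler_wpM2r => //; rewrite ler_nat leq_addl.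
  rewrite -sv -(subnKC (ltnW NM)) sum_ltD lerDl. exact: sumr_ge0.
have -> : \sum_(n < N) f n = \sum_(n < M + (N - M)) f n by rewrite subnKC.
rewrite sum_ltD sv (eq_bigr (fun n : 'I_(N - M) => f n)) => [|n _]; last exact: hf.
have := IH (N - M)%N ltac:(lia). rewrite subnK // natrD. lra.
Qed.
End PeriodicSums.

Section Sieve.
Variables (R : realFieldType) (h : nat).

(** For these p the residues 0 and - h are distinct and p > 2, so exactly two of at least three
    classes are sieved out. *)
Definition good p := prime p && ~~ (p %| 2 * h)%N.

(* Orthogonal to constants modulo p, and equal to 1 whenever p divides neither n nor n + h. *)
Definition psi p n : R := if (p %| n)%N || (p %| n + h)%N then - ((p%:R - 2) / 2) else 1.

Definition psis (s : seq nat) n : R := \prod_(p <- s) psi p n.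
(** The mean square of [psis s] over a period: one prime contributes (p - 2 + 2 ((p - 2) / 2)^2) / p
    = (p - 2) / 2. *)
Definition psi_mean_sq (s : seq nat) : R := \prod_(p <- s) ((p%:R - 2) / 2).

Lemma good_gt2 p : good p -> (2 < p)%N.
Proof.
case/andP => pp; rewrite ltn_neqAle prime_gt1 // andbT => hp.
by apply/eqP => e; move: hp; rewrite -e dvdn_mulr.
Qed.

Lemma psi_periodic p : periodic p (psi p).
Proof. by move=> n; rewrite /psi addnAC !(@dvdn_addl p). Qed.

(** The exceptional value is taken at exactly two residues. A general F yields the mean (F the
    identity) and the mean square from one count. *)
Lemma psi_sum (F : R -> R) p : good p ->
  \sum_(n < p) F (psi p n) = p%:R * F 1 + 2 * (F (- ((p%:R - 2) / 2)) - F 1).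
Proof.
move=> gp. have p2 := good_gt2 gp. have p0 : (0 < p)%N by lia.
case/andP: gp => pp pdh.
have ph : ~~ (p %| h)%N by apply: contra pdh => ?; apply: dvdn_mull.
pose j := (p - h %% p)%N.
have hm : (0 < h %% p < p)%N by rewrite ltn_pmod // andbT lt0n.
have jp : (j < p)%N by rewrite /j; lia.
have j0 : j != 0%N by rewrite /j; lia.
have psiE (n : 'I_p) : F (psi p n) = F 1 + ((n == 0 :> nat)%:R + (n == j :> nat)%:R) * (F (- ((p%:R - 2) / 2)) - F 1).
  have e1 : (p %| n)%N = (n == 0 :> nat).
    by rewrite /dvdn modn_small.
  have e2 : (p %| n + h)%N = (n == j :> nat).
    rewrite -(dvdn_addr _ (dvdn_mull (h %/ p) (dvdnn p))) .
    have -> : (h %/ p * p + (n + h) = n + h %% p + 2 * (h %/ p * p))%N by rewrite {2}(divn_eq h p); lia.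
    rewrite dvdn_addl ?dvdn_mull //. apply/idP/eqP => [/dvdnP [k hk]|->].
      have nl := ltn_ord n. have k1 : k = 1%N by case: k hk => [|[|k]] hk //; nia.
      by rewrite /j; lia.
    by rewrite /j subnK ?dvdnn //; lia.
  rewrite /psi e1 e2. case: eqP => h1; case: eqP => h2 /=; try ring.
  by move: j0; rewrite -h2 h1.
rewrite (eq_bigr _ (fun n _ => psiE n)) big_split /= sumr_const card_ord -[_ *+ p]mulr_natl -mulr_suml big_split /=.
have one_pt (k : nat) : (k < p)%N -> \sum_(n < p) (n == k :> nat)%:R = 1 :> R.
  move=> kp. rewrite (bigD1 (Ordinal kp)) //= eqxx big1 ?addr0 // => n hn.
  by case: eqP => // e; case/eqP: hn; apply: val_inj.
by rewrite !one_pt.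
Qed.

Lemma psis_periodic s : periodic (\prod_(p <- s) p) (psis s).
Proof.
elim: s => [|p s IH] n; first by rewrite /psis !big_nil.
rewrite /psis !big_cons -!/(psis s _) (periodic_mulr _ (@psi_periodic p)).
by congr (_ * _); apply: periodic_mull.
Qed.

Lemma coprime_prod p s : all prime (p :: s) -> p \notin s -> coprime p (\prod_(q <- s) q).
Proof.
move=> /= /andP [pp]; elim: s => [|q s IH]; first by rewrite big_nil coprimen1.
move=> /= /andP [qp sp]; rewrite inE negb_or => /andP [pq ps].
rewrite big_cons coprimeMr IH // andbT prime_coprime // dvdn_prime2 //.
Qed.

Lemma all_good_prime s : all good s -> all prime s.
Proof. by apply: sub_all => p /andP []. Qed.

Lemma prod_pos s : all good s -> (0 < \prod_(p <- s) p)%N.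
Proof. by move=> /all_good_prime/allP hs; rewrite big_seq prodn_cond_gt0 // => p ps; rewrite prime_gt0 ?hs. Qed.

Lemma psis_sq_sum s : uniq s -> all good s ->
  \sum_(n < \prod_(p <- s) p) psis s n ^+ 2 = (\prod_(p <- s) p)%N%:R * psi_mean_sq s.
Proof.
elim: s => [|p s IH] /=; first by rewrite /psis /psi_mean_sq !big_nil big_ord1 big_nil expr1n mulr1.
move=> /andP [ps us] /andP [gp gs].
have pp : prime p by case/andP: gp.
rewrite /psi_mean_sq !big_cons -/(psi_mean_sq s).
rewrite (eq_bigr (fun n : 'I__ => psi p n ^+ 2 * psis s n ^+ 2)) => [|n _]; last by rewrite /psis big_cons exprMn.
rewrite (@sum_crt _ _ _ (fun n => psi p n ^+ 2) (fun n => psis s n ^+ 2)); first last.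
- by move=> n; rewrite psis_periodic.
- by move=> n; rewrite psi_periodic.
- by apply: coprime_prod => //=; rewrite pp all_good_prime.
- exact: prod_pos.
- exact: prime_gt0.
rewrite IH // (psi_sum (fun x => x ^+ 2) gp) natrM. by field.
Qed.

Lemma psis_rem p s n : p \in s -> psis s n = psi p n * psis (rem p s) n.
Proof. by move=> ps; rewrite /psis (perm_big _ (perm_to_rem ps)) big_cons. Qed.

Lemma psis_cat s t n : psis (s ++ t) n = psis s n * psis t n.
Proof. by rewrite /psis big_cat. Qed.

(** The other factors have a period prime to p, so by the Chinese remainder theorem the sum splits
    off the mean of [psi p], which is 0. *)
Lemma psis_orth p s t : uniq s -> all good s -> all good t -> p \in s -> p \notin t ->
  \sum_(n < (\prod_(p <- s) p) * (\prod_(p <- t) p)) psis s n * psis t n = 0.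
Proof.
move=> us gs gt ps pt.
have gp : good p by apply: (allP gs).
have pp : prime p by case/andP: gp.
have gr : all good (rem p s) by apply/allP => q /mem_rem/(allP gs).
rewrite (perm_big _ (perm_to_rem ps)) big_cons /= -mulnA -big_cat /=.
rewrite (eq_bigr (fun n : 'I__ => psi p n * psis (rem p s ++ t) n)) => [|n _]; last first.
  by rewrite (psis_rem _ ps) -mulrA psis_cat.
rewrite sum_crt.
- have -> : \sum_(n < p) psi p n = 0 by rewrite (psi_sum id gp) /=; field.
  by rewrite mul0r.
- exact: prime_gt0.
- by apply: prod_pos; rewrite all_cat gr.
- apply: coprime_prod; first by rewrite /= pp all_cat !all_good_prime.
  by rewrite mem_cat negb_or pt andbT mem_rem_uniqF.
- exact: psi_periodic.
- exact: psis_periodic.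
Qed.

Lemma psi_le p n : good p -> `|psi p n| <= p%:R.
Proof.
move=> /good_gt2 p2. have hp : (2 : R) < p%:R by rewrite ltr_nat.
rewrite /psi; case: ifP => _; last by rewrite normr1; lra.
by rewrite normrN ger0_norm; lra.
Qed.

Lemma psis_le s n : all good s -> `|psis s n| <= (\prod_(p <- s) p)%N%:R.
Proof.
elim: s => [|p s IH] /=; first by rewrite /psis !big_nil normr1.
move=> /andP [gp gs]. rewrite /psis !big_cons normrM natrM. by apply: ler_pM => //; [exact: psi_le|exact: IH].
Qed.

Lemma psi_mean_sq_ge0 s : all good s -> 0 <= psi_mean_sq s.
Proof.
move=> /allP hs; rewrite /psi_mean_sq big_seq; apply: prodr_ge0 => p /hs /good_gt2 p2.
have hp : (2 : R) < p%:R by rewrite ltr_nat. lra.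
Qed.
End Sieve.

(** * Square-free moduli and the sieve inequality *)

Definition sqf l := (0 < l)%N && (\prod_(p <- primes l) p == l)%N.
Definition sifting h l := sqf l && coprime l (2 * h).
Definition prime_pairs h N := (\sum_(n < N | prime n && prime (n + h)) 1)%N.

Lemma sifting_gt0 h l : sifting h l -> (0 < l)%N.
Proof. by case/andP => /andP []. Qed.

Lemma sifting_prod h l : sifting h l -> (\prod_(p <- primes l) p = l)%N.
Proof. by case/andP => /andP [_ /eqP]. Qed.

Lemma sifting_good h l : sifting h l -> all (good h) (primes l).
Proof.
case/andP => _ cl; apply/allP => p; rewrite mem_primes => /and3P [pp _ pl].
by rewrite /good pp -prime_coprime // (coprime_dvdl pl cl).
Qed.

Lemma sifting_ext h l m : sifting h l -> sifting h m -> primes l =i primes m -> l = m.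
Proof.
move=> ql qm e; rewrite -(sifting_prod ql) -(sifting_prod qm).
by apply: perm_big; apply: uniq_perm; rewrite ?primes_uniq.
Qed.

Lemma divisors_mul_prime p m : prime p -> (0 < m)%N ->
  {subset divisors (p * m) <= divisors m ++ map (muln p) (divisors m)}.
Proof.
move=> pp m0 d; have p0 := prime_gt0 pp. have pm0 : (0 < p * m)%N by rewrite muln_gt0 p0.
rewrite mem_cat -!dvdn_divisors // => dpm. case: (boolP (p %| d)%N) => pd; last first.
  by rewrite -(Gauss_dvdr m (_ : coprime d p)) ?dpm // coprime_sym prime_coprime.
apply/orP; right. move/dvdnP: pd => [k dk]. apply/mapP; exists k; last by rewrite dk mulnC.
by rewrite -dvdn_divisors // -(dvdn_pmul2l p0) mulnC -dk.
Qed.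

Lemma size_divisors_mul p m : prime p -> (0 < m)%N -> (size (divisors (p * m)) <= 2 * size (divisors m))%N.
Proof.
move=> pp m0. rewrite mul2n -addnn -[X in (_ <= _ + X)%N](size_map (muln p)) -size_cat.
by apply: uniq_leq_size; [exact: divisors_uniq|exact: divisors_mul_prime].
Qed.

Lemma size_divisors_le l : (0 < l)%N -> (size (divisors l) <= l)%N.
Proof.
move=> l0. rewrite -{2}(size_iota 1 l). apply: uniq_leq_size; first exact: divisors_uniq.
by move=> d; rewrite -dvdn_divisors // mem_iota add1n ltnS => dl; rewrite (dvdn_leq l0 dl) andbT (dvdn_gt0 l0 dl).
Qed.

Section Sieve.
Variables (R : realFieldType) (h : nat).
Local Notation psis := (psis R h).

(** The weight minimizing the diagonal form is 1 / [psi_mean_sq], a product of 2 / (p - 2). For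
    square-free l, tau(l) / l is the product of 2 / p, slightly smaller, and its sum can be bounded
    below through counting divisors. *)
Definition wgt l : R := (size (divisors l))%:R / l%:R.
Definition mass z : R := \sum_(l < z.+1 | sifting h l) wgt l.

Lemma divisors_psi_mean_sq s : uniq s -> all (good h) s ->
  (size (divisors (\prod_(p <- s) p)))%:R * psi_mean_sq R s <= (\prod_(p <- s) p)%N%:R.
Proof.
elim: s => [|p s IH] /=; first by rewrite /psi_mean_sq !big_nil /= mulr1.
move=> /andP [ps us] /andP [gp gs]. have pp : prime p by case/andP: gp.
have p2 : (2 : R) < p%:R by rewrite ltr_nat (good_gt2 gp).
rewrite /psi_mean_sq !big_cons -/(psi_mean_sq R s) natrM.
have h1 := size_divisors_mul pp (prod_pos gs). have v0 := psi_mean_sq_ge0 R gs.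
have {}h1 : (size (divisors (p * \prod_(q <- s) q)))%:R <= 2 * (size (divisors (\prod_(q <- s) q)))%:R :> R.
  by rewrite -natrM ler_nat.
have h2 := IH us gs.
set A := (size _)%:R in h1 *. set B := (size _)%:R in h1 h2. set P := (_%:R : R) in h2 *.
have h3 : A * ((p%:R - 2) / 2 * psi_mean_sq R s) <= 2 * B * ((p%:R - 2) / 2 * psi_mean_sq R s).
  by apply: ler_wpM2r => //; apply: mulr_ge0 => //; lra.
have P0 : 0 <= P by [].
have h4 : (p%:R - 2) * (B * psi_mean_sq R s) <= (p%:R - 2) * P by apply: ler_wpM2l => //; lra.
nra.
Qed.

Lemma wgt_ge0 l : 0 <= wgt l.
Proof. exact: divr_ge0. Qed.

Lemma wgt_psi_mean_sq l : sifting h l -> wgt l * psi_mean_sq R (primes l) <= 1.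
Proof.
move=> ql. have := divisors_psi_mean_sq (primes_uniq l) (sifting_good ql). rewrite (sifting_prod ql).
by rewrite /wgt mulrAC ler_pdivrMr ?mul1r // ltr0n (sifting_gt0 ql).
Qed.

Lemma psis_sifting_periodic l : sifting h l -> periodic l (psis (primes l)).
Proof. by move=> ql; have := @psis_periodic R h (primes l); rewrite (sifting_prod ql). Qed.

Lemma corr_diag N l : sifting h l ->
  \sum_(n < N) psis (primes l) n * psis (primes l) n <= (N + l)%:R * psi_mean_sq R (primes l).
Proof.
move=> ql. have gl := sifting_good ql.
rewrite (eq_bigr (fun n : 'I_N => psis (primes l) n ^+ 2)) => [|n _]; last by rewrite expr2.
apply: (@sum_periodic_ge0 R l N (fun n => psis (primes l) n ^+ 2)).
- exact: sifting_gt0 ql.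
- by move=> n; rewrite psis_sifting_periodic.
- by have := psis_sq_sum R (primes_uniq l) gl; rewrite (sifting_prod ql).
- exact: psi_mean_sq_ge0 gl.
- by move=> n; rewrite sqr_ge0.
Qed.

(** Distinct square-free moduli differ in a prime, so the sum over a period l m vanishes; fewer than
    l m terms remain, each at most l m in absolute value. *)
Lemma corr_off N l m : sifting h l -> sifting h m -> l != m ->
  `|\sum_(n < N) psis (primes l) n * psis (primes m) n| <= (l * m)%:R * (l * m)%:R.
Proof.
move=> ql qm lm. have gl := sifting_good ql. have gm := sifting_good qm.
apply: (@sum_periodic_small R (l * m) N (fun n => psis (primes l) n * psis (primes m) n)).
- by rewrite muln_gt0 (sifting_gt0 ql) (sifting_gt0 qm).
- apply: periodicM.
  + by apply: periodic_mulr; apply: psis_sifting_periodic.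
  + by apply: periodic_mull; apply: psis_sifting_periodic.
- case: (boolP (all (mem (primes m)) (primes l))) => [al|/allPn [p pl pm]]; last first.
    by have := psis_orth R (primes_uniq l) gl gm pl pm; rewrite (sifting_prod ql) (sifting_prod qm).
  case: (boolP (all (mem (primes l)) (primes m))) => [am|/allPn [p pm pl]]; last first.
    have := psis_orth R (primes_uniq m) gm gl pm pl; rewrite (sifting_prod ql) (sifting_prod qm) mulnC => e; rewrite -[RHS]e.
    by apply: eq_bigr => n _; rewrite mulrC.
  case/eqP: lm. apply: sifting_ext ql qm _ => p. apply/idP/idP; [exact: (allP al)|exact: (allP am)].
- move=> n. rewrite normrM natrM. apply: ler_pM => //.
  + by have := psis_le R n gl; rewrite (sifting_prod ql).
  + by have := psis_le R n gm; rewrite (sifting_prod qm).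
Qed.

Lemma psis_eq1 z l n : (z < n)%N -> prime n -> prime (n + h) -> (l < z.+1)%N -> sifting h l -> psis (primes l) n = 1.
Proof.
move=> zn pn pnh lz ql. rewrite /psis big_seq big1 // => p.
rewrite mem_primes => /and3P [pp l0 pl].
have pz : (p <= z)%N by apply: leq_trans (dvdn_leq l0 pl) _; rewrite -ltnS.
rewrite /psi. by rewrite !dvdn_prime2 // !ltn_eqF //; lia.
Qed.

Lemma sum_const_lt_le (c : R) N K : 0 <= c -> \sum_(n < N | (n < K)%N) c <= \sum_(n < K) c.
Proof.
move=> c0. suff -> : \sum_(n < N | (n < K)%N) c = c *+ minn N K.
  by rewrite sumr_const card_ord -[leLHS]mulr_natl -[leRHS]mulr_natl; apply: ler_wpM2r; rewrite ?ler_nat ?geq_minr.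
rewrite big_mkcond; elim: N => [|N IH]; first by rewrite big_ord0 min0n.
rewrite big_ord_recr /= IH. case: ltnP => NK.
  by rewrite !(minn_idPl _) ?mulrSr //; lia.
by rewrite !(minn_idPr _) ?addr0 //; lia.
Qed.

(* The weighted sum F of the psis equals mass z at every n > z with n and n + h prime, and
   its second moment is computed by orthogonality. *)
Lemma selberg_sieve z N : (0 < z)%N ->
  (prime_pairs h N)%:R <= z.+1%:R + (N + z)%:R / mass z + z.+1%:R ^+ 6.
Proof.
move=> z0. set G := mass z.
have G1 : 1 <= G.
  have z1 : (1 < z.+1)%N by rewrite ltnS.
  rewrite /G /mass (bigD1 (Ordinal z1)) /=; last by rewrite /sifting /sqf coprime1n /= big_nil eqxx.
  rewrite {1}/wgt /= divr1 lerDl. by apply: sumr_ge0 => l _; exact: wgt_ge0.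
have G0 : 0 < G by lra.
pose F n := \sum_(l < z.+1 | sifting h l) wgt l * psis (primes l) n.
have h1 : (prime_pairs h N)%:R * G ^+ 2 <= z.+1%:R * G ^+ 2 + \sum_(n < N) F n ^+ 2.
  have -> : z.+1%:R * G ^+ 2 = \sum_(n < z.+1) G ^+ 2 by rewrite sumr_const card_ord mulr_natl.
  rewrite /prime_pairs natr_sum mulr_suml.
  have -> : \sum_(n < N | prime n && prime (n + h)) 1 * G ^+ 2 =
     \sum_(n < N | (prime n && prime (n + h)) && (n < z.+1)%N) G ^+ 2 +
     \sum_(n < N | (prime n && prime (n + h)) && ~~ (n < z.+1)%N) G ^+ 2.
    by rewrite (bigID (fun n : 'I_N => (n < z.+1)%N)) /=; congr (_ + _); apply: eq_bigr => n _; rewrite mul1r.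
  apply: lerD.
    apply: le_trans (_ : \sum_(n < N | (n < z.+1)%N) G ^+ 2 <= _).
      rewrite [leRHS]big_mkcond [leLHS]big_mkcond; apply: ler_sum => n _.
      case: (n < z.+1)%N; rewrite ?andbF //; case: ifP => _ //; exact: sqr_ge0.
    by apply: sum_const_lt_le; exact: sqr_ge0.
  rewrite big_mkcond. apply: ler_sum => n _. case: ifP => [/andP [/andP [pn pnh] nz]|_]; last exact: sqr_ge0.
  rewrite (_ : F n = G) // /F /G /mass. apply: eq_bigr => l ql.
  by rewrite (@psis_eq1 z) ?mulr1 // ltnNge -ltnS.
(* On the diagonal one factor [wgt l] cancels against [psi_mean_sq], and the other sums to G. Each
   of the at most (z + 1)^2 off-diagonal terms is at most (z + 1)^4. *)
have h2 : \sum_(n < N) F n ^+ 2 <= G * (N + z)%:R + z.+1%:R ^+ 6.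
  have -> : \sum_(n < N) F n ^+ 2 = \sum_(l < z.+1 | sifting h l) \sum_(m < z.+1 | sifting h m)
      wgt l * wgt m * \sum_(n < N) psis (primes l) n * psis (primes m) n.
    rewrite (eq_bigr (fun n : 'I_N => \sum_(l < z.+1 | sifting h l) \sum_(m < z.+1 | sifting h m)
      wgt l * wgt m * (psis (primes l) n * psis (primes m) n))) => [|n _].
      rewrite exchange_big; apply: eq_bigr => l _; rewrite exchange_big; apply: eq_bigr => m _.
      by rewrite mulr_sumr.
    rewrite expr2 /F big_distrlr /=. apply: eq_bigr => l _; apply: eq_bigr => m _. ring.
  apply: le_trans (_ : \sum_(l < z.+1 | sifting h l) (wgt l * (N + z)%:R + \sum_(m < z.+1) z.+1%:R ^+ 4) <= _).
    apply: ler_sum => l ql. rewrite (bigD1 l) //=. apply: lerD.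
      rewrite -mulrA. apply: ler_wpM2l; first exact: wgt_ge0.
      apply: le_trans (_ : wgt l * ((N + l)%:R * psi_mean_sq R (primes l)) <= _).
        by apply: ler_wpM2l; [exact: wgt_ge0|exact: corr_diag].
      rewrite mulrCA -[leRHS]mulr1. apply: ler_pM => //.
      - by apply: mulr_ge0; [exact: wgt_ge0|exact: psi_mean_sq_ge0 (sifting_good ql)].
      - by rewrite ler_nat leq_add2l -ltnS.
      - exact: wgt_psi_mean_sq.
    rewrite big_mkcond. apply: ler_sum => m _. case: ifP => [/andP [qm ml]|_]; last exact: exprn_ge0.
    have := corr_off N ql qm; rewrite eq_sym => /(_ ml) h3.
    apply: le_trans (_ : wgt l * wgt m * ((l * m)%:R * (l * m)%:R) <= _).
      apply: ler_wpM2l; first by apply: mulr_ge0; exact: wgt_ge0.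
      exact: le_trans (ler_norm _) h3.
    have wl k : (k < z.+1)%N -> sifting h k -> wgt k * (k%:R * k%:R) <= z.+1%:R ^+ 2.
      move=> kz qk. have k0 : (k%:R : R) != 0 by rewrite pnatr_eq0 -lt0n (sifting_gt0 qk).
      rewrite /wgt mulrA divfK // expr2. apply: ler_pM => //; rewrite ler_nat.
        by apply: leq_trans (size_divisors_le (sifting_gt0 qk)) _; apply: ltnW.
      exact: ltnW.
    have -> : wgt l * wgt m * ((l * m)%:R * (l * m)%:R) = (wgt l * (l%:R * l%:R)) * (wgt m * (m%:R * m%:R)).
      by rewrite natrM; ring.
    rewrite (_ : 4 = 2 + 2)%N // exprD.
    have w0 k : 0 <= wgt k * (k%:R * k%:R) by apply: mulr_ge0; [exact: wgt_ge0|exact: mulr_ge0].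
    by apply: ler_pM => //; apply: wl.
  rewrite big_split /= -mulr_suml. apply: lerD => //.
  apply: le_trans (_ : \sum_(l < z.+1) \sum_(m < z.+1) z.+1%:R ^+ 4 <= _).
    rewrite big_mkcond. apply: ler_sum => l _. case: ifP => _ //. by apply: sumr_ge0 => m _; exact: exprn_ge0.
  rewrite !sumr_const !card_ord -!mulrnA -[_ *+ (_ * _)]mulr_natl natrM. rewrite le_eqVlt; apply/orP; left; apply/eqP. ring.
have h3 : (prime_pairs h N)%:R <= z.+1%:R + (G * (N + z)%:R + z.+1%:R ^+ 6) / G ^+ 2.
  rewrite -lerBlDl ler_pdivlMr ?exprn_gt0 // mulrBl. lra.
apply: le_trans h3 _. rewrite -addrA lerD2l mulrDl. apply: lerD.
  by have -> : G * (N + z)%:R / G ^+ 2 = (N + z)%:R / G by field; lra.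
rewrite ler_pdivrMr ?exprn_gt0 // -[leLHS]mulr1. apply: ler_wpM2l; first exact: exprn_ge0.
exact: exprn_ege1.
Qed.
End Sieve.

Lemma logn_prod_primes q s : prime q -> all prime s -> uniq s -> logn q (\prod_(p <- s) p) = (q \in s).
Proof.
move=> qp; elim: s => [|p s IH] /=; first by rewrite big_nil logn1.
move=> /andP [pp sp] /andP [ps us].
have s0 : (0 < \prod_(p <- s) p)%N.
  by rewrite big_seq prodn_cond_gt0 // => r rs; rewrite prime_gt0 // (allP sp).
rewrite big_cons lognM //; last exact: prime_gt0.
rewrite IH // logn_prime // inE.
case: eqP => [e|_] //=. by rewrite e (negbTE ps).
Qed.

Lemma sqfP l : reflect ((0 < l)%N /\ forall p, prime p -> (logn p l <= 1)%N) (sqf l).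
Proof.
apply: (iffP andP) => [[l0 /eqP e]|[l0 hl]].
  split=> // p pp. have h := logn_prod_primes pp (s := primes l).
  rewrite -e h ?primes_uniq ?leq_b1 //. by apply/allP => q; rewrite mem_primes => /andP [].
split=> //. apply/eqP. rewrite {2}(prod_prime_decomp l0) prime_decompE big_map /=.
rewrite [LHS]big_seq [RHS]big_seq. apply: eq_bigr => p pl.
have pp : prime p by move: pl; rewrite mem_primes => /andP [].
have := hl p pp; move: pl; rewrite -logn_gt0. by case: (logn p l) => [|[|]].
Qed.

Lemma sqf_dvd l d : (d %| l)%N -> sqf l -> sqf d.
Proof.
move=> dl /sqfP [l0 hl]; apply/sqfP; split; first exact: dvdn_gt0 dl.
by move=> p pp; apply: leq_trans (hl p pp); apply: dvdn_leq_log.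
Qed.

Lemma sqf_mul a b : coprime a b -> sqf a -> sqf b -> sqf (a * b).
Proof.
move=> cab /sqfP [a0 ha] /sqfP [b0 hb]; apply/sqfP; split; first by rewrite muln_gt0 a0.
move=> p pp; rewrite lognM //. have := ha p pp. have := hb p pp.
case: (posnP (logn p a)) => [->|pa]; first by rewrite add0n.
case: (posnP (logn p b)) => [->|pb]; first by rewrite addn0.
exfalso. rewrite !logn_gt0 !mem_primes !pp a0 b0 /= in pa pb.
have : (p %| gcdn a b)%N by rewrite dvdn_gcd pa. by rewrite (eqP cab) Euclid_dvd1.
Qed.

Lemma sifting_dvd h l d : (d %| l)%N -> sifting h l -> sifting h d.
Proof. by move=> dl /andP [sl cl]; rewrite /sifting (sqf_dvd dl sl) (coprime_dvdl dl cl). Qed.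

Lemma sifting_mul h a b : coprime a b -> sifting h a -> sifting h b -> sifting h (a * b).
Proof. by move=> cab /andP [sa ca] /andP [sb cb]; rewrite /sifting sqf_mul // coprimeMl ca. Qed.

Lemma sqf_decomp m : (0 < m)%N -> exists c s, m = (c ^ 2 * s)%N /\ sqf s.
Proof.
elim/ltn_ind: m => m IH m0.
case: (boolP (sqf m)) => [sm|sm]; first by exists 1%N, m; rewrite mul1n.
have [p [pp pm]] : exists p, prime p /\ (p ^ 2 %| m)%N.
  move: sm; rewrite /sqf m0 /= => sm.
  have : ~~ all (fun p => logn p m <= 1)%N (primes m).
    apply: contra sm => /allP h. suff : sqf m by case/andP.
    apply/sqfP; split=> // p pp. case: (posnP (logn p m)) => [-> //|]. by rewrite logn_gt0 => /h.
  case/allPn => p pm; rewrite -ltnNge => hp. exists p.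
  have pp : prime p by move: pm; rewrite mem_primes => /andP [].
  by split; last by rewrite pfactor_dvdn.
case/dvdnP: pm => k mk.
have k0 : (0 < k)%N by move: m0; rewrite mk muln_gt0 => /andP [].
have km : (k < m)%N by rewrite mk ltn_Pmulr // (ltn_exp2l 0) ?prime_gt1.
have [c [s [ks ss]]] := IH k km k0. exists (p * c)%N, s; split=> //.
by rewrite mk ks expnMn; lia.
Qed.

(** Take s1 as the gcd of the square-free part s with 2 h. A prime common to s2 = s / s1 and 2 h
    would also divide s1, and its square would divide s. *)
Lemma sifting_decomp h m : (0 < h)%N -> (0 < m)%N ->
  exists c s1 s2, [/\ m = (c ^ 2 * s1 * s2)%N, (s1 %| 2 * h)%N & sifting h s2].
Proof.
move=> h0 m0. have [c [s [ms ss]]] := sqf_decomp m0.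
pose s1 := gcdn s (2 * h). have s1s : (s1 %| s)%N by exact: dvdn_gcdl.
have s1d : (s1 %| 2 * h)%N by exact: dvdn_gcdr.
have [s0 hs] := sqfP _ ss.
case/dvdnP: (s1s) => s2 e. exists c, s1, s2. split=> //; first by rewrite ms e; lia.
have s2s : (s2 %| s)%N by rewrite e dvdn_mulr.
rewrite /sifting (sqf_dvd s2s ss) /=. apply: contraT => nc.
have g1 : (1 < gcdn s2 (2 * h))%N.
  by rewrite ltn_neqAle eq_sym nc gcdn_gt0 muln_gt0 h0 orbT.
have pp := pdiv_prime g1. have pg := pdiv_dvd (gcdn s2 (2 * h)). set p := pdiv _ in pp pg.
have p2 : (p %| s2)%N by exact: dvdn_trans pg (dvdn_gcdl _ _).
have p1 : (p %| s1)%N by rewrite dvdn_gcd (dvdn_trans p2 s2s) (dvdn_trans pg (dvdn_gcdr _ _)).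
have : (p ^ 2 %| s)%N by rewrite e (dvdn_mul p2 p1).
by rewrite pfactor_dvdn // ltnNge hs.
Qed.

(** * Lower bound for the sieve mass; average over the shift *)

Section Sums.
Variable R : realFieldType.

(** The map f sends j back to the index it pays for, so different i are paid for by different j.
    Thus an injection from i to j is given through its left inverse, and each use only has to
    exhibit j. *)
Lemma sum_le_cover (I J : finType) (P : pred I) (Q : pred J) (F : I -> R) (G : J -> R) (f : J -> I) :
  (forall j, Q j -> 0 <= G j) ->
  (forall i, P i -> exists j, [/\ Q j, f j = i & F i <= G j]) ->
  \sum_(i | P i) F i <= \sum_(j | Q j) G j.
Proof.
move=> G0 H.
apply: le_trans (_ : \sum_(j | Q j && P (f j)) G j <= _); last first.
  rewrite big_mkcond [leRHS]big_mkcond. apply: ler_sum => j _.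
  case hq: (Q j) => //=. case: (P (f j)) => //. exact: G0.
rewrite (partition_big f P) /=; last by move=> j /andP [].
apply: ler_sum => i Pi. have [j [Qj fj Fi]] := H i Pi.
rewrite (bigD1 j) /=; last by rewrite Qj fj Pi eqxx.
apply: le_trans Fi _. rewrite lerDl. by apply: sumr_ge0 => k /andP [/andP [/andP [Qk _] _] _]; apply: G0.
Qed.

Definition harm y : R := \sum_(m < y.+1 | (0 < m)%N) m%:R^-1.
(** A truncation of sigma(n) / n. At n = 2 h it measures what the harmonic sum loses by leaving out
    the primes dividing 2 h. *)
Definition rho y n : R := \sum_(d < y.+1 | (0 < d)%N && (d %| n)%N) d%:R^-1.
Definition sift_harm h y : R := \sum_(a < y.+1 | sifting h a) a%:R^-1.

Lemma sum_inv_sq y : \sum_(c < y.+1 | (0 < c)%N) (c%:R ^+ 2)^-1 <= 2 :> R.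
Proof.
suff h : (0 < y)%N -> \sum_(c < y.+1 | (0 < c)%N) (c%:R ^+ 2)^-1 <= 2 - y%:R^-1 :> R.
  case: (posnP y) => [->|y0]; first by rewrite big_mkcond big_ord1 /=; lra.
  apply: le_trans (h y0) _. have : 0 <= y%:R^-1 :> R by rewrite invr_ge0. lra.
elim: y => // y IH _. rewrite big_mkcond big_ord_recr -big_mkcond /=.
case: (posnP y) => [->|y0].
  by rewrite big_mkcond big_ord1 /= expr1n invr1; lra.
have := IH y0. have yp : 0 < y%:R :> R by rewrite ltr0n.
have yp1 : 0 < y.+1%:R :> R by rewrite ltr0n.
have e : y.+1%:R = y%:R + 1 :> R by rewrite natr1.
have : (y.+1%:R ^+ 2)^-1 <= y%:R^-1 - y.+1%:R^-1 :> R.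
  have -> : y%:R^-1 - y.+1%:R^-1 = (y%:R * y.+1%:R)^-1 :> R by rewrite e; field; lra.
  by rewrite lef_pV2 ?posrE ?mulr_gt0 ?exprn_gt0 // expr2 ler_pM2r // e; lra.
move=> h1 h2; apply: le_trans (lerD h2 h1) _; by rewrite addrA subrK.
Qed.

(* Every m is c^2 s1 s2 with s1 dividing 2 h and s2 square-free and coprime to 2 h. *)
Lemma harm_le_sift h y : (0 < h)%N -> harm y <= 2 * rho y (2 * h) * sift_harm h y.
Proof.
move=> h0; rewrite /harm.
apply: le_trans (_ : \sum_(t : 'I_y.+1 * ('I_y.+1 * 'I_y.+1) | (0 < t.1)%N && (((0 < t.2.1)%N && (t.2.1 %| 2 * h)%N) && sifting h t.2.2))
   (t.1%:R ^+ 2)^-1 * (t.2.1%:R^-1 * t.2.2%:R^-1) <= _).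
  apply: (@sum_le_cover _ _ _ _ _ _ (fun t : 'I_y.+1 * ('I_y.+1 * 'I_y.+1) => inord (t.1 ^ 2 * t.2.1 * t.2.2))) => [t _|m m0].
    by rewrite !mulr_ge0 ?invr_ge0 ?exprn_ge0.
  have [c [s1 [s2 [e d1 q2]]]] := sifting_decomp h0 m0.
  have my : (m <= y)%N by rewrite -ltnS.
  have s20 := sifting_gt0 q2.
  have s10 : (0 < s1)%N by apply: dvdn_gt0 d1; rewrite muln_gt0.
  have c0 : (0 < c)%N by rewrite lt0n; apply: contraTneq m0 => c0; rewrite e c0.
  have cy : (c < y.+1)%N by rewrite ltnS; apply: leq_trans my; rewrite e -!mulnA leq_pmulr // !muln_gt0 c0 s10.
  have s1y : (s1 < y.+1)%N by rewrite ltnS; apply: leq_trans my; rewrite e mulnAC leq_pmull // muln_gt0 expn_gt0 c0.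
  have s2y : (s2 < y.+1)%N by rewrite ltnS; apply: leq_trans my; rewrite e leq_pmull // muln_gt0 expn_gt0 c0.
  exists (Ordinal cy, (Ordinal s1y, Ordinal s2y)); rewrite /= c0 s10 d1 q2; split=> //.
    by rewrite -e; apply: val_inj; rewrite /= inordK.
  by rewrite e 2!natrM natrX 2!invfM mulrA.
rewrite -(pair_big (fun c : 'I_y.+1 => (0 < c)%N) (fun u : 'I_y.+1 * 'I_y.+1 => ((0 < u.1)%N && (u.1 %| 2 * h)%N) && sifting h u.2)
   (fun c u => (c%:R ^+ 2)^-1 * (u.1%:R^-1 * u.2%:R^-1))) /=.
rewrite -big_distrlr /= -(pair_big (fun d : 'I_y.+1 => (0 < d)%N && (d %| 2 * h)%N) (fun a : 'I_y.+1 => sifting h a) (fun d a => d%:R^-1 * a%:R^-1)) /=.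
rewrite -big_distrlr /= -/(rho _ _) -/(sift_harm _ _) -mulrA.
apply: ler_wpM2r; last exact: sum_inv_sq.
by apply: mulr_ge0; apply: sumr_ge0 => i _; rewrite invr_ge0.
Qed.

(* A pair (a, b) is reduced to a coprime pair by dividing out the gcd, and a coprime pair
   is a divisor a of the square-free number a b. *)
Lemma sift_harm_sq h y z : (y * y <= z)%N -> sift_harm h y ^+ 2 <= 2 * mass R h z.
Proof.
move=> yz.
pose C : R := \sum_(t : 'I_y.+1 * 'I_y.+1 | [&& sifting h t.1, sifting h t.2 & coprime t.1 t.2]) t.1%:R^-1 * t.2%:R^-1.
have h1 : sift_harm h y ^+ 2 <= 2 * C.
  rewrite expr2 /sift_harm big_distrlr pair_big /=.
  apply: le_trans (_ : \sum_(t : 'I_y.+1 * ('I_y.+1 * 'I_y.+1) | (0 < t.1)%N && [&& sifting h t.2.1, sifting h t.2.2 & coprime t.2.1 t.2.2])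
     (t.1%:R ^+ 2)^-1 * (t.2.1%:R^-1 * t.2.2%:R^-1) <= _).
    apply: (@sum_le_cover _ _ _ _ _ _ (fun t : 'I_y.+1 * ('I_y.+1 * 'I_y.+1) => (inord (t.1 * t.2.1), inord (t.1 * t.2.2)))) => [t _|[a b] /= /andP [qa qb]].
      by rewrite !mulr_ge0 ?invr_ge0 ?exprn_ge0.
    have a0 := sifting_gt0 qa. have b0 := sifting_gt0 qb.
    pose e := gcdn a b. have e0 : (0 < e)%N by rewrite gcdn_gt0 a0.
    case/dvdnP: (dvdn_gcdl a b) => a' ea. case/dvdnP: (dvdn_gcdr a b) => b' eb. rewrite -/e in ea eb.
    have ay : (a <= y)%N by rewrite -ltnS. have by_ : (b <= y)%N by rewrite -ltnS.
    have a'0 : (0 < a')%N by move: a0; rewrite ea muln_gt0 => /andP [].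
    have b'0 : (0 < b')%N by move: b0; rewrite eb muln_gt0 => /andP [].
    have ey : (e < y.+1)%N by rewrite ltnS; apply: leq_trans ay; rewrite ea leq_pmull.
    have a'y : (a' < y.+1)%N by rewrite ltnS; apply: leq_trans ay; rewrite ea leq_pmulr.
    have b'y : (b' < y.+1)%N by rewrite ltnS; apply: leq_trans by_; rewrite eb leq_pmulr.
    exists (Ordinal ey, (Ordinal a'y, Ordinal b'y)); split=> /=.
    - rewrite e0 (sifting_dvd _ qa) ?(sifting_dvd _ qb) /=; [|by rewrite eb dvdn_mulr|by rewrite ea dvdn_mulr].
      have : gcdn (a' * e) (b' * e) = e by rewrite -ea -eb.
      by rewrite -muln_gcdl => /eqP; rewrite -{2}(mul1n e) eqn_pmul2r.
    - by congr (_, _); apply: val_inj; rewrite /= inordK mulnC -?ea -?eb.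
    - move: (e) ea eb e0 => g ea eb g0. rewrite ea eb !natrM {ea eb}.
      have gp : 0 < g%:R :> R by rewrite ltr0n. have ap : 0 < a'%:R :> R by rewrite ltr0n. have bp : 0 < b'%:R :> R by rewrite ltr0n.
      by rewrite le_eqVlt; apply/orP; left; apply/eqP; field; lra.
  rewrite -(pair_big (fun c : 'I_y.+1 => (0 < c)%N) (fun u : 'I_y.+1 * 'I_y.+1 => [&& sifting h u.1, sifting h u.2 & coprime u.1 u.2])
    (fun c u => (c%:R ^+ 2)^-1 * (u.1%:R^-1 * u.2%:R^-1))) /=.
  rewrite -big_distrlr /= -/C. apply: ler_wpM2r; last exact: sum_inv_sq.
  by apply: sumr_ge0 => t _; rewrite mulr_ge0 ?invr_ge0.
apply: le_trans h1 _. apply: ler_wpM2l => //. rewrite /C /mass.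
apply: le_trans (_ : \sum_(t : 'I_z.+1 * 'I_y.+1 | sifting h t.1 && (t.2 %| t.1)%N) t.1%:R^-1 <= _).
  apply: (@sum_le_cover _ _ _ _ _ _ (fun t : 'I_z.+1 * 'I_y.+1 => (t.2, inord (t.1 %/ t.2)))) => [t _|[a b] /= /and3P [qa qb cab]].
    by rewrite invr_ge0.
  have ay : (a <= y)%N by rewrite -ltnS. have by_ : (b <= y)%N by rewrite -ltnS.
  have abz : (a * b < z.+1)%N by rewrite ltnS; apply: leq_trans yz; apply: leq_mul.
  exists (Ordinal abz, a) => /=; split.
  - by rewrite sifting_mul // dvdn_mulr.
  - by congr (_, _); apply: val_inj; rewrite /= inordK mulKn ?(sifting_gt0 qa).
  - by rewrite natrM invfM.
rewrite -(pair_big_dep (fun l : 'I_z.+1 => sifting h l) (fun (l : 'I_z.+1) (a : 'I_y.+1) => (a %| l)%N) (fun l a => l%:R^-1)) /=.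
apply: ler_sum => l ql. have l0 := sifting_gt0 ql. rewrite sumr_const -[leLHS]mulr_natl /wgt.
apply: ler_wpM2r; first by rewrite invr_ge0.
rewrite ler_nat cardE -(size_map val). apply: uniq_leq_size; first by rewrite map_inj_uniq ?enum_uniq //; exact: val_inj.
by move=> d /mapP [a]; rewrite mem_enum => ha ->; rewrite -dvdn_divisors.
Qed.

Lemma count_multiples L K : (0 < L)%N -> (\sum_(k < K.+1 | (0 < k)%N && (L %| k)%N) 1)%:R * L%:R <= K%:R :> R.
Proof.
move=> L0. rewrite -natrM ler_nat.
suff -> : (\sum_(k < K.+1 | (0 < k)%N && (L %| k)%N) 1 = K %/ L)%N by exact: leq_trunc_div.
elim: K => [|K IH]; first by rewrite big_mkcond big_ord1 div0n.
rewrite big_mkcond big_ord_recr -big_mkcond /= IH divnS //. by case: (L %| K.+1)%N; rewrite ?addn0 ?addn1.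
Qed.

(** Expand the square over pairs of divisors a, b of 2 h: the number of such h up to H is at most 2
    H / lcm(a, b) = 2 H gcd(a, b) / (a b). With g = gcd(a, b), a = g a' and b = g b', the sum of
    gcd(a, b) / (a b)^2 is at most that of g^(-3) a'^(-2) b'^(-2), hence at most 2^3. *)
Lemma rho_sq_avg y H : \sum_(h < H.+1 | (0 < h)%N) rho y (2 * h) ^+ 2 <= 16 * H%:R.
Proof.
pose S : R := \sum_(t : 'I_y.+1 * 'I_y.+1 | (0 < t.1)%N && (0 < t.2)%N) (gcdn t.1 t.2)%:R * ((t.1%:R ^+ 2)^-1 * (t.2%:R ^+ 2)^-1).
have hS : S <= 8.
  rewrite /S.
  apply: le_trans (_ : \sum_(t : 'I_y.+1 * ('I_y.+1 * 'I_y.+1) | (0 < t.1)%N && ((0 < t.2.1)%N && (0 < t.2.2)%N))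
     (t.1%:R ^+ 2)^-1 * ((t.2.1%:R ^+ 2)^-1 * (t.2.2%:R ^+ 2)^-1) <= _).
    apply: (@sum_le_cover _ _ _ _ _ _ (fun t : 'I_y.+1 * ('I_y.+1 * 'I_y.+1) => (inord (t.1 * t.2.1), inord (t.1 * t.2.2)))) => [t _|[a b] /= /andP [a0 b0]].
      by rewrite !mulr_ge0 ?invr_ge0 ?exprn_ge0.
    pose e := gcdn a b. have e0 : (0 < e)%N by rewrite gcdn_gt0 a0.
    case/dvdnP: (dvdn_gcdl a b) => a' ea. case/dvdnP: (dvdn_gcdr a b) => b' eb. rewrite -/e in ea eb *.
    have ay : (a <= y)%N by rewrite -ltnS. have by_ : (b <= y)%N by rewrite -ltnS.
    have a'0 : (0 < a')%N by move: a0; rewrite ea muln_gt0 => /andP [].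
    have b'0 : (0 < b')%N by move: b0; rewrite eb muln_gt0 => /andP [].
    have ey : (e < y.+1)%N by rewrite ltnS; apply: leq_trans ay; rewrite ea leq_pmull.
    have a'y : (a' < y.+1)%N by rewrite ltnS; apply: leq_trans ay; rewrite ea leq_pmulr.
    have b'y : (b' < y.+1)%N by rewrite ltnS; apply: leq_trans by_; rewrite eb leq_pmulr.
    exists (Ordinal ey, (Ordinal a'y, Ordinal b'y)); split=> /=; first by rewrite e0 a'0 b'0.
      by congr (_, _); apply: val_inj; rewrite /= inordK mulnC -?ea -?eb.
    move: (e) ea eb e0 => g ea eb g0.
    rewrite ea eb !natrM {ea eb}. have gp : 1 <= g%:R :> R by rewrite ler1n.
    have ap : 0 < a'%:R :> R by rewrite ltr0n. have bp : 0 < b'%:R :> R by rewrite ltr0n.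
    have -> : g%:R * (((a'%:R * g%:R) ^+ 2)^-1 * ((b'%:R * g%:R) ^+ 2)^-1) = (g%:R ^+ 3)^-1 * ((a'%:R ^+ 2)^-1 * (b'%:R ^+ 2)^-1) :> R.
      by field; lra.
    apply: ler_wpM2r; first by rewrite mulr_ge0 ?invr_ge0 ?exprn_ge0.
    rewrite lef_pV2 ?posrE ?exprn_gt0 ?ltr0n //. exact: ler_weXn2l.
  rewrite -(pair_big (fun c : 'I_y.+1 => (0 < c)%N) (fun u : 'I_y.+1 * 'I_y.+1 => (0 < u.1)%N && (0 < u.2)%N)
    (fun c u => (c%:R ^+ 2)^-1 * ((u.1%:R ^+ 2)^-1 * (u.2%:R ^+ 2)^-1))) /=.
  rewrite -big_distrlr /= -(pair_big (fun c : 'I_y.+1 => (0 < c)%N) (fun c : 'I_y.+1 => (0 < c)%N) (fun c d => (c%:R ^+ 2)^-1 * (d%:R ^+ 2)^-1)) /=.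
  rewrite -big_distrlr /=. have h2 := sum_inv_sq y. set A := \sum_(c < _ | _) _ in h2 *.
  have A0 : 0 <= A by apply: sumr_ge0 => c _; rewrite invr_ge0 exprn_ge0.
  have : A * A <= 4 by nra. nra.
have -> : \sum_(h < H.+1 | (0 < h)%N) rho y (2 * h) ^+ 2 =
  \sum_(t : 'I_y.+1 * 'I_y.+1 | (0 < t.1)%N && (0 < t.2)%N) (t.1%:R^-1 * t.2%:R^-1) *
    (\sum_(h < H.+1 | (0 < h)%N && ((t.1 %| 2 * h)%N && (t.2 %| 2 * h)%N)) 1%N)%:R.
  under eq_bigr => h _ do rewrite expr2 /rho big_distrlr pair_big /= big_mkcond.
  rewrite exchange_big /= [RHS]big_mkcond. apply: eq_bigr => t _.
  rewrite natr_sum mulr_sumr. case: ifP => ht.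
    rewrite big_mkcond [RHS]big_mkcond. apply: eq_bigr => h _. case/andP: ht => -> -> /=.
    by case: (0 < h)%N => //=; case: ifP => _; rewrite ?mulr1.
  rewrite big1 // => h _. case: ifP => // /andP [/andP [a _] /andP [b _]]. by rewrite a b in ht.
apply: le_trans (_ : \sum_(t : 'I_y.+1 * 'I_y.+1 | (0 < t.1)%N && (0 < t.2)%N)
   (gcdn t.1 t.2)%:R * ((t.1%:R ^+ 2)^-1 * (t.2%:R ^+ 2)^-1) * (2 * H%:R) <= _); last first.
  rewrite -mulr_suml -/S. have : 0 <= H%:R :> R by []. nra.
apply: ler_sum => -[a b] /= /andP [a0 b0].
have L0 : (0 < lcmn a b)%N by rewrite lcmn_gt0 a0.
have h1 : (\sum_(h < H.+1 | (0 < h)%N && ((a %| 2 * h)%N && (b %| 2 * h)%N)) 1)%:R * (lcmn a b)%:R <= 2 * H%:R :> R.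
  rewrite -[leRHS]natrM. apply: le_trans (count_multiples (2 * H) L0). apply: ler_wpM2r => //.
  rewrite !natr_sum.
  (* The multiple of the lcm assigned to h is k = 2 h, and halving recovers h. *)
  apply: (@sum_le_cover _ _ _ _ _ _ (fun k : 'I_(2 * H).+1 => inord k./2)) => [k _ //|h /andP [h0 hab]].
  have hH : (2 * h < (2 * H).+1)%N by have := ltn_ord h; lia.
  exists (Ordinal hH) => /=; split=> //; first by rewrite muln_gt0 h0 dvdn_lcm hab.
  by apply: val_inj; rewrite /= mul2n doubleK inordK.
have ap : 0 < a%:R :> R by rewrite ltr0n. have bp : 0 < b%:R :> R by rewrite ltr0n.
have gp : 0 < (gcdn a b)%:R :> R by rewrite ltr0n gcdn_gt0 a0.
have e : (lcmn a b)%:R * (gcdn a b)%:R = a%:R * b%:R :> R by rewrite -!natrM muln_lcm_gcd.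
set n := (\sum_(h < _ | _) 1)%:R in h1 *.
have -> : a%:R^-1 * b%:R^-1 * n = ((gcdn a b)%:R * ((a%:R ^+ 2)^-1 * (b%:R ^+ 2)^-1)) * (n * (lcmn a b)%:R).
  have -> : (gcdn a b)%:R * ((a%:R ^+ 2)^-1 * (b%:R ^+ 2)^-1) * (n * (lcmn a b)%:R) =
    ((lcmn a b)%:R * (gcdn a b)%:R) * ((a%:R ^+ 2)^-1 * (b%:R ^+ 2)^-1) * n by ring.
  rewrite e. by field; lra.
apply: ler_wpM2l => //. by rewrite !mulr_ge0 ?invr_ge0 ?exprn_ge0 ?ltW.
Qed.
End Sums.

(** * Harmonic sums and prime pairs on average *)

Section Logs.
Variable R : realType.

Lemma ln_ratio_le (x y : R) : 0 < x -> 0 < y -> ln x - ln y <= (x - y) / y.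
Proof.
move=> x0 y0. rewrite -ln_div ?posrE //.
have -> : x / y = 1 + (x - y) / y by field; lra.
apply: le_ln1Dx. have h : 0 < x / y by rewrite divr_gt0.
have e : (x - y) / y = x / y - 1 by field; lra. lra.
Qed.

Lemma ln2_half : 2^-1 <= ln 2 :> R.
Proof. have := @ln_ratio_le 1 2 ltr01 (ltr0n R 2); rewrite ln1. lra. Qed.

Lemma ln2_le1 : ln 2 <= 1 :> R.
Proof. have := @ln_ratio_le 2 1 (ltr0n R 2) ltr01; rewrite ln1. lra. Qed.

Lemma harmS y : harm R y.+1 = harm R y + y.+1%:R^-1.
Proof. by rewrite /harm big_mkcond big_ord_recr -big_mkcond. Qed.

Lemma harm_lower y : ln y.+1%:R <= harm R y.
Proof.
elim: y => [|y IH]; first by rewrite ln1 /harm; apply: sumr_ge0 => i _; rewrite invr_ge0.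
rewrite harmS. have := @ln_ratio_le y.+2%:R y.+1%:R (ltr0n _ _) (ltr0n _ _).
have -> : (y.+2%:R - y.+1%:R) / y.+1%:R = y.+1%:R^-1 :> R by rewrite -[y.+2%:R]natr1 addrAC subrr add0r div1r.
by move=> h1; apply: le_trans (_ : ln y.+1%:R + y.+1%:R^-1 <= _); [rewrite -lerBlDl|rewrite lerD2r].
Qed.

Lemma harm_upper y : (0 < y)%N -> harm R y <= 1 + ln y%:R.
Proof.
elim: y => // y IH _. rewrite harmS. case: (posnP y) => [->|y0].
  by rewrite /harm big_mkcond big_ord1 /= ln1 invr1; lra.
have := IH y0. have := @ln_ratio_le y%:R y.+1%:R (_ : 0 < y%:R) (ltr0n _ _); rewrite ltr0n => /(_ y0).
have -> : (y%:R - y.+1%:R) / y.+1%:R = - y.+1%:R^-1 :> R by rewrite -natr1; field; have : 0 <= y%:R :> R by []; lra.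
move: (y.+1%:R^-1 : R) (ln y.+1%:R : R) => u v; lra.
Qed.

Lemma expn_bracket (e N : nat) : (0 < e)%N -> (0 < N)%N -> exists y, (y ^ e <= N < y.+1 ^ e)%N.
Proof.
move=> e0 N0. have ex : exists y, (y ^ e <= N)%N by exists 0%N; rewrite exp0n.
have ub y : (y ^ e <= N)%N -> (y <= N)%N.
  by move=> h; apply: leq_trans h; case: y => // y; rewrite -{1}(expn1 y.+1) leq_pexp2l.
case: (ex_maxnP ex ub) => y hy hmax. exists y. rewrite hy ltnNge. apply/negP => /hmax. by rewrite ltnn.
Qed.

(** Squaring [harm_le_sift] and inserting [sift_harm_sq] gives the constant 2^2 * 2 = 8. *)
Lemma inv_mass_le h y z : (0 < h)%N -> (0 < y)%N -> (y * y <= z)%N ->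
  (mass R h z)^-1 <= 8 * rho R y (2 * h) ^+ 2 / harm R y ^+ 2.
Proof.
move=> h0 y0 yz. have h1 := harm_le_sift R y h0. have h2 := sift_harm_sq R h yz.
have H1 : 1 <= harm R y.
  by case: y y0 {yz h1 h2} => // y _; rewrite harmS; elim: y => [|y IH]; rewrite ?harmS;
     [rewrite /harm big_mkcond big_ord1 /= invr1; lra | apply: le_trans IH _; rewrite lerDl invr_ge0].
have S0 : 0 <= sift_harm R h y by apply: sumr_ge0 => i _; rewrite invr_ge0.
have r0 : 0 <= rho R y (2 * h) by apply: sumr_ge0 => i _; rewrite invr_ge0.
set H := harm R y in h1 H1 *. set S := sift_harm R h y in h1 h2 S0. set r := rho R y _ in h1 r0 *.
set m := mass R h z in h2 *.
have rS : 0 <= r * S by exact: mulr_ge0.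
have r2 : 0 <= r ^+ 2 by exact: sqr_ge0.
have h3 : H ^+ 2 <= 4 * (r ^+ 2) * S ^+ 2 by nra.
have h4 : H ^+ 2 <= 8 * r ^+ 2 * m by nra.
have Hp : 0 < H ^+ 2 by nra.
have m0 : 0 < m.
  rewrite ltNge; apply/negP => m0. nra.
rewrite ler_pdivlMr // mulrC ler_pdivrMr //.
Qed.

(** With y about N^(1/24) and z = y^2, the sieve error (z + 1)^6 is of order N^(1/2) while harm y is
    still at least L / 24. The factor rho^2 is averaged over the shift by [rho_sq_avg]. *)
Lemma pairs_avg : exists C : R, 0 < C /\ forall N H, (1 < N)%N ->
  \sum_(h < H.+1 | (0 < h)%N) (prime_pairs h N)%:R <= C * H%:R * N%:R / ln N%:R ^+ 2.
Proof.
(* 300 * 300 exceeds 128 * 576, from the terms z + 1 and (z + 1)^6. The main term has 4608 = 8 *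
   24^2, and 32 is 2 from N + z <= 2 N times the average 16. *)
exists (300 * 300 + 32 * 4608). split; first by lra. move=> N H N1.
have [y /andP [y1 y2]] := expn_bracket (isT : 0 < 24)%N (ltnW N1).
have y0 : (0 < y)%N by case: y y1 y2 => [_|//]; rewrite exp1n; lia.
have Np : 1 < N%:R :> R by rewrite ltr1n. have L0 : 0 < ln N%:R :> R by exact: ln_gt0.
pose z := (y * y)%N. have z0 : (0 < z)%N by rewrite muln_gt0 y0.
set L := ln N%:R in L0 *.
have hL : L <= 24 * harm R y.
  have h1 : L <= ln (y.+1%:R ^+ 24).
    by rewrite ler_ln ?posrE ?exprn_gt0 ?ltr0n ?(ltnW N1) // -natrX ler_nat ltnW.
  rewrite lnXn ?ltr0n // in h1. apply: le_trans h1 _. rewrite -[leLHS]mulr_natl.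
  by apply: ler_wpM2l => //; exact: harm_lower.
have H0 : 0 < harm R y by have : 0 < 24 * harm R y := lt_le_trans L0 hL; lra.
have yp : 1 <= y%:R :> R by rewrite ler1n.
have hH : harm R y <= y%:R.
  have := harm_upper y0. have := @ln_ratio_le y%:R 1 (lt_le_trans ltr01 yp) ltr01. rewrite ln1 divr1. lra.
have zN : (z <= N)%N.
  have y2y : (y ^ 2 <= y ^ 24)%N by rewrite leq_pexp2l.
  exact: leq_trans y2y y1.
apply: le_trans (_ : \sum_(h < H.+1 | (0 < h)%N) ((z.+1%:R + z.+1%:R ^+ 6) + (N + z)%:R * (8 / harm R y ^+ 2) * rho R y (2 * h) ^+ 2) <= _).
  apply: ler_sum => h h0. apply: le_trans (selberg_sieve R h N z0) _.
  rewrite addrAC lerD2l -mulrA. apply: ler_wpM2l => //.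
  apply: le_trans (inv_mass_le h0 y0 (leqnn _)) _. by rewrite mulrAC.
rewrite big_split /= -mulr_sumr.
have h1 : \sum_(h < H.+1 | (0 < h)%N) (z.+1%:R + z.+1%:R ^+ 6) <= H%:R * (z.+1%:R + z.+1%:R ^+ 6) :> R.
  rewrite big_mkcond big_ord_recl /= add0r. rewrite (eq_bigr (fun=> z.+1%:R + z.+1%:R ^+ 6)) // sumr_const card_ord.
  by rewrite mulr_natl.
have h2 := rho_sq_avg R y H.
have Hn : 0 <= H%:R :> R by [].
have h3 : z.+1%:R + z.+1%:R ^+ 6 <= 128 * y%:R ^+ 12 :> R.
  have e1 : z.+1%:R <= 2 * y%:R ^+ 2 :> R by rewrite -natr1 /z natrM; nra.
  have e2 : z.+1%:R ^+ 6 <= (2 * y%:R ^+ 2) ^+ 6 :> R by apply: lerXn2r; rewrite ?nnegrE // mulr_ge0 ?exprn_ge0.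
  have e3 : (2 * y%:R ^+ 2) ^+ 6 = 64 * y%:R ^+ 12 :> R by ring.
  have e4 : y%:R ^+ 2 <= y%:R ^+ 12 :> R by apply: ler_weXn2l.
  have e5 : 0 <= y%:R ^+ 12 :> R by exact: exprn_ge0.
  lra.
have h4 : 128 * y%:R ^+ 12 <= (300 * 300) * (N%:R / L ^+ 2).
  rewrite mulrA ler_pdivlMr ?exprn_gt0 //.
  have l1 : L <= 24 * y%:R by lra.
  have l2 : L ^+ 2 <= 576 * y%:R ^+ 12.
    apply: le_trans (_ : (24 * y%:R) ^+ 2 <= _); first by apply: lerXn2r; rewrite ?nnegrE ?(ltW L0) // mulr_ge0.
    have : y%:R ^+ 2 <= y%:R ^+ 12 :> R by apply: ler_weXn2l. move=> ?. rewrite exprMn. nra.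
  have l3 : y%:R ^+ 12 * y%:R ^+ 12 <= N%:R :> R by rewrite -exprD -natrX ler_nat.
  have l4 : 0 <= y%:R ^+ 12 :> R by exact: exprn_ge0.
  have : y%:R ^+ 12 * L ^+ 2 <= y%:R ^+ 12 * (576 * y%:R ^+ 12) by apply: ler_wpM2l.
  nra.
have h5 : 8 / harm R y ^+ 2 <= 4608 / L ^+ 2.
  rewrite ler_pdivrMr ?exprn_gt0 // mulrAC ler_pdivlMr ?exprn_gt0 //.
  have : L ^+ 2 <= (24 * harm R y) ^+ 2 by apply: lerXn2r; rewrite ?nnegrE ?(ltW L0) // mulr_ge0 // ltW.
  rewrite exprMn. lra.
have h6 : (N + z)%:R <= 2 * N%:R :> R.
  have zN' : z%:R <= N%:R :> R by rewrite ler_nat.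
  by rewrite natrD; lra.
have rn : 0 <= \sum_(h < H.+1 | (0 < h)%N) rho R y (2 * h) ^+ 2 by apply: sumr_ge0 => i _; exact: sqr_ge0.
have i0 : 0 <= 8 / harm R y ^+ 2 by rewrite divr_ge0 // exprn_ge0 // ltW.
have h7 : (N + z)%:R * (8 / harm R y ^+ 2) <= (2 * N%:R) * (4608 / L ^+ 2) by apply: ler_pM.
have h8 := ler_pM (mulr_ge0 (ler0n R (N + z)) i0) rn h7 h2.
have h9 : H%:R * (z.+1%:R + z.+1%:R ^+ 6) <= H%:R * ((300 * 300) * (N%:R / L ^+ 2)).
  by apply: ler_wpM2l => //; apply: le_trans h3 h4.
apply: le_trans (lerD (le_trans h1 h9) h8) _.
rewrite le_eqVlt; apply/orP; left; apply/eqP. field. lra.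
Qed.
End Logs.

(** * Level sets of the distance to the next prime *)

Lemma next_prime_distP n : [/\ (0 < next_prime_dist n)%N, prime (n + next_prime_dist n) &
  forall b, (0 < b)%N -> prime (n + b) -> (next_prime_dist n <= b)%N].
Proof.
rewrite /next_prime_dist. case: ex_minnP => m /andP [m0 pm] hm; split=> // b b0 pb.
by apply: hm; rewrite b0.
Qed.

Section Assembly.
Variable R : realType.

Definition level N j : R := \sum_(n < N.+1 | (0 < n)%N && (next_prime_dist n == j)) 1.

Lemma sum_indicator (I : finType) (P : pred I) : \sum_(i | P i) 1 = \sum_i (P i)%:R :> R.
Proof. by rewrite big_mkcond; apply: eq_bigr => i _; case: (P i). Qed.

Lemma primepi_sum M : (primepi M)%:R = \sum_(p < M.+1 | prime p) 1 :> R.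
Proof. by rewrite /PrimeCount.primepi natr_sum. Qed.

Lemma primepiD N j : (primepi (N + j))%:R <= (primepi N)%:R + j%:R :> R.
Proof.
elim: j => [|j IH]; first by rewrite addn0 addr0.
rewrite addnS primepi_sum big_mkcond big_ord_recr -big_mkcond /= -primepi_sum -[j.+1%:R]natr1 addrA.
by apply: lerD => //; case: ifP.
Qed.

Lemma level_upper N j : level N j <= (primepi N)%:R + j%:R.
Proof.
apply: le_trans (primepiD N j). rewrite primepi_sum.
apply: (@sum_le_cover R _ _ _ _ (fun=> 1) (fun=> 1) (fun p : 'I_(N + j).+1 => (inord (p - j) : 'I_N.+1))) => // n /andP [n0 /eqP nj].
have [_ pr _] := next_prime_distP n. rewrite nj in pr.
have h : (n + j < (N + j).+1)%N by rewrite ltnS leq_add2r -ltnS.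
exists (Ordinal h); split=> //=. by apply: val_inj; rewrite /= addnK inordK.
Qed.

(** Let q be a prime with j < q <= N and n = q - j. If a_n differs from j, then n + a_n is a prime q
    - i with 0 < i < j, so q closes a prime pair of difference i. The primes q <= j are paid for by
    j + 1. *)
Lemma level_lower N j : (0 < j)%N ->
  (primepi N)%:R - j.+1%:R - \sum_(i < j.+1 | (0 < i)%N) (prime_pairs i N)%:R <= level N j.
Proof.
move=> j0.
have h1 : \sum_(q < N.+1 | prime q && (j < q)%N && (next_prime_dist (q - j) == j)) 1 <= level N j :> R.
  apply: (@sum_le_cover R _ _ _ _ (fun=> 1) (fun=> 1) (fun n : 'I_N.+1 => (inord (n + j) : 'I_N.+1))) => // q /andP [/andP [pq jq] hq].
  have h : (q - j < N.+1)%N by apply: leq_ltn_trans (ltn_ord q); exact: leq_subr.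
  exists (Ordinal h); split=> //=; first by rewrite hq subn_gt0 jq.
  by apply: val_inj; rewrite /= subnK ?inordK // ltnW.
have h2 (i : nat) : (0 < i)%N -> \sum_(q < N.+1 | prime q && ((i < q)%N && prime (q - i))) 1 <= (prime_pairs i N)%:R :> R.
  move=> i0. rewrite /prime_pairs natr_sum.
  apply: (@sum_le_cover R _ _ _ _ (fun=> 1) (fun=> 1) (fun n : 'I_N => (inord (n + i) : 'I_N.+1))) => // q /andP [pq /andP [iq pqi]].
  have h : (q - i < N)%N by have := ltn_ord q; lia.
  exists (Ordinal h); split=> //=; first by rewrite pqi subnK // ltnW.
  by apply: val_inj; rewrite /= subnK ?inordK // ltnW.
have h3 : (primepi N)%:R <= \sum_(q < N.+1 | (q < j.+1)%N) 1 + \sum_(q < N.+1 | prime q && (j < q)%N && (next_prime_dist (q - j) == j)) 1 +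
   \sum_(i < j.+1 | (0 < i)%N) \sum_(q < N.+1 | prime q && ((i < q)%N && prime (q - i))) 1 :> R.
  rewrite primepi_sum !sum_indicator. under [X in _ + X]eq_bigr => i _ do rewrite sum_indicator.
  rewrite exchange_big /= -!big_split /=. apply: ler_sum => q _.
  case pq: (prime q); last by rewrite addr_ge0 ?addr_ge0 //; apply: sumr_ge0.
  case: (ltnP q j.+1) => qj /=; first by rewrite -addrA lerDl addr_ge0 //; apply: sumr_ge0.
  rewrite add0r.
  have [a0 pa ha] := next_prime_distP (q - j). set a := next_prime_dist (q - j) in a0 pa ha *.
  have aj : (a <= j)%N by apply: ha => //; rewrite subnK ?pq // ltnW.
  case: eqP => [_|/eqP aj']; first by rewrite lerDl; apply: sumr_ge0.
  have ij : (j - a < j.+1)%N by rewrite ltnS leq_subr.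
  have i0 : (0 < j - a)%N by rewrite subn_gt0 ltn_neqAle aj'.
  rewrite add0r (bigD1 (Ordinal ij)) //=.
  have -> : (j - a < q)%N by lia.
  have -> : (q - (j - a) = q - j + a)%N by lia.
  by rewrite pa lerDl; apply: sumr_ge0.
have h4 : \sum_(q < N.+1 | (q < j.+1)%N) 1 <= j.+1%:R :> R.
  by apply: le_trans (sum_const_lt_le N.+1 j.+1 ler01) _; rewrite sumr_const card_ord.
have h5 : \sum_(i < j.+1 | (0 < i)%N) \sum_(q < N.+1 | prime q && ((i < q)%N && prime (q - i))) 1
  <= \sum_(i < j.+1 | (0 < i)%N) (prime_pairs i N)%:R :> R by apply: ler_sum => i; exact: h2.
rewrite lerBlDr lerBlDr. apply: le_trans h3 _. apply: le_trans (lerD (lerD h4 h1) h5) _. by rewrite -addrA addrC.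
Qed.

(** Each n with a_n > J contributes at most 1 / (J + 1). *)
Lemma sum_levels N J : \sum_(j < J.+1 | (0 < j)%N) j%:R^-1 * level N j <=
  \sum_(n < N.+1 | (0 < n)%N) ((next_prime_dist n)%:R)^-1 <= \sum_(j < J.+1 | (0 < j)%N) j%:R^-1 * level N j + N%:R / J.+1%:R.
Proof.
have -> : \sum_(j < J.+1 | (0 < j)%N) j%:R^-1 * level N j =
  \sum_(n < N.+1 | (0 < n)%N) \sum_(j < J.+1 | (0 < j)%N) (next_prime_dist n == j)%:R * j%:R^-1.
  rewrite exchange_big /=. apply: eq_bigr => j j0. rewrite /level mulr_sumr big_mkcondr /=.
  by apply: eq_bigr => n _; case: eqP; rewrite ?mulr1 ?mul1r ?mul0r.
have pt n : (0 < n)%N -> \sum_(j < J.+1 | (0 < j)%N) (next_prime_dist n == j)%:R * j%:R^-1 =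
   if (next_prime_dist n < J.+1)%N then ((next_prime_dist n)%:R)^-1 else 0 :> R.
  move=> n0. have [a0 _ _] := next_prime_distP n. set a := next_prime_dist n in a0 *.
  case: (ltnP a J.+1) => aJ.
    rewrite (bigD1 (Ordinal aJ)) //= eqxx mul1r big1 ?addr0 // => j /andP [_ ja].
    by case: eqP => [e|]; rewrite ?mul0r //; case/eqP: ja; apply: val_inj.
  by rewrite big1 // => j _; case: eqP => [e|]; rewrite ?mul0r //; have := ltn_ord j; rewrite -e ltnNge aJ.
apply/andP; split.
  by apply: ler_sum => n n0; rewrite pt //; case: ifP => // _; rewrite invr_ge0.
have -> : N%:R / J.+1%:R = \sum_(n < N.+1 | (0 < n)%N) J.+1%:R^-1 :> R.
  by rewrite big_mkcond big_ord_recl /= add0r sumr_const card_ord mulr_natl.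
rewrite -big_split /=. apply: ler_sum => n n0. rewrite pt //.
have [a0 _ _] := next_prime_distP n.
case: ltnP => aJ; first by rewrite lerDl invr_ge0.
by rewrite add0r lef_pV2 ?posrE ?ltr0n // ler_nat.
Qed.
End Assembly.

(** * Summation over the level sets and passage to real x *)

Section Final.
Variable R : realType.

Lemma ler_ln_nat (m n : nat) : (0 < m)%N -> (m <= n)%N -> ln m%:R <= ln n%:R :> R.
Proof. by move=> m0 mn; rewrite ler_ln ?posrE ?ltr0n ?ler_nat //; apply: leq_trans mn. Qed.

Lemma ler_ln_pos (x y : R) : 0 < x -> x <= y -> ln x <= ln y.
Proof. by move=> x0 xy; rewrite ler_ln ?posrE //; apply: lt_le_trans xy. Qed.

(** For k the integer part of log_2 log_2 N, 1 + ln ln N <= k + 2 <= 3 k. *)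
Lemma pnt_loglog : exists C : R, 0 < C /\ forall N, (16 <= N)%N ->
  `|(primepi N)%:R * ln N%:R - N%:R| * (1 + ln (ln N%:R)) <= C * N%:R.
Proof.
have [C H] := @pnt_bound R. exists (3 * C%:R + 1).
split; first by have : 0 <= C%:R :> R by []; lra.
move=> N N16. have N0 : (0 < N)%N by lia.
set a := trunc_log 2 N. set k := trunc_log 2 a.
have a4 : (4 <= a)%N by rewrite /a; apply: trunc_log_max.
have k1 : (2 <= k)%N by rewrite /k; apply: trunc_log_max.
have hk : (2 ^ (2 ^ k) <= N)%N.
  apply: leq_trans (trunc_logP (isT : 1 < 2)%N N0). by rewrite leq_exp2l //; apply: trunc_logP => //; lia.
have hN : (N <= 2 ^ (2 ^ k.+1))%N.
  apply: leq_trans (ltnW (trunc_log_ltn N (isT : 1 < 2)%N)) _. by rewrite leq_exp2l //; apply: trunc_log_ltn.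
have l2 := @ln2_half R. have l2' := @ln2_le1 R.
have hL : ln N%:R <= 2 ^+ k.+1 :> R.
  apply: le_trans (ler_ln_nat N0 hN) _. by rewrite natrX lnXn // -[leLHS]mulr_natr natrX ler_piMl ?exprn_ge0.
have L1 : 0 < ln N%:R :> R by rewrite ln_gt0 // ltr1n; lia.
have hl : ln (ln N%:R) <= k.+1%:R :> R.
  apply: le_trans (ler_ln_pos L1 hL) _. by rewrite lnXn // -[leLHS]mulr_natr ler_piMl.
have h := H N k hk. move: h hl. set E := `|_|. rewrite -natr1 => h hl.
have k2 : 1 <= k%:R :> R by rewrite ler1n; lia.
have E0 : 0 <= E by exact: normr_ge0.
apply: le_trans (_ : E * (3 * k%:R) <= _); first by apply: ler_wpM2l => //; lra.
have N1 : 0 <= N%:R :> R by []. rewrite mulrCA. clear -h N1. lra.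
Qed.

Definition inv_dist_sum N : R := \sum_(n < N.+1 | (0 < n)%N) ((next_prime_dist n)%:R)^-1.

Lemma cube_ln_le (N : nat) : (0 < N)%N -> ln N%:R ^+ 3 <= 6 * N%:R :> R.
Proof.
move=> N0. have N1 : 0 < N%:R :> R by rewrite ltr0n.
have L0 : 0 <= ln N%:R :> R by rewrite ln_ge0 // ler1n.
have := @exp.expR_ge1Dxn R _ 2 L0. rewrite lnK ?posrE //.
have -> : (3`!)%:R = 6 :> R by []. lra.
Qed.

Lemma sum_inv_mul (J : nat) (c : R) : \sum_(j < J.+1 | (0 < j)%N) j%:R^-1 * (c * j%:R) = J%:R * c.
Proof.
rewrite (eq_bigr (fun=> c)) => [|j j0]; last by rewrite mulrCA mulVf ?mulr1 // pnatr_eq0 -lt0n.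
by rewrite big_mkcond big_ord_recl /= add0r sumr_const card_ord mulr_natl.
Qed.

Lemma harm_sum (J : nat) (c : R) : \sum_(j < J.+1 | (0 < j)%N) j%:R^-1 * c = c * harm R J.
Proof. by rewrite -mulr_suml mulrC. Qed.

(** Cutting at J, the integer part of L = ln N, balances the tail N / J against the pair error J N /
    L^2, both of order N / L; the terms of size J are absorbed through [cube_ln_le]. As harm J lies
    between ln L and 1 + ln L, [pnt_loglog] controls its product with the error of pi(N). *)
Lemma inv_dist_sum_nat : exists C : R, 0 < C /\ forall N, (16 <= N)%N ->
  `|inv_dist_sum N * ln N%:R - N%:R * ln (ln N%:R)| <= C * N%:R.
Proof.
have [C1 [C10 H1]] := pnt_loglog. have [C2 [C20 H2]] := @pairs_avg R.
exists (C1 + C2 + 12). split; first by lra.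
move=> N N16. have N0 : (0 < N)%N by lia.
have Np : 0 < N%:R :> R by rewrite ltr0n.
have h1 := H1 N N16. have h2 (h : nat) := H2 N h (ltac:(lia) : (1 < N)%N).
have h3 := cube_ln_le N0.
have l2 := @ln2_half R.
have L2 : 2 <= ln N%:R :> R.
  apply: le_trans (ler_ln_nat (isT : 0 < 16)%N N16).
  have -> : 16%:R = 2 ^+ 4 :> R by rewrite -natrX. rewrite lnXn // -[leRHS]mulr_natr. lra.
have hS : inv_dist_sum N = inv_dist_sum N by [].
have := sum_levels R N (Num.truncn (ln N%:R : R)).
rewrite -/(inv_dist_sum N).
set S := inv_dist_sum N. set L := ln N%:R in h1 h2 h3 L2 *. set l := ln L in h1 *.
set J := Num.truncn _. set P := (primepi N)%:R in h1 *.
have [J1 J2] : J%:R <= L /\ L < J.+1%:R.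
  have L0 : 0 <= L by lra. by have := truncn_itv L0 => /andP.
have J0 : (0 < J)%N by rewrite /J truncn_gt0; lra.
have Jp : 1 <= J%:R :> R by rewrite ler1n.
have l0 : 0 <= l by rewrite /l ln_ge0 //; lra.
have H0 : l <= harm R J by apply: le_trans (harm_lower R J); apply: ler_ln_pos; lra.
have H3 : harm R J <= 1 + l.
  apply: le_trans (harm_upper R J0) _. by rewrite lerD2l; apply: ler_ln_pos; lra.
move=> /andP [lo up].
have up2 : S <= P * harm R J + J%:R + N%:R / J.+1%:R.
  apply: le_trans up _. rewrite lerD2r.
  rewrite -harm_sum. have e := sum_inv_mul J (1 : R). rewrite mulr1 in e. rewrite -e -big_split /=.
  apply: ler_sum => j j0. rewrite -mulrDr mul1r. apply: ler_wpM2l; [by rewrite invr_ge0|exact: level_upper].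
(* The weight 1 / j cancels the factor j of the pair bound, so all levels contribute alike; 2 J
   comes from j + 1 <= 2 j. *)
have lo2 : P * harm R J - 2 * J%:R - J%:R * (C2 * N%:R / L ^+ 2) <= S.
  apply: le_trans lo. rewrite -harm_sum (mulrC 2) -(sum_inv_mul J 2) -(sum_inv_mul J (C2 * N%:R / L ^+ 2)) -!sumrB.
  apply: ler_sum => j j0. rewrite -!mulrBr. apply: ler_wpM2l; first by rewrite invr_ge0.
  apply: le_trans (level_lower R N j0). rewrite -/P.
  have := h2 j. have j1 : 1 <= j%:R :> R by rewrite ler1n.
  rewrite -natr1 [C2 * j%:R]mulrC -!mulrA !(mulrC j%:R) !mulrA.
  move: (\sum_(i < _ | _) _) => s; move: (_ / _ * _) => t. lra.
have Lp : 0 < L by lra.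
have a1 : J%:R * L <= 3 * N%:R.
  apply: le_trans (_ : L ^+ 2 <= _); first by rewrite expr2 ler_pM2r.
  have : 2 * L ^+ 2 <= L ^+ 3 by rewrite [L ^+ 3]exprSr mulrC ler_pM2l ?exprn_gt0.
  lra.
have a2 : N%:R / J.+1%:R * L <= N%:R.
  by rewrite mulrAC ler_pdivrMr ?ltr0n // ler_pM2l // ltW.
have a3 : J%:R * (C2 * N%:R / L ^+ 2) * L <= C2 * N%:R.
  have -> : J%:R * (C2 * N%:R / L ^+ 2) * L = C2 * N%:R * J%:R / L by field; lra.
  by rewrite ler_pdivrMr // ler_pM2l // mulr_gt0.
have a4 : `|(P * L - N%:R) * harm R J| <= C1 * N%:R.
  apply: le_trans h1. rewrite normrM (ger0_norm (le_trans l0 H0)). exact: ler_wpM2l.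
move: (ler_wpM2r (ltW Lp) up2) (ler_wpM2r (ltW Lp) lo2).
rewrite !mulrDl !mulNr.
have b1 : N%:R * l <= N%:R * harm R J by rewrite ler_pM2l.
have b2 : N%:R * harm R J <= N%:R + N%:R * l by have : N%:R * harm R J <= N%:R * (1 + l); [rewrite ler_pM2l|rewrite mulrDr mulr1].
move: a4 a2 a3. rewrite !ler_norml mulrBl => /andP [a4 a5].
move: (_ / J.+1%:R * L) (J%:R * _ * L) => u v a2 a3 e1 e2.
have e : P * harm R J * L = P * L * harm R J by rewrite mulrAC.
rewrite e in e1 e2. clear -a1 a2 a3 a4 a5 b1 b2 e1 e2 Np C10 C20.
apply/andP; split; nra.
Qed.

Lemma ln3_lower : 2 / 3 <= ln 3 :> R.
Proof. have := @ln_ratio_le R 1 3 ltr01 (ltr0n R 3); rewrite ln1. lra. Qed.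

Lemma inv_dist_sum_le N : 0 <= inv_dist_sum N <= N%:R.
Proof.
apply/andP; split; first by apply: sumr_ge0 => n _; rewrite invr_ge0.
apply: le_trans (_ : \sum_(n < N.+1 | (0 < n)%N) 1 <= _).
  apply: ler_sum => n n0. have [a0 _ _] := next_prime_distP n. by rewrite invf_le1 ?ltr0n // ler1n.
by rewrite big_mkcond big_ord_recl /= add0r sumr_const card_ord.
Qed.

Lemma lnln_bound (x : R) : 3 <= x -> - 2^-1 <= ln (ln x) <= x.
Proof.
move=> x3. have L0 : 2 / 3 <= ln x by apply: le_trans ln3_lower _; apply: ler_ln_pos => //; lra.
apply/andP; split.
  apply: le_trans (_ : ln (2 / 3) <= _); last by apply: ler_ln_pos => //; lra.
  have := @ln_ratio_le R 1 (2 / 3) ltr01 (ltac:(lra)). rewrite ln1.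
  have -> : (1 - 2 / 3) / (2 / 3) = 2^-1 :> R by field. lra.
have h1 := @ln_sublinear R x (ltac:(lra)).
have h2 := @ln_sublinear R (ln x) (ltac:(lra)). lra.
Qed.

Lemma inv_dist_sum_nat3 : exists C : R, 0 < C /\ forall N, (3 <= N)%N ->
  `|inv_dist_sum N * ln N%:R - N%:R * ln (ln N%:R)| <= C * N%:R.
Proof.
have [C [C0 H]] := inv_dist_sum_nat. exists (C + 32). split; first by lra.
move=> N N3. have Np : 3 <= N%:R :> R by rewrite ler_nat.
case: (leqP 16 N) => N16; first by have := H N N16; lra.
have N16' : N%:R <= 16 :> R by rewrite ler_nat ltnW.
have h1 := inv_dist_sum_le N. have h2 := lnln_bound Np.
have h3 : 0 <= (ln N%:R : R) <= N%:R.
  by rewrite ln_ge0 ?(ltW (ln_sublinear _)) //; lra.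
move: (inv_dist_sum N) (ln N%:R : R) (ln (ln N%:R : R)) h1 h2 h3 => S L l /andP [s1 s2] /andP [l1 l2] /andP [L1 L2].
have a1 : S * L <= 16 * N%:R by apply: ler_pM; lra.
have a2 : 0 <= S * L by rewrite mulr_ge0.
have a3 : N%:R * l <= 16 * N%:R by rewrite mulrC ler_pM2r; lra.
have a4 : - N%:R <= N%:R * l by rewrite -mulrN1 ler_pM2l; lra.
have a5 : 0 <= C * N%:R by rewrite mulr_ge0 //; lra.
rewrite ler_norml. clear N3 N16 H. lra.
Qed.

(** As x - N < 1, replacing N by x inside ln and ln ln changes the two products by O(1), because the
    sum is at most N and N (ln x - ln N) <= 1. The remaining (x - N) ln ln x is at most x. *)
Lemma inv_dist_sum_real : exists C : R, 0 < C /\ forall x : R, 3 <= x ->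
  `|inv_dist_sum (Num.truncn x) * ln x - x * ln (ln x)| <= C * x.
Proof.
have [C [C0 H]] := inv_dist_sum_nat3. exists (C + 4). split; first by lra.
move=> x x3. set N := Num.truncn x.
have [N1 N2] : N%:R <= x /\ x < N.+1%:R.
  have x0 : 0 <= x by lra. by have := truncn_itv x0 => /andP.
have N3 : (3 <= N)%N by rewrite /N truncn_ge_nat //; lra.
have Np : 3 <= N%:R :> R by rewrite ler_nat.
have h := H N N3. have hS := inv_dist_sum_le N. have hl := lnln_bound x3.
rewrite -natr1 in N2.
have L3 : 2 / 3 <= ln N%:R :> R by apply: le_trans ln3_lower _; apply: ler_ln_pos => //; lra.
have LL : ln N%:R <= ln x by apply: ler_ln_pos => //; lra.
have ll : ln (ln N%:R) <= ln (ln x) by apply: ler_ln_pos => //; lra.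
have e1 : N%:R * (ln x - ln N%:R) <= 1.
  have := @ln_ratio_le R x N%:R (ltac:(lra)) (ltac:(lra)). rewrite ler_pdivlMr; [lra|lra].
have e2 : N%:R * (ln (ln x) - ln (ln N%:R)) <= 3 / 2.
  have := @ln_ratio_le R (ln x) (ln N%:R) (ltac:(lra)) (ltac:(lra)).
  rewrite ler_pdivlMr; last by lra.
  move: (ln x) (ln N%:R) (ln (ln x)) (ln (ln N%:R)) ll LL L3 e1 => L' L l' l ll LL L3 e1 e.
  have : N%:R * ((l' - l) * (2 / 3)) <= N%:R * (L' - L).
    apply: ler_wpM2l; first by lra. apply: le_trans e. apply: ler_wpM2l; lra.
  lra.
move: (inv_dist_sum N) (ln x) (ln N%:R) (ln (ln x)) (ln (ln N%:R)) h hS hl LL ll e1 e2 => S L' L l' l h hS hl LL ll e1 e2.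
have b1 : 0 <= S * (L' - L) <= 1.
  case/andP: hS => s1 s2. rewrite mulr_ge0 ?subr_ge0 //=. apply: le_trans e1. apply: ler_wpM2r => //; lra.
have b2 : 0 <= N%:R * (l' - l) by rewrite mulr_ge0 ?subr_ge0 //; lra.
have b3 : - 2^-1 <= (x - N%:R) * l' <= x.
  case/andP: hl => s1 s2. apply/andP; split; nra.
have -> : S * L' - x * l' = (S * L - N%:R * l) + S * (L' - L) - N%:R * (l' - l) - (x - N%:R) * l' by ring.
have b4 : C * N%:R <= C * x by rewrite ler_pM2l.
move: (S * L - _) (S * (_ - _)) (N%:R * (_ - _)) ((x - _) * _) h b1 b2 b3 e2 => u v w z h /andP [b1 b1'] b2 /andP [b3 b3'] e2.
move: h; rewrite !ler_norml => /andP [h h']. clear N3 hS hl e1 H. lra.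
Qed.
End Final.

Theorem theorem2 (R : realType) :
  exists2 C : R, 0 < C &
    forall x : R, 3 <= x ->
      `| \sum_(1 <= n < (Num.truncn x).+1) ((next_prime_dist n)%:R)^-1
         - x * ln (ln x) / ln x | <= C * (x / ln x).
Proof.
have [C [C0 H]] := inv_dist_sum_real R. exists C => // x x3.
have L0 : 0 < ln x by rewrite ln_gt0 //; lra.
have -> : \sum_(1 <= n < (Num.truncn x).+1) ((next_prime_dist n)%:R)^-1 = inv_dist_sum R (Num.truncn x).
  by rewrite big_add1 big_mkord /inv_dist_sum [RHS]big_mkcond big_ord_recl /= add0r.
have -> : inv_dist_sum R (Num.truncn x) - x * ln (ln x) / ln x =
  (inv_dist_sum R (Num.truncn x) * ln x - x * ln (ln x)) / ln x by field; lra.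
by rewrite normrM normfV (gtr0_norm L0) mulrA ler_pM2r ?invr_gt0 //; exact: H.
Qed.
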